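(* Let $\Omega$ be a domain in $\mathbb{R}^N$, let $\mathscr{A}^{hk}(x)=\{a^{hk}_{ij}(x)\}$ ($1\le i,j\le m$, $1\le h,k\le N$) be $m\times m$ matrices with complex valued $L^\infty(\Omega)$ entries, and let $\varphi$ satisfy conditions (i)-(v) of the context. The operator $A=\partial_h(\mathscr{A}^{hk}(x)\partial_k)$ is $L^\Phi$-dissipative if and only if $$\operatorname{Re}\int_\Omega\Big(\langle\mathscr{A}^{hk}\partial_kv,\partial_hv\rangle+\Lambda(|v|)|v|^{-2}\langle(\mathscr{A}^{hk}-(\mathscr{A}^{kh})^* )v,\partial_hv\rangle\operatorname{Re}\langle v,\partial_kv\rangle-\Lambda^2(|v|)|v|^{-4}\langle\mathscr{A}^{hk}v,v\rangle\operatorname{Re}\langle v,\partial_kv\rangle\operatorname{Re}\langle v,\partial_hv\rangle\Big)dx\ge0$$ for any $v\in[\mathring{H}^1(\Omega)]^m$, where the terms containing $\Lambda$ in the integrand are extended by zero on the set where $v$ vanishes.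
   Context: Conditions on $\varphi:(0,+\infty)\to(0,+\infty)$: (i) $\varphi\in C^1((0,+\infty))$; (ii) $(s\varphi(s))'>0$ for all $s>0$; (iii) the range of the strictly increasing function $s\varphi(s)$ is $(0,+\infty)$; (iv) there exist constants $C_1,C_2>0$, $r>-1$ and $s_0>0$ such that $C_1s^r\le(s\varphi(s))'\le C_2s^r$ for $s\in(0,s_0)$; if $r=0$ one requires moreover that the finite limit $\lim_{s\to0^+}\varphi(s)$ exists and is $>0$, and $\lim_{s\to0^+}s\varphi'(s)=0$; (v) there exists $s_1>s_0$ such that either $\varphi'(s)\ge0$ for all $s\ge s_1$ or $\varphi'(s)\le0$ for all $s\ge s_1$. The function $s\mapsto s\sqrt{\varphi(s)}$ is a strictly increasing bijection of $(0,+\infty)$ with $C^1$ inverse $\zeta(t)$; set $\Theta(t)=\zeta(t)/t$ and $\Lambda(t)=t\,\Theta'(t)/\Theta(t)$; equivalently $\Lambda(s\sqrt{\varphi(s)})=-\frac{s\varphi'(s)}{s\varphi'(s)+2\varphi(s)}$ for $s>0$. $\Phi(s)=\int_0^s\sigma\varphi(\sigma)d\sigma$ is only used in the name ''$L^\Phi$-dissipative''. Summation over repeated indices is understood; $\langle\cdot,\cdot\rangle$ is the standard Hermitian inner product of $\mathbb{C}^m$; $\mathscr{A}^*$ is the conjugate transpose. $\mathring{H}^1(\Omega)$ is the closure of the complex valued $C_c^\infty(\Omega)$ in the $H^1$ norm. The operator $A$ is $L^\Phi$-dissipative (functional dissipative) if $\operatorname{Re}\int_\Omega\langle\mathscr{A}^{hk}\partial_ku,\partial_h(\varphi(|u|)u)\rangle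 dx\ge0$ for any $u\in[\mathring{H}^1(\Omega)]^m$ such that $\varphi(|u|)u\in[\mathring{H}^1(\Omega)]^m$ (with $\varphi(|u|)u:=0$ where $u=0$). *)

(* Defs.v *)
From HB Require Import structures.
From mathcomp Require Import all_boot all_order all_algebra.
From mathcomp Require Import all_classical all_reals all_analysis.
From mathcomp Require Import complex.

Set Implicit Arguments.
Unset Strict Implicit.
Unset Printing Implicit Defensive.

Import Order.TTheory GRing.Theory Num.Theory.
Import numFieldNormedType.Exports.

Local Open Scope classical_set_scope.
Local Open Scope ring_scope.

(* 'rV[R]_n carries the sigma-algebra generated by the coordinates, i.e. the
   Borel sets of R^n, and its Lebesgue measure is the n-fold product of
   [lebesgue_measure], built by induction on n through the splitting
   'rV_(1 + n) = R * 'rV_n; see [lebesgue_rV_box]. *)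

Definition measure_matrix_display : measure_display -> measure_display.
Proof. exact. Qed.

Section measurable_matrix.
Context {d} {T : sigmaRingType d} (m n : nat).

Definition measurable_matrix : set (set 'M[T]_(m, n)) :=
  <<s [set A | exists i j, preimage_set_system setT
                             (fun M : 'M[T]_(m, n) => M i j) measurable A] >>.

Let measurable_matrix0 : measurable_matrix set0.
Proof. exact: sigma_algebra0. Qed.

Let measurable_matrixC A : measurable_matrix A -> measurable_matrix (~` A).
Proof. exact: sigma_algebraC. Qed.

Let measurable_matrix_bigcup (F : (set _)^nat) :
  (forall i, measurable_matrix (F i)) -> measurable_matrix (\bigcup_i (F i)).
Proof. exact: sigma_algebra_bigcup. Qed.

HB.instance Definition _ := @isMeasurable.Build (measure_matrix_display d)
  'M[T]_(m, n) measurable_matrix measurable_matrix0 measurable_matrixC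
  measurable_matrix_bigcup.

End measurable_matrix.

Lemma measurable_entry d (T : sigmaRingType d) m n (i : 'I_m) (j : 'I_n) :
  measurable_fun [set: 'M[T]_(m, n)] (fun M : 'M[T]_(m, n) => M i j).
Proof.
move=> _ Y mY; apply: sub_sigma_algebra; exists i, j; by exists Y.
Qed.

Lemma measurable_fun_matrix d d' (S : measurableType d') (T : sigmaRingType d)
    m n (f : S -> 'M[T]_(m, n)) :
  (forall i j, measurable_fun setT (fun x => f x i j)) ->
  measurable_fun setT f.
Proof.
move=> mf _ A mA; move: A mA.
have : @measurable_matrix _ T m n `<=` image_set_system setT f measurable.
  apply: smallest_sub; first exact/sigma_algebra_image/sigma_algebra_measurable.
  move=> A [i [j [B mB <-]]]; rewrite /image_set_system/= !setTI.
  by have := mf i j measurableT _ mB; rewrite setTI.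
by move=> + A mA => /(_ A mA).
Qed.

Section lebesgue_rV.
Context {R : realType}.

Definition consrV n (p : measurableTypeR R * 'rV[R]_n) : 'rV[R]_(1 + n) :=
  row_mx (const_mx p.1 : 'rV_1) p.2.

Lemma consrVl n (p : measurableTypeR R * 'rV[R]_n) i j :
  consrV p i (lshift n j) = p.1.
Proof. by rewrite row_mxEl mxE. Qed.

Lemma consrVr n (p : measurableTypeR R * 'rV[R]_n) i j :
  consrV p i (rshift 1 j) = p.2 i j.
Proof. by rewrite row_mxEr. Qed.

Lemma measurable_consrV n : measurable_fun [set: measurableTypeR R * 'rV[R]_n] (@consrV n).
Proof.
apply: measurable_fun_matrix => i j.
case: (@split_ordP 1 n j) => k ->.
  rewrite (_ : (fun _ => _) = fst); first exact: measurable_fst.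
  by apply/funext => x; exact: consrVl.
rewrite (_ : (fun _ => _) = (fun v : 'rV_n => v i k) \o snd).
  by apply: measurableT_comp; [exact: measurable_entry|exact: measurable_snd].
by apply/funext => x; exact: consrVr.
Qed.

Lemma measurable_rsubrV n :
  measurable_fun [set: 'rV[R]_(1 + n)] (@rsubmx R 1 1 n).
Proof.
apply: measurable_fun_matrix => i j.
rewrite (_ : (fun _ => _) = (fun v : 'rV_(1 + n) => v i (rshift 1 j))).
  exact: measurable_entry.
by apply/funext => v; rewrite mxE.
Qed.

Section step.
Variables (n : nat) (mu : {sigma_finite_measure set 'rV[R]_n -> \bar R}).

Let prodm : {measure set (measurableTypeR R * 'rV[R]_n)%type -> \bar R} :=
  (@lebesgue_measure R \x mu)%E.

Definition lebesgue_step : set 'rV[R]_(1 + n) -> \bar R :=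
  pushforward (@lebesgue_measure R \x mu)%E (@consrV n).

Let lebesgue_step0 : lebesgue_step set0 = 0%E.
Proof. by rewrite /lebesgue_step /pushforward preimage_set0 measure0. Qed.

Let lebesgue_step_ge0 A : (0 <= lebesgue_step A)%E.
Proof. exact: (measure_ge0 prodm). Qed.

Let lebesgue_step_sigma_additive : semi_sigma_additive lebesgue_step.
Proof.
move=> F mF tF mUF; rewrite /lebesgue_step /pushforward preimage_bigcup.
apply: (@measure_semi_sigma_additive _ _ _ prodm).
- by move=> k; rewrite -[X in measurable X]setTI; exact: measurable_consrV.
- apply/trivIsetP => /= i j _ _ ij; rewrite -preimage_setI.
  by move/trivIsetP : tF => /(_ _ _ _ _ ij) ->//; rewrite preimage_set0.
- rewrite -preimage_bigcup -[X in measurable X]setTI.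
  exact: measurable_consrV.
Qed.

HB.instance Definition _ := isMeasure.Build _ _ _ lebesgue_step
  lebesgue_step0 lebesgue_step_ge0 lebesgue_step_sigma_additive.

Let lebesgue_step_sigma_finite : sigma_finite setT lebesgue_step.
Proof.
have /sigma_finiteP[F [TF ndF Foo]] := sigma_finiteT (@lebesgue_measure R).
have /sigma_finiteP[G [TG ndG Goo]] := sigma_finiteT mu.
pose split_rV (v : 'rV[R]_(1 + n)) : measurableTypeR R * 'rV[R]_n := (v 0 0, @rsubmx R 1 1 n v).
have msplit : measurable_fun setT split_rV.
  by apply/measurable_fun_pair; [exact: measurable_entry|
                                 exact: measurable_rsubrV].
have consK : cancel (@consrV n) split_rV.
  move=> [x v]; rewrite /split_rV /consrV row_mxKr; congr (_, _).
  have -> : 0 = lshift n 0 :> 'I_(1 + n) by exact/val_inj.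
  exact: consrVl.
exists (fun i => split_rV @^-1` (F i `*` G i)).
  rewrite -preimage_bigcup -(preimage_setT split_rV); congr (_ @^-1` _).
  apply/seteqP; split => // -[x v] _.
  have : setT x by []. have : setT v by [].
  rewrite {1}TG {1}TF => -[i _ Giv] [j _ Fjx]; exists (maxn i j) => //; split.
  - by move: x Fjx; exact/subsetPset/ndF/leq_maxr.
  - by move: v Giv; exact/subsetPset/ndG/leq_maxl.
move=> i; have [mF Fi] := Foo i; have [mG Gi] := Goo i; split.
  by rewrite -[X in measurable X]setTI; apply: msplit => //; exact: measurableX.
rewrite /lebesgue_step /pushforward -comp_preimage.
rewrite (_ : split_rV \o _ = id); last exact/funext.
by rewrite preimage_id product_measure1E// lte_mul_pinfty// ge0_fin_numE.
Qed.

HB.instance Definition _ := Measure_isSigmaFinite.Build _ _ _ lebesgue_step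
  lebesgue_step_sigma_finite.

End step.

Fixpoint lebesgue_rV n : {sigma_finite_measure set 'rV[R]_n -> \bar R} :=
  if n is n'.+1 then lebesgue_step (lebesgue_rV n') else \d_(0 : 'rV[R]_0).

Lemma measurable_box n (A : 'I_n -> set R) :
  (forall i, measurable (A i)) ->
  measurable [set v : 'rV[R]_n | forall i, A i (v 0 i)].
Proof.
move=> mA; rewrite (_ : mkset _ =
    \big[setI/setT]_(i < n) ((fun v : 'rV[R]_n => v 0 i) @^-1` A i)).
  apply: bigsetI_measurable => i _; rewrite -[X in measurable X]setTI.
  exact: measurable_entry.
apply/seteqP; split => v; rewrite -bigcap_seq => /= Av i.
  by move=> _; exact: Av.
by apply: (Av i); rewrite /mkset mem_index_enum.
Qed.

Lemma lebesgue_rV_box n (A : 'I_n -> set R) :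
  (forall i, measurable (A i)) ->
  lebesgue_rV n [set v | forall i, A i (v 0 i)] =
  (\prod_(i < n) lebesgue_measure (A i))%E.
Proof.
elim: n A => [|n IHn] A mA.
  by rewrite big_ord0 /= diracE mem_set// => -[].
rewrite big_ord_recl -IHn; last by [].
rewrite -product_measure1E; first last.
- exact: (@measurable_box n (fun i => A (lift ord0 i))).
- exact: mA.
transitivity ((@lebesgue_measure R \x lebesgue_rV n)%E
  (@consrV n @^-1` [set v | forall i, A i (v 0 i)])); first by [].
congr (product_measure1 _ _ _); apply/seteqP; split=> -[x v] /=.
  move=> Axv; split=> [|i].
    have := Axv (lshift n (0 : 'I_1)); rewrite (consrVl (x, v)).
    by congr (A _ x); exact/val_inj.
  have := Axv (rshift 1 i); rewrite (consrVr (x, v)).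
  by congr (A _ _); exact/val_inj.
move=> [Ax Av] i; case: (@split_ordP 1 n i) => k ->.
  rewrite (consrVl (x, v)) ord1; move: Ax.
  by congr (A _ x); exact/val_inj.
rewrite (consrVr (x, v)); move: (Av k).
by congr (A _ _); exact/val_inj.
Qed.

End lebesgue_rV.

Section complex_functions.
Context {R : realType} {N : nat}.
Local Notation C := R[i].
Local Notation mu := (lebesgue_rV N : set 'rV[R]_N -> \bar R).
Implicit Types (Omega : set 'rV[R]_N) (f g : 'rV[R]_N -> C).

(* Elements of L^2 and L^oo are represented by Borel functions on the whole
   space, of which only the values on Omega matter. *)
Definition cmeasurable Omega f : Prop :=
  measurable_fun Omega (fun x => complex.Re (f x)) /\
  measurable_fun Omega (fun x => complex.Im (f x)).

Definition cintegral Omega f : C :=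
  Complex (\int[mu]_(x in Omega) complex.Re (f x))
          (\int[mu]_(x in Omega) complex.Im (f x)).

Definition sqL2norm Omega f : \bar R :=
  (\int[mu]_(x in Omega) (Normc.normc (f x) ^+ 2)%:E)%E.

Definition L2 Omega f : Prop :=
  cmeasurable Omega f /\ (sqL2norm Omega f < +oo)%E.

Definition Linfty Omega f : Prop :=
  cmeasurable Omega f /\
  exists M : R, {ae mu, forall x, Omega x -> Normc.normc (f x) <= M}.

Definition partial (k : 'I_N) (f : 'rV[R]_N -> R) (x : 'rV[R]_N) : R :=
  'D_(delta_mx 0 k) f x.

Fixpoint Ck (n : nat) (f : 'rV[R]_N -> R) : Prop :=
  continuous f /\
  if n is n'.+1 then
    forall k, (forall x, derivable f x (delta_mx 0 k)) /\ Ck n' (partial k f)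
  else True.

Definition smooth (f : 'rV[R]_N -> R) : Prop := forall n, Ck n f.

(* Functions in C_c^oo(Omega) are represented by their extension by 0 to the
   whole space. *)
Definition test_function Omega (psi : 'rV[R]_N -> C) : Prop :=
  [/\ smooth (fun x => complex.Re (psi x)),
      smooth (fun x => complex.Im (psi x)),
      compact (closure [set x | psi x != 0]) &
      closure [set x | psi x != 0] `<=` Omega].

Definition cpartial (k : 'I_N) (psi : 'rV[R]_N -> C) (x : 'rV[R]_N) : C :=
  Complex (partial k (fun y => complex.Re (psi y)) x)
          (partial k (fun y => complex.Im (psi y)) x).

Definition weak_partial Omega (k : 'I_N) f g : Prop :=
  forall psi, test_function Omega psi ->
    cintegral Omega (fun x => f x * cpartial k psi x) =
    - cintegral Omega (fun x => g x * psi x).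

(* [H1 Omega u Du]: u belongs to H^1(Omega) and Du is its weak gradient. The
   gradient is only determined almost everywhere by u, so it is an argument of
   the predicate; the same holds for [H1norm] and [H01]. *)
Definition H1 Omega (u : 'rV[R]_N -> C) (Du : 'I_N -> 'rV[R]_N -> C) : Prop :=
  [/\ L2 Omega u, forall k, L2 Omega (Du k) &
      forall k, weak_partial Omega k u (Du k)].

Definition H1norm Omega (u : 'rV[R]_N -> C) (Du : 'I_N -> 'rV[R]_N -> C) :
    \bar R :=
  sqrte (sqL2norm Omega u + \sum_(k < N) sqL2norm Omega (Du k))%E.

(* The closure of C_c^oo(Omega) in the H^1 norm; the weak gradient of
   u - psi is Du minus the classical gradient of psi. *)
Definition H01 Omega (u : 'rV[R]_N -> C) (Du : 'I_N -> 'rV[R]_N -> C) : Prop :=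
  H1 Omega u Du /\
  forall e : R, 0 < e -> exists2 psi, test_function Omega psi &
    (H1norm Omega (fun x => (u x - psi x)%R)
                  (fun k x => (Du k x - cpartial k psi x)%R) < e%:E)%E.

Definition H01_vec m Omega (u : 'rV[R]_N -> 'cV[C]_m)
    (Du : 'I_N -> 'rV[R]_N -> 'cV[C]_m) : Prop :=
  forall i, H01 Omega (fun x => u x i 0) (fun k x => Du k x i 0).

Definition domain Omega : Prop := [/\ open Omega, connected Omega & Omega !=set0].

End complex_functions.

Section hermitian.
Context {R : realType} {m : nat}.
Implicit Types v w : 'cV[R[i]]_m.

Definition herm v w : R[i] := \sum_i v i 0 * (w i 0)^*.

Definition enorm v : R := Num.sqrt (complex.Re (herm v v)).

Definition adjmx (A : 'M[R[i]]_m) : 'M[R[i]]_m := map_mx Num.conj A^T.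

End hermitian.

(* The functions on (0, +oo) are represented by total functions on R, whose
   values outside (0, +oo) are irrelevant. *)
Definition phi_conditions {R : realType} (phi : R -> R) : Prop :=
  let sphi s := s * phi s in
  [/\ forall s, 0 < s -> 0 < phi s,
      forall s, 0 < s -> derivable phi s 1 /\ {for s, continuous (derive1 phi)},
      forall s, 0 < s -> 0 < derive1 sphi s,
      sphi @` [set` `]0, +oo[] = [set` `]0, +oo[] &
      exists s0 : R, [/\ 0 < s0,
        exists C1 C2 r : R,
          [/\ 0 < C1, 0 < C2, -1 < r,
              forall s, 0 < s < s0 ->
                C1 * s `^ r <= derive1 sphi s <= C2 * s `^ r &
              r = 0 ->
                (exists2 l : R, 0 < l & phi s @[s --> 0^'+] --> l) /\
                s * derive1 phi s @[s --> 0^'+] --> (0 : R)] &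
        exists2 s1 : R, s0 < s1 &
          (forall s, s1 <= s -> 0 <= derive1 phi s) \/
          (forall s, s1 <= s -> derive1 phi s <= 0)]].

Section functional_dissipativity.
Context {R : realType}.
Variable phi : R -> R.

(* The inverse of s |-> s * sqrt (phi s) on (0, +oo). *)
Definition zeta (t : R) : R :=
  xget 0 [set s | 0 < s /\ s * Num.sqrt (phi s) = t].

Definition Theta (t : R) : R := zeta t / t.

Definition Lambda (t : R) : R := t * derive1 Theta t / Theta t.

Definition phi_scale m (v : 'cV[R[i]]_m) : 'cV[R[i]]_m :=
  if v == 0 then 0 else (phi (enorm v))%:C%C *: v.

(* Dphiu is the weak gradient of phi(|u|) u. *)
Definition functional_dissipative N m (Omega : set 'rV[R]_N)
    (A : 'I_N -> 'I_N -> 'rV[R]_N -> 'M[R[i]]_m) : Prop :=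
  forall (u : 'rV[R]_N -> 'cV[R[i]]_m)
      (Du Dphiu : 'I_N -> 'rV[R]_N -> 'cV[R[i]]_m),
    H01_vec Omega u Du -> H01_vec Omega (fun x => phi_scale (u x)) Dphiu ->
    0 <= complex.Re (cintegral Omega (fun x =>
           \sum_h \sum_k herm (A h k x *m Du k x) (Dphiu h x))).

End functional_dissipativity.

(* Main.v *)
(** Put P(s) = s phi(s) and q(s) = s sqrt(phi(s)), so that q(s)^2 = s P(s). The
    vector fields that occur are all radial rearrangements f(|V|) V / |V| of one
    field V in H^1_0. When f(t)/t and f' are bounded such a rearrangement is in
    H^1_0 and its gradient is given by the chain rule (0 on {V = 0}): if V is a
    test function and g a polynomial then g(|V|^2) V is a test function,
    Bernstein polynomials give the case of g in C^1, and dominated convergence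
    does the rest.

    If the integral condition holds, let u and w = phi(|u|) u be in H^1_0, and
    put V = u + w. Then |V| = |u| + P(|u|), and u, w and v = sqrt(phi(|u|)) u are
    radial rearrangements of V; that v is in H^1_0 rests on a bound
    q' <= L (1 + P'), which follows from (iv) and (v). The integrand of
    dissipativity at u equals pointwise the integrand of the condition at v.

    Conversely, let v be in H^1_0. The field Theta(|v|) v need not be in H^1_0,
    so for e > 0 define s by q(s) + e (s + P(s)) = |v| and u_e = s v / |v|; both
    u_e and phi(|u_e|) u_e are now 1/e-Lipschitz functions of v. The
    coefficients of the bilinear form obtained from dissipativity at u_e are
    bounded independently of e, and e -> 0 by dominated convergence. *)

Require Import Defs.
From mathcomp Require Import all_boot all_order all_algebra.
From mathcomp Require Import all_classical all_reals all_analysis.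
From mathcomp Require Import measurable_realfun complex.
From mathcomp Require Import ring lra.

Set Implicit Arguments.
Unset Strict Implicit.
Unset Printing Implicit Defensive.

Import Order.TTheory GRing.Theory Num.Theory.
Import numFieldNormedType.Exports.

Local Open Scope classical_set_scope.
Local Open Scope ring_scope.

(** * Lebesgue measure and integration by parts *)

(** Let p be the gradient of v, r_k = Re<v, p_k> v its radial part and l = Lambda(|v|) / |v|^2. The
    integrand of the condition is the form of [A] at the pair (p + l r, p - l r). At |v| = q(s) one
    has (1 + Lambda) q' = sqrt(phi) and (1 - Lambda) q' = P' / sqrt(phi); so passing from (u,
    phi(|u|) u) to v only moves a factor sqrt(phi) from one argument of the form to the other.

    The obstacle is regularity: neither of u and w need be a Lipschitz function of the other, nor v
    of either. The map s + P(s) has a derivative larger than both 1 and P', so s and P(s) are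
    1-Lipschitz functions of it. This is why V = u + w is taken as the independent field, and why e
    (s + P(s)) is the perturbation in the converse.

    The bounds uniform in e rest only on q^2 = s P, its derivative 2 q q' = P + s P', and P' <=
    q'^2.

    Weak gradients are arguments of the predicates and not functions of the field, so the gradients
    in a hypothesis must be matched almost everywhere with those of the chain rule; hence the
    uniqueness statements. *)

Section rV_topology.
Context {R : realType}.

(** The sigma-algebra is generated by the coordinates, not by the open sets. Balls of the sup
    distance are cubes, and an open set is the union of the countably many rational cubes that it
    contains. *)
Lemma open_measurable_rV N (U : set 'rV[R]_N) : open U -> measurable U.
Proof.
move=> oU.
pose B (q : 'rV[rat]_N * rat) : set 'rV[R]_N :=
  [set v | forall i, ball (ratr (q.1 0 i) : R) (ratr q.2) (v 0 i)].
have mB q : measurable (B q).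
  by apply: (@measurable_box R N (fun i => ball (ratr (q.1 0 i) : R) (ratr q.2)))
    => i; exact: measurable_ball.
have -> : U = \bigcup_(q in [set q | B q `<=` U]) B q.
  apply/seteqP; split; last by move=> x [q qU]; exact: qU.
  move=> x Ux.
  have : nbhs x U by exact: open_nbhs_nbhs.
  move=> /nbhs_ballP[e /= e0 xeU].
  (* A cube of half-side r whose centre is within r of x stays within 2 r < e of x. *)
  have /(rat_in_itvoo)[r] : 0 < e / 2 :> R by rewrite divr_gt0.
  rewrite in_itv/= => /andP[r0 re].
  have near_rat i : exists q : rat, ball (x 0 i) (ratr r) (ratr q).
    have : x 0 i - ratr r < x 0 i + ratr r :> R by lra.
    move=> /rat_in_itvoo[q]; rewrite in_itv/= => /andP[q1 q2]; exists q.
    by rewrite /ball/= ltr_distlC; apply/andP; split; lra.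
  have [q Hq] := choice near_rat.
  exists (\row_i q i, r).
    move=> y By; apply: xeU; rewrite /ball/=; split => // i j.
    rewrite !ord1; have := By j; rewrite /= mxE => qy.
    have xq := Hq j.
    have := ball_triangle xq qy.
    by apply: le_ball; lra.
  by move=> i /=; rewrite mxE; apply: ball_sym; exact: Hq.
rewrite bigcup_mkcond; apply: countable_bigcupT_measurable => [|q].
  exact: countableP.
by case: ifP => // _.
Qed.

Lemma continuous_measurable_rV N (f : 'rV[R]_N -> R) :
  continuous f -> measurable_fun setT f.
Proof.
move=> /continuousP cf; apply: (measurability _ (RGenOpens.measurableE R)).
move=> _ [_ [a [b ->] <-]]; rewrite setTI; apply: open_measurable_rV.
exact/cf/interval_open.
Qed.

(** The support is confined to a cube rather than to a general compact set, because this form of the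
    hypothesis is inherited by the slices in the induction of [integral_partial0]. *)
Lemma integrable_cont_box N (f : 'rV[R]_N -> R) (M : R) : continuous f ->
  (forall x, f x != 0 -> forall i, `|x 0 i| <= M) ->
  (lebesgue_rV N).-integrable setT (EFin \o f).
Proof.
move=> cf fM.
pose K := [set v : 'rV[R]_N | forall i, `[-M, M]%classic (v 0 i)].
have mK : measurable K.
  by apply: (@measurable_box R N (fun=> `[-M, M]%classic)).
have cK : compact K 
    by apply: (@rV_compact R N (fun=> `[-M, M]%classic)) => i; exact: segment_compact.
have muK : (lebesgue_rV N K < +oo)%E.
  rewrite (@lebesgue_rV_box R N (fun=> `[-M, M]%classic)) //.
  rewrite -ge0_fin_numE; last by apply: prode_ge0 => i _; exact: measure_ge0.
  apply: prode_fin_num => i _ /=.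
  by rewrite lebesgue_measure_itv/=; case: ifP.
have [B fB] : exists B, forall x, K x -> `|f x| <= B.
  have /compact_bounded[B [_ HB]] : compact (f @` K).
    by apply: continuous_compact => //; exact: continuous_subspaceT.
  exists (B + 1) => x Kx; apply: (HB (B + 1)); first by rewrite ltrDl.
  by exists x.
apply: (@eq_integrable _ _ _ _ _ measurableT (EFin \o (f \_ K))).
  move=> x _ /=; rewrite patchE; case: ifPn => // xK.
  congr EFin; apply/esym/eqP/negPn/negP => fx0; move/negP: xK; apply.
  by rewrite inE => i /=; have := fM _ fx0 i; rewrite ler_norml in_itv.
rewrite -restrict_EFin; apply/integrable_restrict => //; rewrite setTI.
apply: (@le_integrable _ _ _ _ _ mK _ (cst B%:E)).
- apply/measurable_EFinP; apply: measurable_funTS.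
  exact: continuous_measurable_rV.
- by move=> x Kx /=; rewrite lee_fin (le_trans (fB _ Kx))// ler_norm.
- apply/integrableP; split; first exact: measurable_cst.
  by rewrite integral_cst//= lte_mul_pinfty.
Qed.

End rV_topology.

Section integral_partial.
Context {R : realType}.

(** The two difference quotients are the same function of h, so only directional derivatives of f
    are involved and no differentiability. *)
Lemma derive_affine (V W : normedModType R) (f : V -> R) (g : W -> V) w v y :
  (forall h : R, g (h *: w + y) = h *: v + g y) ->
  'D_w (f \o g) y = 'D_v f (g y) /\
  (derivable f (g y) v -> derivable (f \o g) y w).
Proof.
move=> gE; rewrite /derive /derivable.
have -> : (fun h => h^-1 *: ((f \o g \o shift y) (h *: w) - (f \o g) y)) =
          (fun h => h^-1 *: ((f \o shift (g y)) (h *: v) - f (g y))).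
  by apply/funext => h /=; rewrite gE.
by split.
Qed.

Lemma continuous_consrVl n (x : R) :
  continuous (fun y : 'rV[R]_n => consrV (x, y) : 'rV[R]_(1 + n)).
Proof.
move=> y; apply/(@cvg_ballP _ _ _ (nbhs (y : 'rV[R]_n)) (nbhs_filter _)) => e e0.
have : nbhs (y : 'rV[R]_n) (ball y e) by exact: nbhsx_ballx.
apply: (@filterS _ (nbhs (y : 'rV[R]_n))) => z [_ yz]; split=> // i j.
rewrite ord1 /=.
case: (@split_ordP 1 n j) => k ->; rewrite ?consrVl ?consrVr/=.
  exact: ballxx.
exact: yz.
Qed.

Lemma continuous_consrVr n (y : 'rV[R]_n) :
  continuous (fun x : R => consrV (x, y) : 'rV[R]_(1 + n)).
Proof.
move=> x; apply/cvg_ballP => e e0.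
have : nbhs (x : R) (ball (x : R) e) by exact: nbhsx_ballx.
apply: (@filterS _ (nbhs (x : R))) => z xz; split=> // i j.
rewrite ord1 /=.
case: (@split_ordP 1 n j) => k ->; rewrite ?consrVl ?consrVr//=.
exact: ballxx.
Qed.

Lemma partial_eq0 N (k : 'I_N) (f : 'rV[R]_N -> R) x :
  (\forall y \near x, f y = 0) -> partial k f x = 0.
Proof.
move=> fx0; rewrite /partial.
suff -> : 'D_(delta_mx 0 k) f x = 'D_(delta_mx 0 k) (cst 0 : _ -> R) x.
  by rewrite derive_cst.
exact: near_eq_derive.
Qed.

Lemma partial_box N (k : 'I_N) (f : 'rV[R]_N -> R) (M : R) :
  (forall x, f x != 0 -> forall i, `|x 0 i| <= M) ->
  (forall x, partial k f x != 0 -> forall i, `|x 0 i| <= M).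
Proof.
move=> fM x + i; apply: contraNle => Mx.
rewrite partial_eq0//.
have : \forall y \near x, M < `|(y : 'rV[R]_N) 0 i|.
  have : {for x, continuous (fun v : 'rV[R]_N => `|v 0 i|)}.
    apply: (@continuous_comp _ _ _ (fun v : 'rV[R]_N => v 0 i) Num.norm).
      exact: coord_continuous.
    exact: norm_continuous.
  by move/cvgr_gt; apply.
apply: filterS => y My; apply/eqP/negPn/negP => /fM/(_ i).
by rewrite leNgt My.
Qed.

(** Induction on the dimension along the product defining [lebesgue_rV]. If k is the first
    coordinate, Fubini puts the one-dimensional integral inside and the fundamental theorem of
    calculus kills it; otherwise the inner integral is over the remaining coordinates and vanishes
    by induction. *)
Lemma integral_partial0 N (k : 'I_N) (f : 'rV[R]_N -> R) (M : R) :
  continuous f -> (forall x, derivable f x (delta_mx 0 k)) ->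
  continuous (partial k f) ->
  (forall x, f x != 0 -> forall i, `|x 0 i| <= M) ->
  (\int[lebesgue_rV N]_x (partial k f x)%:E)%E = 0%E.
Proof.
elim: N k f => [[]//|n IHn] k f cf df cdf fM.
have fM' := partial_box (k := k) fM.
have iF := integrable_cont_box cdf fM'.
have cons_meas := @measurable_consrV R n.
have mF : measurable_fun [set: 'rV[R]_(1 + n)] (EFin \o partial k f).
  by apply/measurable_EFinP; exact: continuous_measurable_rV.
have iG : (@lebesgue_measure R \x lebesgue_rV n)%E.-integrable setT
    ((EFin \o partial k f) \o @consrV R n).
  move/integrableP : iF => [_ iF].
  apply/integrableP; split; first exact: measurableT_comp.
  suff <- : (\int[pushforward (@lebesgue_measure R \x lebesgue_rV n) (@consrV R n)]_x
    `|(EFin \o partial k f) x| = \int[(@lebesgue_measure R \x lebesgue_rV n)]_x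
    `|((EFin \o partial k f) \o @consrV R n) x|)%E by [].
  rewrite ge0_integral_pushforward//; last exact: measurableT_comp.
transitivity (\int[pushforward (@lebesgue_measure R \x lebesgue_rV n) (@consrV R n)]_x
   (partial k f x)%:E)%E; first by [].
rewrite integral_pushforward// preimage_setT.
case: (@split_ordP 1 n k) => j kj.
- rewrite -integral21_prod_meas1//.
  apply: integral0_eq => y _; rewrite /fubini_G /=.
  pose g (x : R) : 'rV[R]_(1 + n) := consrV (x, y).
  have gE (x h : R) : g (h *: 1 + x) = h *: delta_mx 0 k + g x.
    apply/rowP => i; rewrite !mxE kj (ord1 j).
    case: (@split_ordP 1 n i) => l il; rewrite il /g ?consrVl ?consrVr /=.
      by rewrite (ord1 l) !mxE eqxx [_ *: _]mulr1 mulr1.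
    by rewrite mulr0 add0r.
  have dg x : derive1 (f \o g) x = partial k f (g x).
    by rewrite derive1E; have [] := derive_affine f (gE x).
  have fg0 x : M < `|x| -> f (g x) = 0.
    move=> Mx; apply/eqP/negPn/negP => /fM/(_ (@lshift 1 n 0)).
    by rewrite consrVl /= leNgt Mx.
  have pfg0 x : M < `|x| -> partial k f (g x) = 0.
    move=> Mx; apply/eqP/negPn/negP => /fM'/(_ (@lshift 1 n 0)).
    by rewrite consrVl /= leNgt Mx.
  have cg : continuous g by exact: continuous_consrVr.
  (* M may be negative; K is positive and larger than M, so f vanishes at both ends of [-K, K] and
     its derivative vanishes outside. *)
  pose K : R := `|M| + 1.
  have MK : M < `|K| by rewrite ger0_norm ?addr_ge0// ltr_pwDr// ler_norm.
  have K0 : - K < K by rewrite /K; have := normr_ge0 M; lra.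
  transitivity (\int[@lebesgue_measure R]_(x in `[(- K)%R, K]) (partial k f (g x))%:E)%E.
    rewrite [RHS]integral_mkcond; apply: eq_integral => x _.
    rewrite patchE; case: ifPn => //; rewrite notin_setE /= in_itv/= => xK.
    rewrite pfg0// (lt_le_trans MK)// leNgt; apply/negP => /ltW.
    by rewrite ler_norml ger0_norm ?addr_ge0.
  rewrite (@continuous_FTC2 _ _ (f \o g))//=.
  - by rewrite !fg0 ?normrN// subee.
  - apply: continuous_subspaceT => x; apply: continuous_comp; first exact: cg.
    exact: cdf.
  - split=> [x _||].
    + by have [_] := derive_affine f (gE x); apply; exact: df.
    + apply: cvg_at_right_filter; apply: continuous_comp; first exact: cg.
      exact: cf.
    + apply: cvg_at_left_filter; apply: continuous_comp; first exact: cg.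
      exact: cf.
rewrite -integral12_prod_meas1//.
apply: integral0_eq => x _; rewrite /fubini_F /=.
pose g (y : 'rV[R]_n) : 'rV[R]_(1 + n) := consrV (x, y).
have gE y (h : R) : g (h *: delta_mx 0 j + y) = h *: delta_mx 0 k + g y.
  apply/rowP => i; rewrite !mxE kj.
  case: (@split_ordP 1 n i) => l ->; rewrite /g ?consrVl ?consrVr ?mxE /=.
    by rewrite -?val_eqE /= ?(ord1 l) /= mulr0 add0r.
  by rewrite -[in RHS]val_eqE /= eqn_add2l val_eqE.
have dg y : partial j (f \o g) y = partial k f (g y).
  by have [] := derive_affine f (gE y).
rewrite -[RHS](IHn j (f \o g)).
- by apply: eq_integral => y _; rewrite dg.
- move=> y; apply: continuous_comp; last exact: cf.
  exact: continuous_consrVl.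
- move=> y; have [_] := derive_affine f (gE y); apply; exact: df.
- rewrite (_ : partial j _ = partial k f \o g); last exact/funext.
  move=> y; apply: continuous_comp; last exact: cdf.
  exact: continuous_consrVl.
- move=> y fy i; have := fM _ fy (@rshift 1 n i).
  by rewrite consrVr.
Qed.

End integral_partial.

(** * Test functions and their closure in H^1 *)

Section Ck_theory.
Context {R : realType} {N : nat}.
Implicit Types f g : 'rV[R]_N -> R.

Lemma Ck_cont n f : Ck n f -> continuous f.
Proof. by case: n => [|n] []. Qed.

Lemma CkS n f : Ck n.+1 f -> Ck n f.
Proof.
elim: n f => [|n IHn] f; first by case.
move=> [cf df]; split=> // k; have [dk Ck'] := df k; split=> //; exact: IHn.
Qed.

Lemma Ck_derivable n f k x : Ck n.+1 f -> derivable f x (delta_mx 0 k).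
Proof. by move=> [_ /(_ k)[]]. Qed.

Lemma Ck_partial n f k : Ck n.+1 f -> Ck n (partial k f).
Proof. by move=> [_ /(_ k)[]]. Qed.

Lemma partial_cst k (c : R) : partial k (fun _ : 'rV[R]_N => c) = (fun=> 0).
Proof. by apply/funext => x; exact: derive_cst. Qed.

Lemma Ck_cst n (c : R) : Ck n (fun _ : 'rV[R]_N => c).
Proof.
elim: n c => [|n IHn] c; first by split=> //; exact: cst_continuous.
split; first exact: cst_continuous.
by move=> k; split=> [x|]; [exact: derivable_cst|rewrite partial_cst; exact: IHn].
Qed.

Lemma partialD k f g : (forall x, derivable f x (delta_mx 0 k)) ->
  (forall x, derivable g x (delta_mx 0 k)) ->
  partial k (fun x => f x + g x) = (fun x => partial k f x + partial k g x).
Proof. by move=> df dg; apply/funext => x; exact: deriveD. Qed.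

Lemma partialM k f g : (forall x, derivable f x (delta_mx 0 k)) ->
  (forall x, derivable g x (delta_mx 0 k)) ->
  partial k (fun x => f x * g x) =
  (fun x => f x * partial k g x + partial k f x * g x).
Proof.
by move=> df dg; apply/funext => x; rewrite /partial deriveM// [in RHS](mulrC _ (g x)).
Qed.

Lemma CkD n f g : Ck n f -> Ck n g -> Ck n (fun x => f x + g x).
Proof.
elim: n f g => [|n IHn] f g.
  by move=> [cf _] [cg _]; split=> // x; apply: continuousD; [exact: cf|exact: cg].
move=> [cf df] [cg dg]; split; first by move=> x; apply: continuousD; [exact: cf|exact: cg].
move=> k; have [dfk Cf] := df k; have [dgk Cg] := dg k; split.
  by move=> x; exact: derivableD.
by rewrite partialD//; exact: IHn.
Qed.

Lemma CkM n f g : Ck n f -> Ck n g -> Ck n (fun x => f x * g x).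
Proof.
elim: n f g => [|n IHn] f g.
  by move=> [cf _] [cg _]; split=> // x; apply: continuousM; [exact: cf|exact: cg].
move=> Cf' Cg'; move: (Cf') (Cg') => [cf df] [cg dg]; split.
  by move=> x; apply: continuousM; [exact: cf|exact: cg].
move=> k; have [dfk Cf] := df k; have [dgk Cg] := dg k; split.
  by move=> x; exact: derivableM.
by rewrite partialM//; apply: CkD; apply: IHn => //; exact: CkS.
Qed.

Lemma smooth_cst (c : R) : smooth (fun _ : 'rV[R]_N => c). Proof. by move=> n; exact: Ck_cst. Qed.

Lemma smoothD f g : smooth f -> smooth g -> smooth (fun x => f x + g x).
Proof. by move=> sf sg n; exact: CkD. Qed.

Lemma smoothM f g : smooth f -> smooth g -> smooth (fun x => f x * g x).
Proof. by move=> sf sg n; exact: CkM. Qed.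

Lemma smooth_partial f k : smooth f -> smooth (partial k f).
Proof. by move=> sf n; exact: Ck_partial (sf n.+1). Qed.

Lemma smooth_cont f : smooth f -> continuous f.
Proof. by move=> /(_ 0%N); exact: Ck_cont. Qed.

Lemma smooth_derivable f k x : smooth f -> derivable f x (delta_mx 0 k).
Proof. by move=> /(_ 1%N) /Ck_derivable; exact. Qed.

Lemma smooth_sum (J : Type) (r : seq J) (F : J -> 'rV[R]_N -> R) :
  (forall j, smooth (F j)) -> smooth (fun x => \sum_(j <- r) F j x).
Proof.
move=> sF; elim: r => [|j r IHr].
  by under [fun _ => _]funext do rewrite big_nil; exact: smooth_cst.
by under [fun _ => _]funext do rewrite big_cons; exact: smoothD.
Qed.

Lemma partial_sum (J : Type) (r : seq J) (F : J -> 'rV[R]_N -> R) k x :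
  (forall j, smooth (F j)) ->
  partial k (fun x => \sum_(j <- r) F j x) x = \sum_(j <- r) partial k (F j) x.
Proof.
move=> sF; elim: r => [|j r IHr].
  by under [fun _ => _]funext do rewrite big_nil; rewrite big_nil partial_cst.
under [fun _ => _]funext do rewrite big_cons; rewrite big_cons partialD.
- by rewrite IHr.
- by move=> y; exact: smooth_derivable.
- by move=> y; apply: smooth_derivable; exact: smooth_sum.
Qed.

Lemma smooth_horner (p : {poly R}) f : smooth f -> smooth (fun x => p.[f x]).
Proof.
move=> sf; elim/poly_ind: p => [|p c IHp].
  by under [fun _ => _]funext do rewrite horner0; exact: smooth_cst.
under [fun _ => _]funext do rewrite hornerMXaddC.
by apply: smoothD; [exact: smoothM|exact: smooth_cst].
Qed.

Lemma partial_horner (p : {poly R}) f k x : smooth f ->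
  partial k (fun x => p.[f x]) x = p^`().[f x] * partial k f x.
Proof.
move=> sf; elim/poly_ind: p => [|p c IHp].
  under [fun _ => _]funext do rewrite horner0.
  by rewrite partial_cst deriv0 horner0 mul0r.
under [fun _ => _]funext do rewrite hornerMXaddC.
have sp := smooth_horner p sf.
rewrite partialD; first last.
- by move=> y; apply: smooth_derivable; exact: smooth_cst.
- by move=> y; apply: smooth_derivable; exact: smoothM.
rewrite partialM; first last.
- by move=> y; exact: smooth_derivable.
- by move=> y; exact: smooth_derivable.
rewrite partial_cst IHp derivD derivC addr0 derivM derivX mulr1 !hornerE; ring.
Qed.

End Ck_theory.

Section real_test.
Context {R : realType} {N : nat}.
Variable Omega : set 'rV[R]_N.
Implicit Types f g psi chi : 'rV[R]_N -> R.

(** The real counterpart of [test_function]: the analysis is done on real components and only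
    transferred to complex fields afterwards. *)
Definition rtest psi := [/\ smooth psi,
  compact (closure [set x | psi x != 0]) & closure [set x | psi x != 0] `<=` Omega].

Lemma rtest_smooth psi : rtest psi -> smooth psi. Proof. by case. Qed.

Lemma rtest_supp psi f : rtest psi -> smooth f ->
  [set x | f x != 0] `<=` closure [set x | psi x != 0] -> rtest f.
Proof.
move=> [spsi cpsi psiO] sf fpsi.
have clf : closure [set x | f x != 0] `<=` closure [set x | psi x != 0].
  rewrite [X in _ `<=` X](closure_id (closure _)).1; last exact: closed_closure.
  exact: closureS.
split=> //.
- by apply: (subclosed_compact _ cpsi clf); exact: closed_closure.
- exact: subset_trans psiO.
Qed.

Lemma rtestM psi f : rtest psi -> smooth f -> rtest (fun x => f x * psi x).
Proof.
move=> tpsi sf; apply: (rtest_supp tpsi); first by apply: smoothM => //; case: tpsi.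
move=> x /= fpsi; apply: subset_closure => /=; apply: contra_neq fpsi => ->.
by rewrite mulr0.
Qed.

Lemma rtest_partial psi k : rtest psi -> rtest (partial k psi).
Proof.
move=> tpsi; apply: (rtest_supp tpsi).
  by apply: smooth_partial; case: tpsi.
move=> x /=; apply: contra_neqP => /= ncl; apply: partial_eq0.
have : nbhs x (~` closure [set x | psi x != 0]).
  by apply: open_nbhs_nbhs; split=> //; exact/closed_openC/closed_closure.
apply: filterS => y yncl; apply/eqP/negPn/negP => psiy; apply: yncl.
exact: subset_closure.
Qed.

Lemma rtestD psi chi : rtest psi -> rtest chi -> rtest (fun x => psi x + chi x).
Proof.
move=> [s1 c1 O1] [s2 c2 O2].
have sub : closure [set x | psi x + chi x != 0] `<=`
    closure [set x | psi x != 0] `|` closure [set x | chi x != 0].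
  rewrite -closureU; apply: closureS => x /=.
  by apply: contra_neqP => /= /not_orP[/negP/negPn/eqP -> /negP/negPn/eqP ->]; rewrite addr0.
split; first exact: smoothD.
- by apply: (subclosed_compact _ _ sub); [exact: closed_closure|exact: compactU].
- by apply: (subset_trans sub); rewrite subUset.
Qed.

Lemma rtestN psi : rtest psi -> rtest (fun x => - psi x).
Proof.
move=> tpsi; under [fun _ => _]funext do rewrite -mulN1r.
exact: (rtestM tpsi (smooth_cst (-1))).
Qed.

Lemma rtest_box psi : rtest psi ->
  exists M, forall x, psi x != 0 -> forall i, `|x 0 i| <= M.
Proof.
move=> [_ /compact_bounded[M [_ HM]] _]; exists (M + 1) => x psix i.
have : `|x| <= M + 1 by apply: HM; [rewrite ltrDl|exact: subset_closure].
apply: le_trans; rewrite [leRHS]/Num.Def.normr /= mx_normrE.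
by apply/bigmax_geP; right => /=; exists (0, i).
Qed.

Lemma rtest_bounded psi : rtest psi -> exists M, forall x, `|psi x| <= M.
Proof.
move=> [spsi cpsi _].
have /compact_bounded[B [_ HB]] : compact (psi @` closure [set x | psi x != 0]).
  apply: continuous_compact => //; apply: continuous_subspaceT.
  exact: smooth_cont.
exists (`|B| + 1) => x; have [->|psix] := eqVneq (psi x) 0.
  by rewrite normr0 addr_ge0.
apply: (HB (`|B| + 1)); first by rewrite (le_lt_trans (ler_norm _))// ltrDl.
by exists x => //; exact: subset_closure.
Qed.

Hypothesis oO : open Omega.
Let mO : measurable Omega := open_measurable_rV oO.

Lemma rtest_measurable psi : rtest psi -> measurable_fun Omega psi.
Proof.
move=> [/smooth_cont spsi _ _]; apply: measurable_funTS.
exact: continuous_measurable_rV.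
Qed.

Lemma rtest_integrable psi : rtest psi ->
  (lebesgue_rV N).-integrable Omega (EFin \o psi).
Proof.
move=> tpsi; have [M HM] := rtest_box tpsi.
apply: (@integrableS _ _ _ _ setT) => //.
by apply: integrable_cont_box HM; apply: smooth_cont; case: tpsi.
Qed.

Lemma integral_partial_rtest psi k : rtest psi ->
  \int[lebesgue_rV N]_(x in Omega) partial k psi x = 0.
Proof.
move=> tpsi; have [M HM] := rtest_box tpsi.
have sp : smooth psi by case: tpsi.
rewrite /Rintegral integral_mkcond.
rewrite (_ : (\int[_]_x _)%E = (\int[lebesgue_rV N]_x (partial k psi x)%:E)%E).
  rewrite (integral_partial0 (M := M))//.
  - exact: smooth_cont.
  - by move=> x; exact: smooth_derivable.
  - by apply: smooth_cont; exact: smooth_partial.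
apply: eq_integral => x _; rewrite patchE; case: ifPn => // xO.
congr EFin; apply/esym/eqP/negPn/negP => px; move/negP: xO; apply.
have [_ _] := rtest_partial k tpsi; rewrite inE; apply; exact: subset_closure.
Qed.

Lemma rtest_IBP psi chi k : rtest psi -> rtest chi ->
  \int[lebesgue_rV N]_(x in Omega) (psi x * partial k chi x) =
  - \int[lebesgue_rV N]_(x in Omega) (partial k psi x * chi x).
Proof.
move=> tpsi tchi; apply/eqP; rewrite -subr_eq0 opprK.
have spsi := rtest_smooth tpsi; have schi := rtest_smooth tchi.
rewrite -RintegralD//; first last.
- by apply: rtest_integrable; apply: rtestM => //; exact: smooth_partial.
- by apply: rtest_integrable; apply: rtestM => //; exact: rtest_partial.
rewrite -[X in _ == X](@integral_partial_rtest (fun x => psi x * chi x) k).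
  apply/eqP/eq_Rintegral => x _; rewrite partialM// => y; exact: smooth_derivable.
exact: rtestM.
Qed.

End real_test.

(** * The closure of the test functions, as a space of real 1-jets *)

Section H0.
Context {R : realType} {N : nat}.
Variable Omega : set 'rV[R]_N.
Hypothesis oO : open Omega.
Let mO : measurable Omega := open_measurable_rV oO.
Local Notation mu := (lebesgue_rV N : {sigma_finite_measure set 'rV[R]_N -> \bar R}).
Implicit Types (f g : 'rV[R]_N -> R) (U V : option 'I_N -> 'rV[R]_N -> R).

Definition sqint f : \bar R := (\int[mu]_(x in Omega) ((f x) ^+ 2)%:E)%E.

Definition L2r f := measurable_fun Omega f /\ (sqint f < +oo)%E.

Definition jet (psi : 'rV[R]_N -> R) (a : option 'I_N) : 'rV[R]_N -> R :=
  if a is Some k then partial k psi else psi.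

(* [U] is the jet of an element of the closure of the test functions: [U None]
   is the function itself and [U (Some k)] its k-th weak derivative. *)
Definition H0 U := (forall a, L2r (U a)) /\
  forall e : R, 0 < e -> exists2 psi, rtest Omega psi &
    forall a, (sqint (fun x => U a x - jet psi a x)%R < e%:E)%E.

Lemma sqint_ge0 f : (0 <= sqint f)%E.
Proof. by apply: integral_ge0 => x _; rewrite lee_fin sqr_ge0. Qed.

Lemma measurable_sq f : measurable_fun Omega f ->
  measurable_fun Omega (fun x => ((f x) ^+ 2)%:E).
Proof. by move=> mf; apply/measurable_EFinP; exact: measurable_funX. Qed.

Lemma sqintD f g : measurable_fun Omega f -> measurable_fun Omega g ->
  (sqint (fun x => f x + g x)%R <= 2%:E * sqint f + 2%:E * sqint g)%E.
Proof.
move=> mf mg.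
have mf2 := measurable_sq mf; have mg2 := measurable_sq mg.
rewrite /sqint -!ge0_integralZl//; try by move=> x _; rewrite lee_fin sqr_ge0.
rewrite -ge0_integralD//; first last.
- exact: measurable_funeM.
- by move=> x _; rewrite mule_ge0// lee_fin sqr_ge0.
- exact: measurable_funeM.
- by move=> x _; rewrite mule_ge0// lee_fin sqr_ge0.
apply: ge0_le_integral => //.
- by move=> x _; rewrite lee_fin sqr_ge0.
- by apply: measurable_sq; exact: measurable_funD.
- by apply: emeasurable_funD; exact: measurable_funeM.
move=> x _; rewrite -!EFinM -EFinD lee_fin.
have := sqr_ge0 (f x - g x); rewrite sqrrB sqrrD !mulr2n; lra.
Qed.

Lemma sqintN f : sqint (fun x => - f x)%R = sqint f.
Proof. by apply: eq_integral => x _; rewrite sqrrN. Qed.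

Lemma L2rD f g : L2r f -> L2r g -> L2r (fun x => f x + g x).
Proof.
move=> [mf f2] [mg g2]; split; first exact: measurable_funD.
apply: le_lt_trans (sqintD mf mg) _.
by apply: lte_add_pinfty; apply: lte_mul_pinfty => //; exact: sqint_ge0.
Qed.

Lemma L2rN f : L2r f -> L2r (fun x => - f x).
Proof. by move=> [mf f2]; split; [exact: measurable_funN|rewrite sqintN]. Qed.

Lemma jet_test psi a : rtest Omega psi -> rtest Omega (jet psi a).
Proof. by case: a => [k|] //; exact: rtest_partial. Qed.

Lemma rtest_L2r psi : rtest Omega psi -> L2r psi.
Proof.
move=> tpsi; split; first exact: rtest_measurable.
have := rtest_integrable oO (rtestM tpsi (rtest_smooth tpsi)).
move=> /integrableP[_]; apply: le_lt_trans.
rewrite le_eqVlt; apply/orP; left; apply/eqP/eq_integral => x _ /=.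
by rewrite -expr2 ger0_norm// sqr_ge0.
Qed.

Lemma H0_rtest psi : rtest Omega psi -> H0 (jet psi).
Proof.
move=> tpsi; split=> [a|e e0]; first by apply: rtest_L2r; exact: jet_test.
exists psi => // a; rewrite /sqint integral0_eq// => x _.
by rewrite subrr expr0n.
Qed.

(** The triangle inequality for squared norms: [sqintD] costs a factor 2 on each term, whence e /
    4. *)
Lemma sqint3 (f g h : 'rV[R]_N -> R) (e : R) : measurable_fun Omega f -> measurable_fun Omega g ->
  measurable_fun Omega h -> (sqint (fun x => f x - g x)%R < (e / 4)%:E)%E ->
  (sqint (fun x => g x - h x)%R < (e / 4)%:E)%E ->
  (sqint (fun x => f x - h x)%R < e%:E)%E.
Proof.
move=> mf mg mh fg gh.
have -> : sqint (fun x => f x - h x)%R = sqint (fun x => (f x - g x) + (g x - h x))%R.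
  by apply: eq_integral => x _; rewrite addrA subrK.
apply: le_lt_trans (sqintD _ _) _; [exact: measurable_funB|exact: measurable_funB|].
have -> : e%:E = (2%:E * (e / 4)%:E + 2%:E * (e / 4)%:E)%E.
  by rewrite -!EFinM -EFinD; congr EFin; field.
by apply: lteD; rewrite lte_pmul2l.
Qed.

Lemma H0_closed U : (forall a, measurable_fun Omega (U a)) ->
  (forall e : R, 0 < e -> exists2 V, H0 V &
    forall a, (sqint (fun x => U a x - V a x)%R < e%:E)%E) -> H0 U.
Proof.
move=> mU UV; split=> [a|e e0].
  have [V [VL _] UV1] := UV 1 ltr01; split=> //.
  have -> : sqint (U a) = sqint (fun x => (U a x - V a x) + V a x)%R.
    by apply: eq_integral => x _; rewrite subrK.
  have [mV V2] := VL a.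
  apply: le_lt_trans (sqintD _ mV) _; first exact: measurable_funB.
  apply: lte_add_pinfty; apply: lte_mul_pinfty => //; try exact: sqint_ge0.
  by apply: lt_trans (UV1 a) _; rewrite ltry.
have e4 : 0 < e / 4 by rewrite divr_gt0.
have [V [VL /(_ _ e4)[psi tpsi Vpsi]] UVe] := UV _ e4.
exists psi => // a; have [mV _] := VL a.
apply: (sqint3 (mU a) mV) => //.
by apply: rtest_measurable => //; exact: jet_test.
Qed.

Lemma H0D U V : H0 U -> H0 V -> H0 (fun a x => U a x + V a x).
Proof.
move=> [UL HU] [VL HV]; split=> [a|e e0]; first exact: L2rD.
have e4 : 0 < e / 4 by rewrite divr_gt0.
have [p tp Up] := HU _ e4; have [q tq Vq] := HV _ e4.
exists (fun x => p x + q x); first exact: rtestD.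
move=> a.
have mj psi : rtest Omega psi -> measurable_fun Omega (jet psi a).
  by move=> t; apply: rtest_measurable => //; exact: jet_test.
have jetE : jet (fun x => p x + q x) a = (fun x => jet p a x + jet q a x).
  case: a {mj} => [k|] //=; rewrite partialD// => y; apply: smooth_derivable.
    exact: rtest_smooth tp.
  exact: rtest_smooth tq.
rewrite jetE.
apply: (@sqint3 _ (fun x => jet p a x + V a x)).
- by have [mU _] := UL a; have [mV _] := VL a; exact: measurable_funD.
- by have [mV _] := VL a; apply: measurable_funD => //; exact: mj.
- by apply: measurable_funD; exact: mj.
- rewrite [X in sqint X](_ : _ = (fun x => U a x - jet p a x)); first exact: Up.
  by apply/funext => x; rewrite opprD addrACA subrr addr0.
- rewrite [X in sqint X](_ : _ = (fun x => V a x - jet q a x)); first exact: Vq.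
  by apply/funext => x; rewrite opprD addrACA subrr add0r.
Qed.

Lemma H0N U : H0 U -> H0 (fun a x => - U a x).
Proof.
move=> [UL HU]; split=> [a|e e0]; first exact: L2rN.
have [p tp Up] := HU _ e0.
exists (fun x => - p x); first exact: rtestN.
move=> a; rewrite -sqintN.
rewrite (_ : (fun x => _) = (fun x => U a x - jet p a x)); first exact: Up.
apply/funext => x; rewrite opprB opprK addrC; congr (_ + _).
case: a => [k|] //=; rewrite /partial deriveN ?opprK//.
by apply: smooth_derivable; exact: rtest_smooth tp.
Qed.

(** The only way in which limits are taken in [H0]: domination of the full jets gives strong
    convergence, so weak compactness is avoided. [G] is extended-real valued because one dominating
    function is the sum of a series. *)
Lemma H0_dct (Un : nat -> option 'I_N -> 'rV[R]_N -> R) U (G : 'rV[R]_N -> \bar R) :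
  (forall n, H0 (Un n)) -> (forall a, measurable_fun Omega (U a)) ->
  mu.-integrable Omega G ->
  {ae mu, forall x, Omega x -> forall n a, (((Un n a x) ^+ 2)%:E <= G x)%E} ->
  {ae mu, forall x, Omega x -> forall a, Un ^~ a ^~ x @ \oo --> U a x} ->
  H0 U.
Proof.
move=> HUn mU iG UnG UnU; apply: H0_closed => // e e0.
have mUn n a : measurable_fun Omega (Un n a) by have [/(_ a)[]] := HUn n.
have cv a : \forall n \near \oo, (sqint (fun x => U a x - Un n a x)%R < e%:E)%E.
  (* The bound on (Un)^2 passes to the limit U^2, and (U - Un)^2 <= 2 U^2 + 2 (Un)^2 then gives the
     factor 4. *)
  have [] := @dominated_convergence _ _ _ mu _ mO
    (fun n x => ((U a x - Un n a x) ^+ 2)%:E) (cst 0%E) (fun x => 4%:E * G x)%E.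
  - by move=> n; apply: measurable_sq; exact: measurable_funB.
  - exact: measurable_cst.
  - apply: filterS UnU => x Ux Ox; apply: cvg_EFin; first by near=> n.
    rewrite /comp /= -[X in _ --> X](expr0n _ 2) -[X in X ^+ 2](subrr (U a x)).
    under eq_fun do rewrite expr2.
    rewrite expr2; apply: cvgM; apply: cvgB; (try exact: cvg_cst); exact: Ux.
  - exact: integrableZl.
  - apply: filterS2 UnG UnU => x UG Ux n Ox.
    rewrite gee0_abs ?lee_fin ?sqr_ge0//.
    have UGx : (((U a x) ^+ 2)%:E <= G x)%E.
      case: (G x) (UG Ox) => [r||] Hr; last by have := Hr 0%N a.
        rewrite lee_fin.
        have : (fun n => (Un n a x) ^+ 2) @ \oo --> (U a x) ^+ 2.
          under eq_fun do rewrite expr2.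
          by rewrite expr2; apply: cvgM; exact: Ux.
        move=> /cvgr_to_le; apply.
        by near=> k; have := Hr k a; rewrite lee_fin.
      by rewrite leey.
    have := UG Ox n a; move: UGx; case: (G x) => [r||] //.
      rewrite !lee_fin => h1 h2; have := sqr_ge0 (U a x + Un n a x).
      rewrite sqrrB sqrrD !mulr2n; lra.
    by move=> _ _; rewrite gt0_muley ?lte_fin // leey.
  move=> _ _; rewrite integral0.
  have : nbhs 0%E [set y : \bar R | (y < e%:E)%E].
    by apply: open_nbhs_nbhs; split; [exact: open_ereal_lt_ereal|rewrite /= lte_fin].
  by move=> /[swap] /[apply].
(* There are only finitely many components [a], so one index serves them all. *)
have : \forall n \near \oo, forall a, (sqint (fun x => U a x - Un n a x)%R < e%:E)%E.
  exact: filter_forall.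
move=> [n _ Hn]; exists (Un n) => //; exact: (Hn n (leqnn n)).
Unshelve. all: by end_near. Qed.

End H0.

(** * Weak derivatives and uniqueness of the gradient *)

Section H0_weak.
Context {R : realType} {N : nat}.
Variable Omega : set 'rV[R]_N.
Hypothesis oO : open Omega.
Let mO : measurable Omega := open_measurable_rV oO.
Local Notation mu := (lebesgue_rV N : {sigma_finite_measure set 'rV[R]_N -> \bar R}).
Local Notation L2r := (L2r Omega).
Local Notation sqint := (sqint Omega).
Implicit Types (f g : 'rV[R]_N -> R) (U V : option 'I_N -> 'rV[R]_N -> R).

Lemma integrable_EFinD f g : mu.-integrable Omega (EFin \o f) ->
  mu.-integrable Omega (EFin \o g) ->
  mu.-integrable Omega (EFin \o (fun x => f x + g x)).
Proof. by move=> If Ig; have := integrableD mO If Ig. Qed.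

Lemma integrable_EFinB f g : mu.-integrable Omega (EFin \o f) ->
  mu.-integrable Omega (EFin \o g) ->
  mu.-integrable Omega (EFin \o (fun x => f x - g x)).
Proof. by move=> If Ig; have := integrableB mO If Ig. Qed.

Lemma integrable_EFinZ c f : mu.-integrable Omega (EFin \o f) ->
  mu.-integrable Omega (EFin \o (fun x => c * f x)).
Proof. by move=> If; have := integrableZl mO c If. Qed.

Lemma L2r_sq_integrable f : L2r f -> mu.-integrable Omega (EFin \o (fun x => (f x) ^+ 2)).
Proof.
move=> [mf f2]; apply/integrableP; split; first exact: measurable_sq.
move: f2; apply: le_lt_trans.
rewrite le_eqVlt; apply/orP; left; apply/eqP/eq_integral => x _ /=.
by rewrite ger0_norm// sqr_ge0.
Qed.

Lemma sqintE f : L2r f -> sqint f = (\int[mu]_(x in Omega) ((f x) ^+ 2))%:E.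
Proof.
move=> f2; rewrite /Rintegral fineK//.
by apply: integrable_fin_num => //; exact: L2r_sq_integrable.
Qed.

Lemma L2rM_integrable f g : L2r f -> L2r g ->
  mu.-integrable Omega (EFin \o (fun x => f x * g x)).
Proof.
move=> Lf Lg; have [mf _] := Lf; have [mg _] := Lg.
apply: (@le_integrable _ _ _ _ _ mO _
  (EFin \o (fun x => (f x) ^+ 2 + (g x) ^+ 2))).
- by apply/measurable_EFinP; exact: measurable_funM.
- move=> x _ /=; rewrite lee_fin [leRHS]ger0_norm ?addr_ge0 ?sqr_ge0//.
  have := sqr_ge0 (f x - g x); have := sqr_ge0 (f x + g x).
  rewrite sqrrB sqrrD !mulr2n => h1 h2; rewrite ler_norml.
  by have := sqr_ge0 (f x); have := sqr_ge0 (g x); move=> h3 h4; apply/andP; split; lra.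
- by apply: integrable_EFinD; exact: L2r_sq_integrable.
Qed.

(** Young's inequality with a free weight c, which does the work of Cauchy-Schwarz without square
    roots of integrals. *)
Lemma Rintegral_mul_le f g (c : R) : L2r f -> L2r g -> 0 < c ->
  `|\int[mu]_(x in Omega) (f x * g x)| <=
  c * \int[mu]_(x in Omega) (f x) ^+ 2 + c^-1 * \int[mu]_(x in Omega) (g x) ^+ 2.
Proof.
move=> Lf Lg c0.
have if2 := L2r_sq_integrable Lf; have ig2 := L2r_sq_integrable Lg.
have ifg := L2rM_integrable Lf Lg.
have cf2 : mu.-integrable Omega (EFin \o (fun x => c * (f x) ^+ 2)).
  exact: integrable_EFinZ.
have cg2 : mu.-integrable Omega (EFin \o (fun x => c^-1 * (g x) ^+ 2)).
  exact: integrable_EFinZ.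
apply: le_trans (le_normr_Rintegral mO ifg) _.
rewrite -!RintegralZl// -RintegralD//; apply: le_Rintegral => //.
- exact: integrable_norm.
- exact: integrable_EFinD.
move=> x _; rewrite normrM -(real_normK (num_real (f x))) -(real_normK (num_real (g x))).
move: `|f x| `|g x| (normr_ge0 (f x)) (normr_ge0 (g x)) => a b a0 b0.
rewrite -subr_ge0.
have -> : c * a ^+ 2 + c^-1 * b ^+ 2 - a * b = c^-1 * ((c * a - b / 2) ^+ 2 + 3 / 4 * b ^+ 2).
  by field; rewrite gt_eqF.
apply: mulr_ge0; first by rewrite invr_ge0 ltW.
by apply: addr_ge0; [exact: sqr_ge0|apply: mulr_ge0 => //; exact: sqr_ge0].
Qed.

Lemma H0_weak U k chi : H0 Omega U -> rtest Omega chi ->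
  \int[mu]_(x in Omega) (U None x * partial k chi x) =
  - \int[mu]_(x in Omega) (U (Some k) x * chi x).
Proof.
move=> [UL HU] tchi; apply/eqP; rewrite -subr_eq0 opprK -normr_le0.
have Ldchi : L2r (partial k chi) by apply: rtest_L2r => //; exact: rtest_partial.
have Lchi : L2r chi by exact: rtest_L2r.
(* Integration by parts is exact for the approximating psi. If the squared errors of its jet are at
   most d^2, Young's inequality with weight 1 / d bounds the two remaining integrals by d (1 + int
   (D_k chi)^2) and d (1 + int chi^2), that is by d K in all; d = e / K is then taken. *)
pose K := 2 + \int[mu]_(x in Omega) (partial k chi x) ^+ 2 + \int[mu]_(x in Omega) (chi x) ^+ 2.
have K0 : 0 < K.
  rewrite /K -addrA; apply: ltr_pwDl => //.
  by apply: addr_ge0; apply: Rintegral_ge0 => x _; exact: sqr_ge0.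
apply/ler_addgt0Pl => e e0; rewrite addr0.
have d0 : 0 < e / K by rewrite divr_gt0.
move: (e / K) d0 (divfK (lt0r_neq0 K0) e) => d d0 dK.
have [psi tpsi Upsi] := HU _ (exprn_gt0 2 d0).
have Lpsi a : L2r (jet psi a) by apply: rtest_L2r => //; exact: jet_test.
have LB a : L2r (fun x => U a x - jet psi a x) by apply: L2rD => //; exact: L2rN.
have -> : \int[mu]_(x in Omega) (U None x * partial k chi x) +
   \int[mu]_(x in Omega) (U (Some k) x * chi x) =
  \int[mu]_(x in Omega) ((U None x - jet psi None x) * partial k chi x) +
   \int[mu]_(x in Omega) ((U (Some k) x - jet psi (Some k) x) * chi x).
  under [in RHS]eq_Rintegral do rewrite mulrBl.
  under [X in _ = _ + X]eq_Rintegral do rewrite mulrBl.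
  rewrite (RintegralB mO (L2rM_integrable (UL None) Ldchi) (L2rM_integrable (Lpsi None) Ldchi)).
  rewrite (RintegralB mO (L2rM_integrable (UL (Some k)) Lchi) (L2rM_integrable (Lpsi (Some k)) Lchi)).
  rewrite /= (rtest_IBP _ _ tpsi tchi)//; ring.
have Le a : \int[mu]_(x in Omega) (U a x - jet psi a x) ^+ 2 <= d ^+ 2.
  by rewrite -lee_fin -sqintE//; exact: ltW (Upsi a).
apply: le_trans (ler_normD _ _) _.
have di : 0 < d^-1 by rewrite invr_gt0.
have h1 := Rintegral_mul_le (LB None) Ldchi di.
have h2 := Rintegral_mul_le (LB (Some k)) Lchi di.
apply: le_trans (lerD h1 h2) _; rewrite invrK.
have g1 := ler_wpM2l (ltW di) (Le None).
have g2 := ler_wpM2l (ltW di) (Le (Some k)).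
move: g1 g2; rewrite expr2 mulrA mulVf ?gt_eqF// mul1r => g1 g2.
rewrite -dK /K; lra.
Qed.

(* [U (Some k)] is orthogonal to all test functions and is a limit of them, so
   no mollification is needed. *)
Lemma H0_zero U : H0 Omega U -> (forall x, Omega x -> U None x = 0) ->
  forall a, {ae mu, forall x, Omega x -> U a x = 0}.
Proof.
move=> HU U0 [k|]; last by apply: aeW => x; exact: U0.
have [UL HUe] := HU; have LD := UL (Some k); have [mD _] := LD.
have orth chi : rtest Omega chi -> \int[mu]_(x in Omega) (U (Some k) x * chi x) = 0.
  move=> tchi; apply/eqP; rewrite -oppr_eq0 -(H0_weak _ HU)//; apply/eqP.
  rewrite (@eq_Rintegral _ _ _ mu Omega (fun=> 0)); last by move=> x /set_mem xO; rewrite U0// mul0r.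
  by rewrite /Rintegral integral0.
have sq0 : \int[mu]_(x in Omega) (U (Some k) x) ^+ 2 <= 0.
  apply/ler_addgt0Pl => e e0; rewrite addr0.
  have [psi tpsi /(_ (Some k)) /= Upsi] := HUe _ e0.
  have tdpsi := rtest_partial k tpsi.
  have LB : L2r (fun x => U (Some k) x - partial k psi x).
    by apply: L2rD => //; apply: L2rN; exact: rtest_L2r.
  have -> : \int[mu]_(x in Omega) (U (Some k) x) ^+ 2 =
      \int[mu]_(x in Omega) (U (Some k) x) ^+ 2 -
      2 * \int[mu]_(x in Omega) (U (Some k) x * partial k psi x).
    by rewrite orth// mulr0 subr0.
  apply: le_trans (_ : \int[mu]_(x in Omega) (U (Some k) x - partial k psi x) ^+ 2 <= _); last first.
    by rewrite -lee_fin -sqintE//; exact: ltW.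
  have iM : mu.-integrable Omega (EFin \o (fun x => U (Some k) x * partial k psi x)).
    by apply: L2rM_integrable => //; exact: rtest_L2r.
  have i2M : mu.-integrable Omega (EFin \o (fun x => 2 * (U (Some k) x * partial k psi x))).
    exact: integrable_EFinZ.
  rewrite -RintegralZl// -RintegralB//; last exact: L2r_sq_integrable.
  apply: le_Rintegral => //.
  - by apply: integrable_EFinB => //; exact: L2r_sq_integrable.
  - exact: L2r_sq_integrable.
  move=> x _; rewrite sqrrB -mulr_natl; have := sqr_ge0 (partial k psi x); lra.
have : (sqint (U (Some k)) = 0)%E.
  by apply/eqP; rewrite eq_le sqint_ge0 andbT sqintE.
rewrite /sqint => sqE.
have := (ae_eq_integral_abs mu mO (measurable_sq mD)).1.
rewrite (_ : (\int[_]_(x in _) _)%E = 0%E); last first.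
  rewrite -sqE; apply: eq_integral => x _.
  by rewrite gee0_abs// lee_fin sqr_ge0.
move=> /(_ erefl); apply: filterS => x Hx Ox.
have /= [/eqP] := Hx Ox.
by rewrite sqrf_eq0 => /eqP.
Qed.

(** This is what allows a gradient supplied by a hypothesis to be exchanged for the one computed by
    the chain rule. *)
Lemma H0_unique U V : H0 Omega U -> H0 Omega V ->
  (forall x, Omega x -> U None x = V None x) ->
  forall a, {ae mu, forall x, Omega x -> U a x = V a x}.
Proof.
move=> HU HV UV a.
have UV0 x : Omega x -> U None x - V None x = 0 by move=> /UV ->; rewrite subrr.
have := H0_zero (H0D oO HU (H0N HV)) UV0 a.
by apply: filterS => x /[apply] Hx; apply/eqP; rewrite -subr_eq0 Hx.
Qed.

End H0_weak.

(** * Bernstein approximation *)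

Section bernstein.
Context {R : realType}.
Variable M : R.
Hypothesis M0 : 0 < M.
Implicit Types (F G : nat -> R) (x : R).

(* The Bernstein polynomial
   sum_k C(n, k) (x / M)^k (1 - x / M)^(n - k) F(k), defined by conditioning on
   the first of n Bernoulli trials. *)
Fixpoint bern n F : {poly R} := if n is n'.+1 then
  (M^-1 *: 'X) * bern n' (fun k => F k.+1) + (1 - M^-1 *: 'X) * bern n' F
  else (F 0%N)%:P.

Lemma bernS n F x : (bern n.+1 F).[x] =
  x / M * (bern n (fun k => F k.+1)).[x] + (1 - x / M) * (bern n F).[x].
Proof. by rewrite /= !hornerE (mulrC x). Qed.

(** The mean and the second moment of the binomial law of parameter x / M. They are kept in one
    formula with free coefficients because k |-> k + 1 maps quadratic polynomials to quadratic
    polynomials, which closes the induction. *)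
Lemma bern_quad n (a b c x : R) :
  (bern n (fun k => a + b * k%:R + c * k%:R ^+ 2)).[x] =
  a + b * n%:R * (x / M) + c * (n%:R * (x / M) * (1 - x / M) + n%:R ^+ 2 * (x / M) ^+ 2).
Proof.
elim: n a b c => [|n IHn] a b c; first by rewrite /= hornerC; ring.
rewrite bernS IHn.
rewrite (_ : (fun k : nat => _) = (fun k : nat => (a + b + c) + (b + 2 * c) * k%:R + c * k%:R ^+ 2)).
  by rewrite IHn -[n.+1]addn1 natrD; ring.
by apply/funext => k; rewrite -[k.+1]addn1 natrD; ring.
Qed.

Lemma bern_le n F G x : 0 <= x <= M -> (forall k, (k <= n)%N -> F k <= G k) ->
  (bern n F).[x] <= (bern n G).[x].
Proof.
move=> /andP[x0 xM].
have y0 : 0 <= x / M by rewrite divr_ge0// ltW.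
have y1 : 0 <= 1 - x / M by rewrite subr_ge0 ler_pdivrMr// mul1r.
elim: n F G => [|n IHn] F G FG; first by rewrite /= !hornerC; exact: FG.
rewrite !bernS; apply: lerD; apply: ler_wpM2l => //; apply: IHn => k kn; apply: FG => //.
exact: leqW.
Qed.

Lemma bern_cst n a x : (bern n (fun=> a)).[x] = a.
Proof.
transitivity (bern n (fun k => a + 0 * k%:R + 0 * k%:R ^+ 2)).[x].
  by congr (horner (bern _ _) _); apply/funext => k; rewrite !mul0r !addr0.
by rewrite bern_quad !mul0r !addr0.
Qed.

Lemma bernZ n c F x : (bern n (fun k => c * F k)).[x] = c * (bern n F).[x].
Proof.
elim: n F => [|n IHn] F; first by rewrite /= !hornerC.
by rewrite !bernS !IHn; ring.
Qed.

Lemma bern_bound n F B x : 0 <= x <= M -> (forall k, (k <= n)%N -> `|F k| <= B) ->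
  `|(bern n F).[x]| <= B.
Proof.
move=> xM FB; rewrite ler_norml -[- B](bern_cst n _ x) -[X in _ && (_ <= X)](bern_cst n _ x).
by apply/andP; split; apply: bern_le => // k /FB; rewrite ler_norml => /andP[].
Qed.

(** The derivative is again of Bernstein type, with scaled difference quotients as coefficients;
    hence one convergence lemma serves for a function and its derivative. *)
Lemma deriv_bern n F :
  (bern n.+1 F)^`() = (n.+1%:R * M^-1) *: bern n (fun k => F k.+1 - F k).
Proof.
elim: n F => [|n IHn] F.
  rewrite /= derivD !derivM derivB derivZ derivX !derivC -!mul_polyC.
  by rewrite polyCM polyCB; ring.
have bB m G H : bern m (fun k => G k - H k) = bern m G - bern m H.
  elim: m G H => [|m IHm] G H; first by rewrite /= polyCB.
  by rewrite /= !IHm; ring.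
rewrite [bern n.+2 F]/= -/(bern n.+1 F) -/(bern n.+1 (fun k => F k.+1)).
rewrite derivD !derivM derivB derivZ derivX derivC !IHn.
rewrite [in RHS]/= !bB /= -!mul_polyC !polyCM -[n.+2]addn1 [(n.+1 + 1)%:R]natrD polyCD polyC1; ring.
Qed.

(** Bernstein's proof by Chebyshev's inequality. The coefficients may depend on n, since for
    derivatives they are difference quotients and not samples of a fixed function. *)
Lemma bern_cvg (G : nat -> nat -> R) B L x : 0 <= x <= M ->
  (forall n k, (k <= n)%N -> `|G n k| <= B) ->
  (forall e : R, 0 < e -> exists2 d : R, 0 < d & forall n k, (k <= n)%N -> n.+1%:R^-1 < d ->
     `|M * k%:R / n%:R - x| < d -> `|G n k - L| <= e) ->
  (bern n (G n)).[x] @[n --> \oo] --> L.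
Proof.
move=> xM GB GL; apply/cvgrPdist_le => e e0.
have e2 : 0 < e / 2 by rewrite divr_gt0.
have [d d0 Hd] := GL _ e2.
(* At a node farther than d from x the trivial bound |B| + |L| is at most K (node - x)^2. Averaging
   this square gives the variance, at most M^2 / n. *)
pose K := (`|B| + `|L| ) / d ^+ 2.
have K0 : 0 <= K by rewrite divr_ge0 ?addr_ge0// sqr_ge0.
near=> n.
have n0 : (0 < n)%N by near: n; exists 1%N.
have nd : n.+1%:R^-1 < d by near: n; exact: near_infty_natSinv_lt (PosNum d0).
have nK : K * M ^+ 2 / n%:R <= e / 2.
  rewrite ler_pdivrMr ?ltr0n// [leRHS]mulrC -ler_pdivrMr//.
  by near: n; exact: nbhs_infty_ger.
have nn0 : n%:R != 0 :> R by rewrite pnatr_eq0 -lt0n.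
have bd k : (k <= n)%N -> `|G n k - L| <= e / 2 + K * (M * k%:R / n%:R - x) ^+ 2.
  move=> kn; have [xd|xd] := ltP `|M * k%:R / n%:R - x| d.
    by apply: le_trans (Hd _ _ kn nd xd) _; rewrite lerDl mulr_ge0// sqr_ge0.
  apply: le_trans (_ : K * d ^+ 2 <= _).
    rewrite /K divfK; last by rewrite expf_neq0// gt_eqF.
    apply: le_trans (ler_normB _ _) _; rewrite lerD2r.
    by apply: le_trans (GB _ _ kn) _; exact: ler_norm.
  rewrite -[X in X <= _]add0r lerD ?(ltW e2)// ler_wpM2l//.
  by rewrite -(real_normK (num_real (_ - x))) lerXn2r// ?nnegrE ?ltW.
(* The coefficients of e / 2 + K (M k / n - x)^2 as a quadratic polynomial in k, so that [bern_quad]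
   applies. *)
pose a1 := e / 2 + K * x ^+ 2.
pose b1 := - (2 * K * x * M / n%:R).
pose c1 := K * M ^+ 2 / n%:R ^+ 2.
have qE k : e / 2 + K * (M * k%:R / n%:R - x) ^+ 2 = a1 + b1 * k%:R + c1 * k%:R ^+ 2.
  by rewrite /a1 /b1 /c1; field.
have /andP[x0 x1] := xM.
have y0 : 0 <= x / M by rewrite divr_ge0// ltW.
have y1 : 0 <= 1 - x / M by rewrite subr_ge0 ler_pdivrMr// mul1r.
have bE : (bern n (fun k => a1 + b1 * k%:R + c1 * k%:R ^+ 2)).[x] <= e.
  rewrite bern_quad.
  have -> : a1 + b1 * n%:R * (x / M) +
    c1 * (n%:R * (x / M) * (1 - x / M) + n%:R ^+ 2 * (x / M) ^+ 2) =
    e / 2 + K * M ^+ 2 / n%:R * ((x / M) * (1 - x / M)).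
    by rewrite /a1 /b1 /c1; field; rewrite nn0 gt_eqF.
  rewrite [leRHS](splitr e).
  apply: lerD => //; apply: le_trans nK.
  rewrite -[leRHS]mulr1; apply: ler_pM => //.
  - by apply: mulr_ge0; [apply: mulr_ge0 => //; exact: sqr_ge0|rewrite invr_ge0].
  - exact: mulr_ge0.
  - apply: mulr_ile1 => //; last by rewrite gerBl.
    by rewrite ler_pdivrMr// mul1r.
rewrite distrC ler_norml; apply/andP; split.
  rewrite lerBrDl; apply: le_trans (_ : (bern n (fun k => L - (a1 + b1 * k%:R + c1 * k%:R ^+ 2))).[x] <= _); last first.
    apply: bern_le => // k kn; have := bd k kn; rewrite qE ler_norml; move: (_ + _ * _) => z /andP[]; lra.
  rewrite (_ : (fun k : nat => _) = (fun k : nat => (L - a1) + (- b1) * k%:R + (- c1) * k%:R ^+ 2)); last first.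
    by apply/funext => k; ring.
  move: bE; rewrite !bern_quad; lra.
rewrite lerBlDl.
apply: le_trans (_ : _ <= (bern n (fun k => L + (a1 + b1 * k%:R + c1 * k%:R ^+ 2))).[x]) _.
  apply: bern_le => // k kn; have := bd k kn; rewrite qE ler_norml; move: (_ + _ * _) => z /andP[]; lra.
rewrite (_ : (fun k : nat => _) = (fun k : nat => (L + a1) + b1 * k%:R + c1 * k%:R ^+ 2)); last first.
  by apply/funext => k; ring.
move: bE; rewrite !bern_quad; lra.
Unshelve. all: by end_near. Qed.

End bernstein.

Section C1_approx.
Context {R : realType}.

Lemma segment_bounded (f : R -> R) (a b : R) : (forall x, a <= x <= b -> {for x, continuous f}) ->
  exists B, forall x, a <= x <= b -> `|f x| <= B.
Proof.
move=> cf; have /compact_bounded[B [_ HB]] : compact (f @` `[a, b]%classic).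
  apply: continuous_compact; last exact: segment_compact.
  by apply: continuous_in_subspaceT => x; rewrite inE /= in_itv/=; exact: cf.
exists (B + 1) => x xab; apply: (HB (B + 1)); first by rewrite ltrDl.
by exists x => //=; rewrite in_itv.
Qed.

(** By the mean value theorem the coefficients of the derivative of the Bernstein polynomial of
    degree n + 1 are values of g' between consecutive nodes, so [bern_cvg] applies to both.
    Two-sided differentiability at 0 is assumed; this is the origin of the negative number r in the
    two applications to fields below. *)
Lemma C1_poly_approx (g : R -> R) (M : R) : 0 < M ->
  (forall x, 0 <= x -> derivable g x 1) ->
  (forall x, 0 <= x -> {for x, continuous (derive1 g)}) ->
  exists (p : nat -> {poly R}) (B : R), forall x, 0 <= x <= M ->
    [/\ forall n, `|(p n).[x]| <= B, forall n, `|(p n)^`().[x]| <= B,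
        (p n).[x] @[n --> \oo] --> g x &
        (p n)^`().[x] @[n --> \oo] --> derive1 g x].
Proof.
move=> M0 dg cdg.
have cg x : 0 <= x -> {for x, continuous g}.
  by move=> x0; apply: differentiable_continuous; apply/derivable1_diffP; exact: dg.
have [B0 HB0] : exists B, forall x, 0 <= x <= M -> `|g x| <= B.
  by apply: segment_bounded => x /andP[x0 _]; exact: cg.
have [B1 HB1] : exists B, forall x, 0 <= x <= M -> `|derive1 g x| <= B.
  by apply: segment_bounded => x /andP[x0 _]; exact: cdg.
pose t n k : R := M * k%:R / n%:R.
have tM n k : (k <= n)%N -> 0 <= t n k <= M.
  move=> kn; apply/andP; split; first by rewrite divr_ge0// mulr_ge0// ltW.
  rewrite /t; case: n kn => [|n] kn; first by rewrite invr0 mulr0 ltW.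
  by rewrite ler_pdivrMr ?ltr0n// ler_pM2l// ler_nat.
have mvt n k : (k <= n)%N -> exists2 c, t n.+1 k <= c <= t n.+1 k.+1 &
    n.+1%:R * M^-1 * (g (t n.+1 k.+1) - g (t n.+1 k)) = derive1 g c.
  move=> kn.
  have tk : t n.+1 k.+1 - t n.+1 k = M / n.+1%:R.
    by rewrite /t -mulrBl -mulrBr -[in k.+1]addn1 natrD addrAC subrr add0r mulr1.
  have tk0 : t n.+1 k <= t n.+1 k.+1.
    by rewrite -subr_ge0 tk divr_ge0// ltW.
  have [t0 _] := andP (tM n.+1 k (leqW kn)).
  have [||c] := @MVT_segment R g (derive1 g) _ _ tk0.
  - move=> x; rewrite in_itv/= => /andP[tx _]; apply: DeriveDef; last by rewrite derive1E.
    by apply: dg; exact: le_trans (ltW tx).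
  - apply: continuous_in_subspaceT => x; rewrite inE /= in_itv/= => /andP[tx _].
    by apply: cg; exact: le_trans tx.
  rewrite in_itv/= => ctk ->; exists c => //.
  have c0 : n.+1%:R != 0 :> R by rewrite pnatr_eq0.
  by rewrite tk; move: (n.+1%:R) c0 => r r0; field; rewrite r0 gt_eqF.
exists (fun n => bern M n.+1 (fun k => g (t n.+1 k))), (Num.max B0 B1) => x xM.
pose G n k := n.+1%:R * M^-1 * (g (t n.+1 k.+1) - g (t n.+1 k)).
have dE n : (bern M n.+1 (fun k => g (t n.+1 k)))^`().[x] = (bern M n (G n)).[x].
  by rewrite deriv_bern hornerZ -bernZ.
split.
- move=> n; apply: bern_bound => // k kn; rewrite le_max; apply/orP; left.
  by apply: HB0; exact: tM.
- move=> n; rewrite dE; apply: bern_bound => // k kn.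
  rewrite le_max; apply/orP; right; rewrite /G; have [c /andP[c1 c2] ->] := mvt n k kn.
  apply: HB1; have [t0 _] := andP (tM n.+1 k (leqW kn)).
  by have [_ t1] := andP (tM n.+1 k.+1 kn); rewrite (le_trans t0)//= (le_trans c2).
- suff H : (fun n => (bern M n (fun k => g (t n k))).[x]) @ \oo --> g x.
    by have := H; rewrite -cvg_shiftS.
  apply: (@bern_cvg _ _ M0 _ B0) => //.
    by move=> n k kn; apply: HB0; exact: tM.
  move=> e e0; have /andP[x0 _] := xM.
  have /cvgrPdist_le/(_ _ e0) := cg x x0.
  move=> /nbhs_ballP[d /= d0 Hd]; exists d => // n k kn _ tx.
  by rewrite distrC; apply: Hd; rewrite /ball/= distrC.
- rewrite (_ : (fun n => _) = (fun n => (bern M n (G n)).[x])); last exact/funext.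
  apply: (@bern_cvg _ _ M0 _ B1) => //.
    move=> n k kn; rewrite /G; have [c /andP[c1 c2] ->] := mvt n k kn.
    apply: HB1; have [t0 _] := andP (tM n.+1 k (leqW kn)).
    by have [_ t1] := andP (tM n.+1 k.+1 kn); rewrite (le_trans t0)//= (le_trans c2).
  move=> e e0; have /andP[x0 _] := xM.
  have /cvgrPdist_le/(_ _ e0) := cdg x x0.
  move=> /nbhs_ballP[d /= d0 Hd].
  (* The node M k / n and the mean value point c both lie between the nodes of index k and k + 1 of
     degree n + 1, which are M / (n + 1) < d / 2 apart. The other d / 2 is the distance from M k / n
     to x. *)
  exists (Num.min (d / 2) (d / (2 * M))).
    by rewrite lt_min !divr_gt0// mulr_gt0.
  move=> n k kn; rewrite !lt_min => /andP[_ nd] /andP[tx _].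
  rewrite /G; have [c /andP[c1 c2] ->] := mvt n k kn.
  rewrite distrC; apply: Hd; rewrite /ball/= distrC.
  have tk1 : t n.+1 k.+1 - t n.+1 k = M / n.+1%:R.
    by rewrite /t -mulrBl -mulrBr -[in k.+1]addn1 natrD addrAC subrr add0r mulr1.
  have Md : M / n.+1%:R < d / 2.
    by rewrite mulrC -ltr_pdivlMr// -mulrA -invfM.
  have l1 : t n.+1 k <= t n k.
    case: n kn {nd tx c1 c2 tk1 Md} => [|n] kn.
      by move: kn; rewrite leqn0 => /eqP ->; rewrite /t mulr0 !mul0r.
    by rewrite /t ler_pM ?invr_ge0// ?mulr_ge0// ?(ltW M0)// lef_pV2 ?posrE ?ltr0n// ler_nat.
  have l2 : t n k <= t n.+1 k.+1.
    case: n kn {nd tx c1 c2 tk1 Md l1} => [|n] kn.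
      by move: kn; rewrite leqn0 => /eqP ->; rewrite /t mulr0 mul0r divr_ge0// mulr_ge0// ltW.
    rewrite /t -!mulrA ler_pM2l// ler_pdivrMr ?ltr0n// mulrAC ler_pdivlMr ?ltr0n//.
    by rewrite -!natrM ler_nat mulSn mulnS leq_add2r.
  move: tx; rewrite -/(t n k) !ltr_norml => /andP[x1 x2].
  move: (M / _) (t n k) (t n.+1 k) (t n.+1 k.+1) tk1 Md l1 l2 c1 c2 x1 x2 => r t1 t2 t3.
  by move=> *; apply/andP; split; lra.
Qed.

End C1_approx.

(** * The chain rule for radial rearrangements *)

Lemma nneseries_cvg_0 (R : realType) (a : nat -> R) : (forall n, 0 <= a n) ->
  (\sum_(n <oo) (a n)%:E < +oo)%E -> a @ \oo --> 0.
Proof.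
move=> a0 afin.
have := nneseries_tail_cvg afin => /(_ (fun k _ => a0 k)) tl.
apply/cvgrPdist_lt => e e0.
have : nbhs 0%E [set y : \bar R | (y < e%:E)%E].
  by apply: open_nbhs_nbhs; split; [exact: open_ereal_lt_ereal|rewrite /= lte_fin].
move=> /tl H.
have {}H : \forall n \near \oo, (\sum_(n <= k <oo) (a k)%:E < e%:E)%E by exact: H.
apply: filterS H => n /= tn; rewrite sub0r normrN ger0_norm// -lte_fin.
apply: le_lt_trans tn.
have := @nneseries_lim_ge R (fun n => (a n)%:E) xpredT n n.+1.
by rewrite big_nat1; apply=> k _ _; rewrite lee_fin.
Qed.

Lemma cvg_bigsum (R : realType) (T : Type) (r : seq T) (f : T -> nat -> R) (l : T -> R) :
  (forall c, f c n @[n --> \oo] --> l c) ->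
  (\sum_(c <- r) f c n) @[n --> \oo] --> \sum_(c <- r) l c.
Proof.
by move=> fl; apply: cvg_big => //; exact: add_continuous.
Qed.

(** Lagrange's identity: twice the difference of the two sides is the sum of all (x_c - x_d)^2. *)
Lemma sum_sqr_le (R : realDomainType) (T : finType) (x : T -> R) :
  (\sum_c x c) ^+ 2 <= #|T|%:R * \sum_c x c ^+ 2.
Proof.
rewrite -subr_ge0 -(@pmulr_rge0 _ 2)//.
have -> : 2 * (#|T|%:R * \sum_c x c ^+ 2 - (\sum_c x c) ^+ 2) =
    \sum_c \sum_d (x c - x d) ^+ 2.
  transitivity (\sum_c \sum_(d : T) x c ^+ 2 + \sum_(c : T) \sum_d x d ^+ 2 -
      2 * (\sum_c \sum_d x c * x d)).
    have -> : \sum_c \sum_(d : T) x c ^+ 2 = #|T|%:R * \sum_c x c ^+ 2.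
      by under eq_bigr do rewrite sumr_const; rewrite sumrMnl mulr_natl.
    have -> : \sum_(c : T) \sum_d x d ^+ 2 = #|T|%:R * \sum_c x c ^+ 2.
      by rewrite sumr_const mulr_natl.
    have -> : \sum_c \sum_d x c * x d = (\sum_c x c) ^+ 2.
      by under eq_bigr do rewrite -mulr_sumr; rewrite -mulr_suml expr2.
    ring.
  rewrite mulr_sumr -big_split -sumrB /=; apply: eq_bigr => c _.
  by rewrite mulr_sumr -big_split -sumrB /=; apply: eq_bigr => d _; ring.
by apply: sumr_ge0 => c _; apply: sumr_ge0 => d _; exact: sqr_ge0.
Qed.

Section radial.
Context {R : realType} {N : nat} {J : finType}.
Implicit Types (V : J -> option 'I_N -> 'rV[R]_N -> R) (g dg : R -> R).

Definition sqnorm V (x : 'rV[R]_N) : R := \sum_j V j None x ^+ 2.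

(* The 1-jet of [g (|v| ^ 2) v_j] obtained by the chain rule from the 1-jet [V]
   of v, when [dg] is the derivative of [g]. *)
Definition radial g dg V (j : J) (a : option 'I_N) (x : 'rV[R]_N) : R :=
  g (sqnorm V x) * V j a x +
  (if a is Some _ then
     2 * dg (sqnorm V x) * (\sum_l V l None x * V l a x) * V j None x else 0).

Definition l1norm V x : R := \sum_(c : J * option 'I_N) `|V c.1 c.2 x|.

Lemma sqnorm_ge0 V x : 0 <= sqnorm V x.
Proof. by apply: sumr_ge0 => j _; exact: sqr_ge0. Qed.

Lemma le_sqnorm V x j : V j None x ^+ 2 <= sqnorm V x.
Proof.
by rewrite /sqnorm (bigD1 j)//= lerDl; apply: sumr_ge0 => i _; exact: sqr_ge0.
Qed.

Lemma l1norm_ge0 V x : 0 <= l1norm V x.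
Proof. exact: sumr_ge0. Qed.

Lemma le_l1norm V x j a : `|V j a x| <= l1norm V x.
Proof. by rewrite /l1norm (bigD1 (j, a))//= lerDl; exact: sumr_ge0. Qed.

Lemma le_sum_l1norm V x a : \sum_l `|V l a x| <= l1norm V x.
Proof.
rewrite /l1norm -(pair_big xpredT xpredT (fun l a => `|V l a x|))/=.
apply: ler_sum => l _; rewrite (bigD1 a)//= lerDl; exact: sumr_ge0.
Qed.

(** Since |V_l V_j| <= |V|^2, the term containing [dg] is controlled by t dg(t) at t = |V|^2, and
    [dg] itself may blow up at 0. The constant 3 is 1 for the first term plus 2 for the second. *)
Lemma radial_le g dg V j a x (L : R) : `|g (sqnorm V x)| <= L ->
  `|sqnorm V x * dg (sqnorm V x)| <= L -> `|radial g dg V j a x| <= 3 * L * l1norm V x.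
Proof.
move=> gL dgL; have Q0 := sqnorm_ge0 V x; have L0 : 0 <= L by exact: le_trans gL.
have l0 := l1norm_ge0 V x.
have h1 : `|g (sqnorm V x) * V j a x| <= L * l1norm V x.
  by rewrite normrM ler_pM// le_l1norm.
apply: le_trans (ler_normD _ _) _.
have -> : 3 * L * l1norm V x = L * l1norm V x + 2 * (L * l1norm V x) by ring.
apply: lerD => //; case: a {h1} => [k|]; last by rewrite normr0 !mulr_ge0.
rewrite -mulrA -mulrA !normrM ger0_norm// ler_pM2l//.
apply: le_trans (_ : L * \sum_l `|V l (Some k) x| <= _); last first.
  by rewrite ler_wpM2l// le_sum_l1norm.
apply: le_trans (_ : `|sqnorm V x * dg (sqnorm V x)| * \sum_l `|V l (Some k) x| <= _); last first.
  by rewrite ler_wpM2r// sumr_ge0.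
rewrite normrM (ger0_norm Q0) mulrAC [X in _ <= X]mulrC ler_wpM2l// -normrM.
rewrite mulr_suml mulr_sumr; apply: le_trans (ler_norm_sum _ _ _) _.
apply: ler_sum => l _; rewrite mulrAC normrM ler_wpM2r//.
have h1 := le_sqnorm V x l; have h2 := le_sqnorm V x j.
have := sqr_ge0 (V l None x - V j None x); have := sqr_ge0 (V l None x + V j None x).
rewrite sqrrB sqrrD !mulr2n => h3 h4; rewrite ler_norml; apply/andP; split; lra.
Qed.

Lemma radial_cvg (gn dgn : nat -> R -> R) (Vn : nat -> J -> option 'I_N -> 'rV[R]_N -> R)
    g dg V j a x :
  (forall j a, Vn n j a x @[n --> \oo] --> V j a x) ->
  gn n (sqnorm (Vn n) x) @[n --> \oo] --> g (sqnorm V x) ->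
  dgn n (sqnorm (Vn n) x) @[n --> \oo] --> dg (sqnorm V x) ->
  radial (gn n) (dgn n) (Vn n) j a x @[n --> \oo] --> radial g dg V j a x.
Proof.
move=> cV cg cdg; rewrite /radial; apply: cvgD; first exact: cvgM.
case: a => [k|]; last exact: cvg_cst.
apply: cvgM => //; apply: cvgM; first by apply: cvgM => //; exact: cvg_cst.
by apply: cvg_bigsum => l; exact: cvgM.
Qed.

Lemma sqnorm_cvg (Vn : nat -> J -> option 'I_N -> 'rV[R]_N -> R) V x :
  (forall j, Vn n j None x @[n --> \oo] --> V j None x) ->
  sqnorm (Vn n) x @[n --> \oo] --> sqnorm V x.
Proof.
move=> cV; apply: cvg_bigsum => l.
by under eq_fun do rewrite expr2; rewrite expr2; exact: cvgM.
Qed.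

Variable Omega : set 'rV[R]_N.
Hypothesis oO : open Omega.
Let mO : measurable Omega := open_measurable_rV oO.

(** The functions composed with |v| are continuous on (0, +oo) only; their value at 0 is a
    convention and may be a jump. *)
Lemma measurable_comp_pos (h : R -> R) (q : 'rV[R]_N -> R) :
  (forall t, 0 < t -> {for t, continuous h}) ->
  measurable_fun Omega q -> (forall x, Omega x -> 0 <= q x) ->
  measurable_fun Omega (h \o q).
Proof.
move=> ch mq q0.
have mpos : measurable_fun (`]0, +oo[%classic : set R) h.
  apply: open_continuous_measurable_fun; first exact: interval_open.
  by move=> t; rewrite inE /= in_itv/= andbT; exact: ch.
pose h1 t := if 0 < t then h t else h 0.
have mh1 : measurable_fun setT h1.
  apply: measurable_fun_if => //.
  - by apply: measurable_fun_ltr; [exact: measurable_cst|exact: measurable_id].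
  - rewrite setTI (_ : _ @^-1` _ = (`]0, +oo[%classic : set R))//.
    by apply/seteqP; split=> t /=; rewrite in_itv/= andbT.
apply: (@eq_measurable_fun _ _ _ _ Omega (h1 \o q)).
  move=> x /set_mem /q0; rewrite /h1 /= le_eqVlt => /predU1P[<-|->]//.
  by rewrite ltxx.
exact: measurableT_comp.
Qed.

Lemma measurable_sqnorm V : (forall j, measurable_fun Omega (V j None)) ->
  measurable_fun Omega (sqnorm V).
Proof. by move=> mV; apply: measurable_sum => j; exact: measurable_funX. Qed.

Lemma measurable_radial g dg V j a : (forall j a, measurable_fun Omega (V j a)) ->
  (forall t, 0 < t -> {for t, continuous g}) ->
  (forall t, 0 < t -> {for t, continuous dg}) ->
  measurable_fun Omega (radial g dg V j a).
Proof.
move=> mV cg cdg; have mQ : measurable_fun Omega (sqnorm V) by exact: measurable_sqnorm.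
have Q0 x : Omega x -> 0 <= sqnorm V x by move=> _; exact: sqnorm_ge0.
have mg := measurable_comp_pos cg mQ Q0.
have mdg := measurable_comp_pos cdg mQ Q0.
apply: measurable_funD; first exact: measurable_funM.
case: a => [k|]; last exact: measurable_cst.
apply: measurable_funM => //; apply: measurable_funM.
  by apply: measurable_funM => //; exact: measurable_cst.
by apply: measurable_sum => l; exact: measurable_funM.
Qed.

Lemma L2rZ (c : R) (f : 'rV[R]_N -> R) : L2r Omega f -> L2r Omega (fun x => c * f x).
Proof.
move=> [mf f2]; split; first exact: measurable_funM.
rewrite /sqint (_ : (\int[_]_(x in _) _)%E = ((c ^+ 2)%:E * sqint Omega f)%E).
  by rewrite lte_mul_pinfty// lee_fin sqr_ge0.
rewrite /sqint -ge0_integralZl//.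
- by apply: eq_integral => x _; rewrite exprMn.
- exact: measurable_sq.
- by move=> x _; rewrite lee_fin sqr_ge0.
- by rewrite lee_fin sqr_ge0.
Qed.

Lemma L2r_norm (f : 'rV[R]_N -> R) : L2r Omega f -> L2r Omega (fun x => `|f x|).
Proof.
move=> [mf f2]; split; first exact: measurableT_comp.
move: f2; apply: le_lt_trans; rewrite le_eqVlt; apply/orP; left; apply/eqP.
by apply: eq_integral => x _; rewrite real_normK// num_real.
Qed.

Lemma L2r0 : L2r Omega (fun=> 0).
Proof.
split; first exact: measurable_cst.
by rewrite /sqint integral0_eq// => x _; rewrite expr0n.
Qed.

Lemma L2r_sum (T : Type) (r : seq T) (f : T -> 'rV[R]_N -> R) :
  (forall c, L2r Omega (f c)) -> L2r Omega (fun x => \sum_(c <- r) f c x).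
Proof.
move=> Lf; elim: r => [|c r IHr].
  by under [fun _ => _]funext do rewrite big_nil; exact: L2r0.
by under [fun _ => _]funext do rewrite big_cons; exact: L2rD.
Qed.

Lemma l1norm_L2r V : (forall j a, L2r Omega (V j a)) -> L2r Omega (l1norm V).
Proof. by move=> LV; apply: L2r_sum => c; exact: L2r_norm. Qed.

End radial.

Lemma sum1_natr (R : pzRingType) (T : finType) : \sum_(c : T) 1 = #|T|%:R :> R.
Proof. by rewrite sumr_const. Qed.

Section chain_rule.
Context {R : realType} {N : nat} {J : finType}.
Variable Omega : set 'rV[R]_N.
Hypothesis oO : open Omega.
Let mO : measurable Omega := open_measurable_rV oO.
Local Notation mu := (lebesgue_rV N : {sigma_finite_measure set 'rV[R]_N -> \bar R}).
Implicit Types (V : J -> option 'I_N -> 'rV[R]_N -> R) (g dg : R -> R).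

Lemma radial_poly_jet (psi : J -> 'rV[R]_N -> R) (p : {poly R}) j :
  (forall j, rtest Omega (psi j)) -> exists2 chi, rtest Omega chi &
    radial (horner p) (horner p^`()) (fun l => jet (psi l)) j = jet chi.
Proof.
move=> tpsi; have spsi l : smooth (psi l) := rtest_smooth (tpsi l).
pose Q := sqnorm (fun l => jet (psi l)).
have Ssq l : smooth (fun x => psi l x ^+ 2).
  by under [fun _ => _]funext do rewrite expr2; exact: smoothM.
have sQ : smooth Q by apply: smooth_sum => l; exact: Ssq.
have spQ : smooth (fun x => p.[Q x]) by exact: smooth_horner.
exists (fun x => p.[Q x] * psi j x); first exact: rtestM.
apply/funext => -[k|]; apply/funext => x; last by rewrite /radial addr0.
rewrite /radial /= -/Q partialM; first last.
- by move=> y; exact: smooth_derivable.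
- by move=> y; exact: smooth_derivable.
have dQ : partial k Q x = 2 * \sum_l psi l x * partial k (psi l) x.
  rewrite /Q /sqnorm partial_sum//= mulr_sumr; apply: eq_bigr => l _.
  under [fun _ => _]funext do rewrite expr2.
  by rewrite partialM => [|y|y]; [ring|exact: smooth_derivable|exact: smooth_derivable].
by rewrite partial_horner// dQ; ring.
Qed.

Lemma integrable_sq_l1norm V (c : R) : (forall j a, L2r Omega (V j a)) ->
  mu.-integrable Omega (EFin \o (fun x => (c * l1norm V x) ^+ 2)).
Proof. by move=> LV; apply: L2r_sq_integrable => //; apply: L2rZ => //; exact: l1norm_L2r. Qed.

Lemma derive1_near g dg (r t : R) : (forall t, r < t -> is_derive t 1 g (dg t)) -> r < t ->
  {for t, continuous dg} -> {for t, continuous (derive1 g)}.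
Proof.
move=> gdg rt cdg.
have E : \forall s \near t, dg s = derive1 g s.
  have : \forall s \near t, r < s by exact: lt_nbhsr.
  by apply: filterS => s rs; rewrite derive1E; have := gdg s rs => -[].
rewrite /prop_for /continuous_at (_ : derive1 g t = dg t); last first.
  by rewrite derive1E; have [] := gdg t rt.
exact: cvg_trans (near_eq_cvg E) cdg.
Qed.

(** A test field is bounded, so |psi|^2 ranges in a fixed [0, M], on which polynomials approximate g
    together with its derivative; no growth condition on g is required at this stage. *)
Lemma H0_radial_test (psi : J -> 'rV[R]_N -> R) g dg (r : R) j :
  (forall j, rtest Omega (psi j)) -> r < 0 ->
  (forall t, r < t -> is_derive t 1 g (dg t)) ->
  (forall t, r < t -> {for t, continuous dg}) ->
  H0 Omega (radial g dg (fun l => jet (psi l)) j).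
Proof.
move=> tpsi r0 gdg cdg; set V := fun l => jet (psi l).
have LV l a : L2r Omega (V l a) by apply: rtest_L2r => //; exact: jet_test.
have [B HB] : exists B, forall x, sqnorm V x <= B.
  have /choice[b Hb] l := rtest_bounded (tpsi l).
  exists (\sum_l b l ^+ 2) => x; apply: ler_sum => l _.
  rewrite -(real_normK (num_real (V l None x))) lerXn2r ?nnegrE//; last exact: Hb.
  exact: le_trans (Hb l x).
pose M := `|B| + 1.
have M0 : 0 < M by rewrite ltr_wpDl.
have QM x : 0 <= sqnorm V x <= M.
  rewrite sqnorm_ge0/=; apply: le_trans (HB x) _.
  by rewrite /M (le_trans (ler_norm _))// lerDl.
have cg t : 0 <= t -> {for t, continuous g}.
  move=> t0; apply: differentiable_continuous; apply/derivable1_diffP.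
  by have [] := gdg t (lt_le_trans r0 t0).
have [|t t0|p [K HK]] := C1_poly_approx (g := g) M0.
- by move=> t t0; have [] := gdg t (lt_le_trans r0 t0).
- have rt := lt_le_trans r0 t0.
  by apply: (derive1_near gdg rt); exact: cdg.
have K0 : 0 <= K.
  have [|HK0 _ _ _] := HK 0; first by rewrite lexx ltW.
  exact: le_trans (HK0 0%N).
(* K (1 + M) bounds both p_n by K and t p_n'(t) by M K; the factor 3 comes from [radial_le]. *)
apply: (@H0_dct _ _ _ oO (fun n => radial (horner (p n)) (horner (p n)^`()) V j) _
  (EFin \o (fun x => (3 * (K * (1 + M)) * l1norm V x) ^+ 2))).
- by move=> n; have [chi tchi ->] := radial_poly_jet (p n) j tpsi; exact: H0_rtest.
- move=> a; apply: measurable_radial => //.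
  + by move=> l b; have [] := LV l b.
  + by move=> t /ltW; exact: cg.
  + by move=> t t0; apply: cdg; exact: lt_trans t0.
- exact: integrable_sq_l1norm.
- apply: aeW => x Ox n a; rewrite /comp lee_fin.
  have [HK0 HK1 _ _] := HK _ (QM x); have /andP[Q0 Q1] := QM x.
  rewrite -(real_normK (num_real (radial _ _ _ _ _ _))) lerXn2r ?nnegrE//.
    by rewrite !mulr_ge0 ?l1norm_ge0 ?addr_ge0 ?(ltW M0).
  apply: radial_le.
    by apply: le_trans (HK0 n) _; rewrite mulrDr mulr1 lerDl mulr_ge0 ?(ltW M0).
  rewrite normrM ger0_norm// mulrDr mulr1 mulrC.
  by apply: le_trans (ler_pM _ _ (HK1 n) Q1) _ => //; rewrite lerDr.
- apply: aeW => x Ox a; have [_ _ HK0 HK1] := HK _ (QM x).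
  apply: radial_cvg => //.
    by move=> *; exact: cvg_cst.
  have -> : dg (sqnorm V x) = derive1 g (sqnorm V x) => //.
  by rewrite derive1E; have [] := gdg _ (lt_le_trans r0 (sqnorm_ge0 V x)).
Qed.

(** Here |V| is unbounded, so the bounds on g(t) and t g'(t) are needed on the whole half-line. They
    make the jets of all the approximations comparable to the jets of the test fields. *)
Lemma H0_radial_C1 V g dg (r L : R) j :
  (forall j, H0 Omega (V j)) -> r < 0 ->
  (forall t, r < t -> is_derive t 1 g (dg t)) ->
  (forall t, r < t -> {for t, continuous dg}) ->
  (forall t, 0 <= t -> `|g t| <= L) -> (forall t, 0 <= t -> `|t * dg t| <= L) ->
  H0 Omega (radial g dg V j).
Proof.
move=> HV r0 gdg cdg gL dgL.
have L0 : 0 <= L by exact: le_trans (gL 0 _).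
have LV l a : L2r Omega (V l a) by have [/(_ a)] := HV l.
have mV l a : measurable_fun Omega (V l a) by have [] := LV l a.
have cg t : 0 <= t -> {for t, continuous g}.
  move=> t0; apply: differentiable_continuous; apply/derivable1_diffP.
  by have [] := gdg t (lt_le_trans r0 t0).
have /choice[psi Hpsi] : forall nl : nat * J, exists psi, rtest Omega psi /\
    forall a, (sqint Omega (fun x => V nl.2 a x - jet psi a x)%R < (1 / (2 ^ nl.1.+1)%:R)%:E)%E.
  move=> [n l]; have [_ /(_ (1 / (2 ^ n.+1)%:R))[|p tp Hp]] := HV l; last by exists p.
  by rewrite divr_gt0// ltr0n expn_gt0.
have tpsi n l : rtest Omega (psi (n, l)) by have [] := Hpsi (n, l).
pose T := (J * option 'I_N)%type.
pose W n l a := jet (psi (n, l)) a.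
pose d n (c : T) x := V c.1 c.2 x - W n c.1 c.2 x.
have md n c : measurable_fun Omega (d n c).
  by apply: measurable_funB => //; apply: rtest_measurable => //; exact: jet_test.
pose e n x := \sum_c d n c x ^+ 2.
have e_ge0 n x : 0 <= e n x by apply: sumr_ge0 => c _; exact: sqr_ge0.
have me n : measurable_fun Omega (e n).
  by apply: measurable_sum => c; exact: measurable_funX.
(* The test functions approximate [V] at the rate 2^-(n+1), so that [Err] is
   integrable: this gives both a.e. convergence and domination. *)
pose Err x := (\sum_(n <oo) (e n x)%:E)%E.
have iErr : mu.-integrable Omega Err.
  apply/integrableP; split.
    apply: ge0_emeasurable_sum => [n x Ox _|n _]; first by rewrite lee_fin.
    exact/measurable_EFinP.
  rewrite (_ : (\int[_]_(x in _) _)%E = (\int[mu]_(x in Omega) Err x)%E); last first.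
    apply: eq_integral => x _; rewrite gee0_abs//.
    by apply: nneseries_ge0 => n _ _; rewrite lee_fin.
  rewrite integral_nneseries//; first last.
    by move=> n x Ox; rewrite lee_fin.
    by move=> n; exact/measurable_EFinP.
  apply: le_lt_trans (_ : (_ <= \sum_(n <oo) (#|{: T}|%:R / (2 ^ n.+1)%:R)%:E)%E) _; last first.
    exact: le_lt_trans (epsilon_trick0 xpredT _) (ltry _).
  apply: lee_nneseries => [n _ _|n _].
    by apply: integral_ge0 => x _; rewrite lee_fin.
  under eq_integral do rewrite -sumEFin.
  rewrite ge0_integral_sum//; first last.
    by move=> c x _; rewrite lee_fin sqr_ge0.
    by move=> c; exact: measurable_sq.
  rewrite (_ : (_ / _)%:E = (\sum_(c : T) (1 / (2 ^ n.+1)%:R)%:E)%E); last first.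
    by rewrite sumEFin -mulr_suml sum1_natr.
  by apply: lee_sum => c _; apply: ltW; have [_] := Hpsi (n, c.1); apply.
have dle n c x : d n c x ^+ 2 <= e n x.
  by rewrite /e (bigD1 c)//= lerDl; apply: sumr_ge0 => i _; exact: sqr_ge0.
have leErr n x : ((e n x)%:E <= Err x)%E.
  have := @nneseries_lim_ge R (fun n => (e n x)%:E) xpredT 0 n.+1.
  move=> /(_ (fun _ _ _ => e_ge0 _ _)); apply: le_trans.
  by rewrite big_nat_recr//= leeDr// sume_ge0// => i _; rewrite lee_fin.
apply: (@H0_dct _ _ _ oO (fun n => radial g dg (W n) j) _
  (* From |radial| <= 3 L (l1norm V + D), with D the sum of the errors |d n c|: squaring gives 9
     L^2, (a + b)^2 <= 2 a^2 + 2 b^2 doubles it, and D^2 <= #|T| e_n <= #|T| Err. *)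
  (fun x => (18 * L ^+ 2)%:E * ((l1norm V x ^+ 2)%:E + #|{: T}|%:R%:E * Err x))%E).
- by move=> n; exact: (H0_radial_test j _ r0).
- move=> a; apply: measurable_radial => //.
  + by move=> t /ltW; exact: cg.
  + by move=> t t0; apply: cdg; exact: lt_trans t0.
- apply: integrableZl => //; apply: integrableD => //; last exact: integrableZl.
  by have := integrable_sq_l1norm 1 LV; under eq_fun do rewrite mul1r.
- apply: aeW => x Ox n a.
  apply: (@le_trans _ _ (18 * L ^+ 2 * (l1norm V x ^+ 2 + #|{: T}|%:R * e n x))%:E); last first.
    rewrite EFinM lee_wpmul2l ?lee_fin ?mulr_ge0 ?sqr_ge0//.
    by rewrite EFinD (EFinM _ (e n x)); apply: leeD2l; apply: lee_wpmul2l => //; rewrite lee_fin.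
  rewrite lee_fin -(real_normK (num_real (radial _ _ _ _ _ _))).
  apply: (@le_trans _ _ ((3 * L * l1norm (W n) x) ^+ 2)).
    rewrite lerXn2r ?nnegrE ?mulr_ge0 ?l1norm_ge0//.
    by apply: radial_le; [apply: gL|apply: dgL]; exact: sqnorm_ge0.
  rewrite exprMn exprMn.
  have -> : 18 * L ^+ 2 * (l1norm V x ^+ 2 + #|{: T}|%:R * e n x) =
    3 ^+ 2 * L ^+ 2 * (2 * (l1norm V x ^+ 2 + #|{: T}|%:R * e n x)) by ring.
  rewrite ler_wpM2l ?mulr_ge0 ?sqr_ge0//.
  pose D := \sum_c `|d n c x|.
  have D0 : 0 <= D by exact: sumr_ge0.
  have WD : l1norm (W n) x <= l1norm V x + D.
    rewrite /l1norm -big_split/=; apply: ler_sum => c _.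
    have -> : W n c.1 c.2 x = V c.1 c.2 x - d n c x by rewrite /d; ring.
    exact: ler_normB.
  have De : D ^+ 2 <= #|{: T}|%:R * e n x.
    have := sum_sqr_le (fun c => `|d n c x|); congr (_ <= _ * _).
    by apply: eq_bigr => c _; rewrite real_normK// num_real.
  apply: (@le_trans _ _ ((l1norm V x + D) ^+ 2)).
    by rewrite lerXn2r ?nnegrE ?addr_ge0 ?l1norm_ge0.
  have := sqr_ge0 (l1norm V x - D); rewrite sqrrB sqrrD !mulr2n; lra.
- have := integrable_ae mO iErr; apply: filterS => x /[apply] fErr a.
  have ce : e ^~ x @ \oo --> 0.
    apply: nneseries_cvg_0 => [n//|]; by rewrite -/(Err x) ltey_eq fErr.
  have cW l b : W n l b x @[n --> \oo] --> V l b x.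
    apply/cvgrPdist_lt => eps eps0.
    have /cvgrPdist_lt/(_ _ (exprn_gt0 2 eps0)) := ce.
    apply: filterS => n; rewrite sub0r normrN ger0_norm// => en.
    have : `|d n (l, b) x| ^+ 2 < eps ^+ 2.
      by rewrite real_normK ?num_real//; exact: le_lt_trans (dle n (l, b) x) en.
    by rewrite ltr_pXn2r ?nnegrE// ltW.
  have cQ := sqnorm_cvg (fun l => cW l None).
  apply: radial_cvg => //.
    by apply: continuous_cvg => //; apply: cg; exact: sqnorm_ge0.
  apply: continuous_cvg => //; apply: cdg.
  exact: lt_le_trans (sqnorm_ge0 V x).
Qed.

End chain_rule.

Section chain_rule_pos.
Context {R : realType} {N : nat} {J : finType}.
Variable Omega : set 'rV[R]_N.
Hypothesis oO : open Omega.
Let mO : measurable Omega := open_measurable_rV oO.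
Local Notation mu := (lebesgue_rV N : {sigma_finite_measure set 'rV[R]_N -> \bar R}).
Implicit Types (V : J -> option 'I_N -> 'rV[R]_N -> R) (g dg : R -> R).

Lemma sqnorm_eq0 V j x : sqnorm V x = 0 -> V j None x = 0.
Proof.
move=> Q0; apply/eqP; rewrite -sqrf_eq0 eq_le sqr_ge0 andbT.
by have := le_sqnorm V x j; rewrite Q0.
Qed.

(* Letting [d -> 0] in [g t = d / (d + t)], the jet [V j] restricted to {V = 0}
   belongs to [H0]; the underlying function is zero, hence so is its gradient. *)
Lemma H0_zero_set V j a : (forall j, H0 Omega (V j)) ->
  {ae mu, forall x, Omega x -> sqnorm V x = 0 -> V j a x = 0}.
Proof.
move=> HV.
have mV l b : measurable_fun Omega (V l b) by have [/(_ b)[]] := HV l.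
pose U := radial (fun t => (t == 0)%:R) (fun=> 0) V j.
pose d n : R := n.+1%:R^-1.
have d0 n : 0 < d n by rewrite invr_gt0.
have dcv : d n @[n --> \oo] --> 0 by exact: cvg_harmonic.
pose g n (t : R) := d n / (d n + t).
pose dg n (t : R) := - (d n) / (d n + t) ^+ 2.
have dgE n t : - d n < t -> is_derive t 1 (g n) (dg n t).
  move=> dt; have dt0 : d n + t != 0 by rewrite gt_eqF// -ltrBlDl sub0r.
  have D1 : is_derive t 1 (fun t => d n + t) 1.
    by have := is_deriveD (is_derive_cst (d n) t (1 : R)) (is_derive_id t (1 : R)); rewrite add0r.
  have D2 : is_derive t 1 (fun s => (d n + s)^-1) (- (d n + t) ^- 2 *: 1).
    apply: DeriveDef; first by apply: derivableV => //; have [] := D1.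
    by rewrite deriveV//; have [_ ->] := D1.
  have D3 := is_deriveZ (d n) D2.
  apply: is_derive_eq D3 _.
  by rewrite /dg /GRing.scale/=; field.
have cdg n t : - d n < t -> {for t, continuous (dg n)}.
  move=> dt; have dt0 : d n + t != 0 by rewrite gt_eqF// -ltrBlDl sub0r.
  apply: cvgMr; apply: cvgV; first by rewrite expf_neq0.
  by rewrite expr2; under eq_fun do rewrite expr2; apply: cvgM; apply: cvgD => //; exact: cvg_cst.
have gL n t : 0 <= t -> `|g n t| <= 1.
  move=> t0; have dt : 0 < d n + t by rewrite ltr_pwDl.
  rewrite /g ger0_norm; last by rewrite divr_ge0// ltW.
  by rewrite ler_pdivrMr// mul1r lerDl.
have dgL n t : 0 <= t -> `|t * dg n t| <= 1.
  move=> t0; have dt : 0 < d n + t by rewrite ltr_pwDl.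
  rewrite /dg mulNr mulrN normrN ger0_norm; last first.
    by rewrite mulr_ge0// divr_ge0 ?sqr_ge0 ?ltW.
  rewrite mulrA ler_pdivrMr ?exprn_gt0// mul1r.
  have := sqr_ge0 (d n - t); have := sqr_ge0 (d n + t); rewrite sqrrB sqrrD !mulr2n; lra.
have cv x b : radial (g n) (dg n) V j b x @[n --> \oo] --> U b x.
  have [Q0|Q0] := eqVneq (sqnorm V x) 0.
    have -> : U b x = V j b x.
      by rewrite /U /radial Q0 eqxx mul1r; case: b => [k|]; rewrite ?mulr0 ?mul0r ?addr0.
    rewrite (_ : (fun n => _) = (fun=> V j b x)); first exact: cvg_cst.
    apply/funext => n; rewrite /radial Q0 /g addr0 divff ?gt_eqF// mul1r.
    by rewrite (sqnorm_eq0 j Q0); case: b => [k|]; rewrite ?mulr0 ?addr0.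
  apply: radial_cvg => /=.
  - by move=> *; exact: cvg_cst.
  - rewrite (negbTE Q0) /g -[X in _ --> X](mul0r (0 + sqnorm V x)^-1).
    apply: cvgM => //; apply: cvgV; first by rewrite add0r.
    by apply: cvgD => //; exact: cvg_cst.
  - rewrite /dg -[X in _ --> X](mul0r ((0 + sqnorm V x) * (0 + sqnorm V x))^-1).
    apply: cvgM; first by rewrite -oppr0; exact: cvgN.
    apply: cvgV; first by rewrite add0r mulf_neq0.
    by under eq_fun do rewrite expr2; apply: cvgM; apply: cvgD => //; exact: cvg_cst.
have HUn n : H0 Omega (radial (g n) (dg n) V j).
  apply: (@H0_radial_C1 _ _ _ _ oO V (g n) (dg n) (- d n) 1) => //.
  - by rewrite oppr_lt0.
  - by move=> t; exact: cdg.
  - by move=> t; exact: gL.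
  - by move=> t; exact: dgL.
have HU : H0 Omega U.
  apply: (@H0_dct _ _ _ oO (fun n => radial (g n) (dg n) V j) _
    (EFin \o (fun x => (3 * l1norm V x) ^+ 2))) => //.
  - move=> b; apply: (measurable_fun_cvg (h := fun n => radial (g n) (dg n) V j b)) => //.
    + by move=> n; have [/(_ b)[]] := HUn n.
  - by apply: integrable_sq_l1norm => // l b; have [] := HV l.
  - apply: aeW => x Ox n b; rewrite /comp lee_fin.
    rewrite -(real_normK (num_real (radial _ _ _ _ _ _))) lerXn2r ?nnegrE//.
      by rewrite mulr_ge0 ?l1norm_ge0.
    rewrite -[3]mulr1; apply: radial_le; [apply: gL|apply: dgL]; exact: sqnorm_ge0.
  - by apply: aeW => x Ox b; exact: cv.
have U0 x : Omega x -> U None x = 0.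
  move=> _; rewrite /U /radial addr0; have [Q0|] := eqVneq (sqnorm V x) 0.
    by rewrite (sqnorm_eq0 j Q0) mulr0.
  by rewrite mul0r.
have := H0_zero oO HU U0 a; apply: filterS => x /[apply] + Q0.
rewrite /U /radial Q0 eqxx mul1r; case: a => [k|]; rewrite ?addr0//.
by rewrite mulr0 !mul0r addr0.
Qed.

(** The shifts g(t + d) with d > 0 are C^1 beyond 0 and keep the bound L, because t <= t + d. As d
    -> 0 their jets converge where V is nonzero by continuity; on {V = 0} the whole jet vanishes
    almost everywhere by [H0_zero_set], so the behaviour of g at 0 is harmless. *)
Lemma H0_radial V g dg (L : R) j : (forall j, H0 Omega (V j)) -> g 0 = 0 ->
  (forall t : R, 0 < t -> is_derive t 1 g (dg t)) ->
  (forall t : R, 0 < t -> {for t, continuous dg}) ->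
  (forall t : R, 0 < t -> `|g t| <= L) -> (forall t : R, 0 < t -> `|t * dg t| <= L) ->
  H0 Omega (radial g dg V j).
Proof.
move=> HV g0 gdg cdg gL dgL.
have mV l b : measurable_fun Omega (V l b) by have [/(_ b)[]] := HV l.
have cg t : 0 < t -> {for t, continuous g}.
  move=> t0; apply: differentiable_continuous; apply/derivable1_diffP.
  by have [] := gdg t t0.
have L0 : 0 <= L by exact: le_trans (gL 1 _).
pose d n : R := n.+1%:R^-1.
have d0 n : 0 < d n by rewrite invr_gt0.
have dcv : d n @[n --> \oo] --> 0 by exact: cvg_harmonic.
pose gn n (t : R) := g (t + d n).
pose dgn n (t : R) := dg (t + d n).
have gnL n t : 0 <= t -> `|gn n t| <= L by move=> t0; apply: gL; rewrite ltr_wpDl.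
have dgnL n t : 0 <= t -> `|t * dgn n t| <= L.
  move=> t0; have td : 0 < t + d n by rewrite ltr_wpDl.
  apply: le_trans (dgL _ td); rewrite !normrM ler_wpM2r// !ger0_norm ?(ltW td)//.
  by rewrite lerDl ltW.
apply: (@H0_dct _ _ _ oO (fun n => radial (gn n) (dgn n) V j) _
    (EFin \o (fun x => (3 * L * l1norm V x) ^+ 2))).
- move=> n; apply: (@H0_radial_C1 _ _ _ _ oO V (gn n) (dgn n) (- d n) L) => //.
  + by rewrite oppr_lt0.
  + move=> t dt; have td : 0 < t + d n by rewrite -ltrBlDr sub0r.
    have D1 : is_derive t 1 (fun t : R => t + d n) 1.
      by have := is_deriveD (is_derive_id t (1 : R)) (is_derive_cst (d n) t (1 : R)); rewrite addr0.
    have := @is_derive1_comp _ g (fun t : R => t + d n) t _ _ (gdg _ td) D1.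
    by rewrite mulr1.
  + move=> t dt; have td : 0 < t + d n by rewrite -ltrBlDr sub0r.
    apply: (@continuous_comp _ _ _ (fun t : R => t + d n) dg); last exact: cdg.
    by apply: cvgD => //; exact: cvg_cst.
  + by move=> t; exact: gnL.
  + by move=> t; exact: dgnL.
- by move=> a; exact: measurable_radial.
- by apply: integrable_sq_l1norm => // l b; have [] := HV l.
- apply: aeW => x Ox n b; rewrite /comp lee_fin.
  rewrite -(real_normK (num_real (radial _ _ _ _ _ _))) lerXn2r ?nnegrE//.
    by rewrite mulr_ge0 ?l1norm_ge0// mulr_ge0.
  by apply: radial_le; [apply: gnL|apply: dgnL]; exact: sqnorm_ge0.
- have : {ae mu, forall x, forall a, Omega x -> sqnorm V x = 0 -> V j a x = 0}.
    by apply: filter_forall => a; exact: H0_zero_set.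
  apply: filterS => x Hx Ox a.
  have [Q0|Q0] := eqVneq (sqnorm V x) 0.
    have V0 b : V j b x = 0 by exact: Hx.
    rewrite (_ : radial g dg V j a x = 0); last first.
      by rewrite /radial !V0 mulr0 add0r; case: a => // k; rewrite mulr0.
    rewrite (_ : (fun n => _) = (fun=> 0)); first exact: cvg_cst.
    by apply/funext => n; rewrite /radial !V0 mulr0 add0r; case: a => // k; rewrite mulr0.
  have Qpos : 0 < sqnorm V x by rewrite lt_neqAle eq_sym Q0 sqnorm_ge0.
  have cvd : sqnorm V x + d n @[n --> \oo] --> sqnorm V x.
    by rewrite -[X in _ --> X]addr0; apply: cvgD => //; exact: cvg_cst.
  apply: radial_cvg => /=.
  + by move=> *; exact: cvg_cst.
  + by apply: continuous_cvg => //; exact: cg.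
  + by apply: continuous_cvg => //; exact: cdg.
Qed.

End chain_rule_pos.

(** * Complex vector fields *)

Section cpx.
Context {R : realType} {N : nat}.
Variable Omega : set 'rV[R]_N.
Hypothesis oO : open Omega.
Let mO : measurable Omega := open_measurable_rV oO.
Local Notation mu := (lebesgue_rV N : {sigma_finite_measure set 'rV[R]_N -> \bar R}).
Local Notation C := R[i].
Local Notation Re := (@complex.Re R).
Local Notation Im := (@complex.Im R).

Definition part (b : bool) (z : C) : R := if b then Re z else Im z.

Lemma partB b x y : part b (x - y) = part b x - part b y.
Proof. by case: x y b => [? ?] [? ?] []. Qed.

Lemma partD b x y : part b (x + y) = part b x + part b y.
Proof. by case: x y b => [? ?] [? ?] []. Qed.

Lemma part_realM b (r : R) z : part b (r%:C%C * z) = r * part b z.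
Proof. by case: z b => [? ?] []; rewrite /= mul0r ?subr0 ?addr0. Qed.

Lemma normc_sq (z : C) : Normc.normc z ^+ 2 = Re z ^+ 2 + Im z ^+ 2.
Proof. by case: z => a b /=; rewrite sqr_sqrtr// addr_ge0 ?sqr_ge0. Qed.

Definition cjet (u : 'rV[R]_N -> C) (Du : 'I_N -> 'rV[R]_N -> C) b
    (a : option 'I_N) (x : 'rV[R]_N) : R :=
  part b (if a is Some k then Du k x else u x).

Lemma sqL2norm_part f b : cmeasurable Omega f ->
  (sqint Omega (part b \o f) <= sqL2norm Omega f)%E.
Proof.
move=> [mR mI]; apply: ge0_le_integral => //.
- by move=> x _; rewrite lee_fin sqr_ge0.
- by apply: measurable_sq; case: b.
- apply/measurable_EFinP; under eq_fun do rewrite normc_sq.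
  by apply: measurable_funD; exact: measurable_funX.
move=> x _; rewrite lee_fin normc_sq /part /=.
by case: b; rewrite ?lerDl ?lerDr sqr_ge0.
Qed.

Lemma sqL2norm_parts f : cmeasurable Omega f ->
  sqL2norm Omega f = (sqint Omega (Re \o f) + sqint Omega (Im \o f))%E.
Proof.
move=> [mR mI]; rewrite /sqint -ge0_integralD//.
- by apply: eq_integral => x _; rewrite normc_sq.
- by move=> x _; rewrite lee_fin sqr_ge0.
- exact: measurable_sq.
- by move=> x _; rewrite lee_fin sqr_ge0.
- exact: measurable_sq.
Qed.

Lemma test_function_part psi b : test_function Omega psi -> rtest Omega (part b \o psi).
Proof.
move=> [sR sI cpsi psiO].
have sub : closure [set x | (part b \o psi) x != 0] `<=` closure [set x | psi x != 0].
  apply: closureS => x /=; apply: contra_neq => ->; by case: b.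
split.
- by case: b {sub}.
- by apply: (subclosed_compact _ cpsi sub); exact: closed_closure.
- exact: subset_trans sub psiO.
Qed.

Lemma rtest_test_function p q : rtest Omega p -> rtest Omega q ->
  test_function Omega (fun x => Complex (p x) (q x)).
Proof.
move=> [sp cp pO] [sq cq qO].
have sub : closure [set x | Complex (p x) (q x) != 0] `<=`
    closure [set x | p x != 0] `|` closure [set x | q x != 0].
  rewrite -closureU; apply: closureS => x /=; rewrite eq_complex /= negb_and.
  by move=> /orP[]; [left|right].
split => //.
- by apply: (subclosed_compact _ _ sub); [exact: closed_closure|exact: compactU].
- by apply: (subset_trans sub); rewrite subUset.
Qed.

Lemma sqrte_lt (X : \bar R) (e : R) : (0 <= X)%E -> 0 < e ->
  (sqrte X < e%:E)%E = (X < (e ^+ 2)%:E)%E.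
Proof.
move=> X0 e0; case: X X0 => [r| |] //=; rewrite !lee_fin !lte_fin => r0.
by rewrite -(@ltr_pXn2r _ 2) ?nnegrE ?sqrtr_ge0 ?ltW// sqr_sqrtr.
Qed.

Lemma sqL2norm_ge0 f : (0 <= sqL2norm Omega f)%E.
Proof. by apply: integral_ge0 => x _; rewrite lee_fin sqr_ge0. Qed.

Lemma L2_part f b : L2 Omega f -> L2r Omega (part b \o f).
Proof.
move=> [mf f2]; split; first by case: mf; case: b.
exact: le_lt_trans (sqL2norm_part b mf) f2.
Qed.

Lemma test_cmeasurable psi : test_function Omega psi -> cmeasurable Omega psi.
Proof.
move=> t; split.
  exact: (rtest_measurable (test_function_part true t)).
exact: (rtest_measurable (test_function_part false t)).
Qed.

Lemma cmeasurableB f g : cmeasurable Omega f -> cmeasurable Omega g ->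
  cmeasurable Omega (fun x => f x - g x).
Proof.
move=> [f1 f2] [g1 g2]; split.
  rewrite (_ : (fun _ => _) = (fun x => Re (f x) - Re (g x))); first exact: measurable_funB.
  by apply/funext => x; exact: (partB true).
rewrite (_ : (fun _ => _) = (fun x => Im (f x) - Im (g x))); first exact: measurable_funB.
by apply/funext => x; exact: (partB false).
Qed.

Lemma H01_H0 u Du b : H01 Omega u Du -> H0 Omega (cjet u Du b).
Proof.
move=> [[Lu LDu _] Hu]; split.
  by case=> [k|]; [exact: (L2_part b (LDu k))|exact: (L2_part b Lu)].
move=> e e0; have se0 : 0 < Num.sqrt e by rewrite sqrtr_gt0.
have [psi tpsi] := Hu _ se0.
rewrite /H1norm sqrte_lt//; last first.
  by rewrite adde_ge0 ?sqL2norm_ge0// sume_ge0// => k _; exact: sqL2norm_ge0.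
rewrite sqr_sqrtr ?ltW// => He; exists (part b \o psi); first exact: test_function_part.
have [mu_ _] := Lu.
have mpsi := test_cmeasurable tpsi.
case=> [k|]; apply: le_lt_trans He.
  have mdk : cmeasurable Omega (fun x => Du k x - cpartial k psi x).
    apply: cmeasurableB; first by have [] := LDu k.
    split; first exact: (rtest_measurable (rtest_partial k (test_function_part true tpsi))).
    exact: (rtest_measurable (rtest_partial k (test_function_part false tpsi))).
  rewrite [leLHS](_ : _ = sqint Omega (part b \o (fun x => Du k x - cpartial k psi x))); last first.
    by apply: eq_integral => x _; rewrite /= partB; case: b.
  apply: le_trans (sqL2norm_part b mdk) _.
  rewrite (bigD1 k)//= addeCA leeDl// adde_ge0 ?sqL2norm_ge0// sume_ge0// => i _.
  exact: sqL2norm_ge0.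
have mdu : cmeasurable Omega (fun x => u x - psi x) by exact: cmeasurableB.
rewrite [leLHS](_ : _ = sqint Omega (part b \o (fun x => u x - psi x))); last first.
  by apply: eq_integral => x _; rewrite /= partB.
apply: le_trans (sqL2norm_part b mdu) _.
by rewrite leeDl// sume_ge0// => i _; exact: sqL2norm_ge0.
Qed.

Lemma H0_L2 u Du : (forall b, H0 Omega (cjet u Du b)) ->
  L2 Omega u /\ forall k, L2 Omega (Du k).
Proof.
move=> HU.
have key f : L2r Omega (Re \o f) -> L2r Omega (Im \o f) -> L2 Omega f.
  move=> [mR R2] [mI I2]; split; first by split.
  by rewrite sqL2norm_parts//; exact: lte_add_pinfty.
have [HT _] := HU true; have [HF _] := HU false.
by split=> [|k]; apply: key; [exact: (HT None)|exact: (HF None)|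
  exact: (HT (Some k))|exact: (HF (Some k))].
Qed.

(** The pairing in [weak_partial] is the product of complex numbers without conjugation; its real
    and imaginary parts split into four real integrations by parts. *)
Lemma H0_weak_partial u Du k : (forall b, H0 Omega (cjet u Du b)) ->
  weak_partial Omega k u (Du k).
Proof.
move=> HU psi tpsi.
have tR := test_function_part true tpsi; have tI := test_function_part false tpsi.
have [LT _] := HU true; have [LF _] := HU false.
have LR a : L2r Omega (jet (part true \o psi) a) by apply: rtest_L2r => //; exact: jet_test.
have LI a : L2r Omega (jet (part false \o psi) a) by apply: rtest_L2r => //; exact: jet_test.
have w1 := H0_weak oO k (HU true) tR.
have w2 := H0_weak oO k (HU false) tI.
have w3 := H0_weak oO k (HU true) tI.
have w4 := H0_weak oO k (HU false) tR.
have eqI f g : (forall x, f x = g x :> R) ->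
    \int[mu]_(x in Omega) f x = \int[mu]_(x in Omega) g x.
  by move=> fg; apply: eq_Rintegral => x _.
have iP a a' b b' : mu.-integrable Omega
    (EFin \o (fun x => cjet u Du b a x * jet (part b' \o psi) a' x)).
  have [Lb _] := HU b.
  by apply: L2rM_integrable => //; apply: rtest_L2r => //; apply: jet_test; exact: test_function_part.
apply/eqP; rewrite eq_complex /=; apply/andP; split; apply/eqP.
- transitivity (\int[mu]_(x in Omega) (cjet u Du true None x * jet (part true \o psi) (Some k) x -
     cjet u Du false None x * jet (part false \o psi) (Some k) x)).
    by apply: eqI => x; rewrite /cjet /= /cpartial; case: (u x).
  rewrite RintegralB// w1 w2 -opprD addrC; congr (- _).
  transitivity (\int[mu]_(x in Omega) (cjet u Du true (Some k) x * jet (part true \o psi) None x -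
     cjet u Du false (Some k) x * jet (part false \o psi) None x)).
    by rewrite RintegralB// addrC.
  by apply: eqI => x; rewrite /cjet /=; case: (Du k x) (psi x) => [? ?] [? ?].
- transitivity (\int[mu]_(x in Omega) (cjet u Du true None x * jet (part false \o psi) (Some k) x +
     cjet u Du false None x * jet (part true \o psi) (Some k) x)).
    by apply: eqI => x; rewrite /cjet /= /cpartial; case: (u x).
  rewrite RintegralD// w3 w4 -opprD; congr (- _).
  transitivity (\int[mu]_(x in Omega) (cjet u Du true (Some k) x * jet (part false \o psi) None x +
     cjet u Du false (Some k) x * jet (part true \o psi) None x)).
    by rewrite RintegralD.
  by apply: eqI => x; rewrite /cjet /=; case: (Du k x) (psi x) => [? ?] [? ?].
Qed.

Lemma H0_H01 u Du : (forall b, H0 Omega (cjet u Du b)) -> H01 Omega u Du.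
Proof.
move=> HU; have [Lu LDu] := H0_L2 HU.
split; first by split=> // k; exact: H0_weak_partial.
move=> e e0.
(* The squared H^1 norm is a sum over one function and N derivatives, each with a real and an
   imaginary part: 2 (N + 1) terms smaller than d. *)
pose d := e ^+ 2 / (2 * N.+1%:R).
have d0 : 0 < d by rewrite divr_gt0 ?exprn_gt0// mulr_gt0.
have [p tp Hp] := (HU true).2 _ d0; have [q tq Hq] := (HU false).2 _ d0.
have tpq := rtest_test_function tp tq.
exists (fun x => Complex (p x) (q x)) => //.
have me f psi : L2 Omega f -> test_function Omega psi ->
    cmeasurable Omega (fun x => f x - psi x).
  by move=> [mf _] t; apply: cmeasurableB => //; exact: test_cmeasurable.
have tk k : test_function Omega (cpartial k (fun x => Complex (p x) (q x))).
  by apply: rtest_test_function; exact: rtest_partial.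
have h0 : (sqL2norm Omega (fun x => (u x - Complex (p x) (q x))%R) < (d + d)%:E)%E.
  rewrite sqL2norm_parts; last exact: me.
  rewrite EFinD; apply: lteD.
    apply: le_lt_trans (Hp None); rewrite le_eqVlt; apply/orP; left; apply/eqP.
    by apply: eq_integral => x _; rewrite /cjet /=; case: (u x).
  apply: le_lt_trans (Hq None); rewrite le_eqVlt; apply/orP; left; apply/eqP.
  by apply: eq_integral => x _; rewrite /cjet /=; case: (u x).
have hk k : (sqL2norm Omega (fun x => (Du k x - cpartial k (fun x => Complex (p x) (q x)) x)%R) < (d + d)%:E)%E.
  rewrite sqL2norm_parts; last exact: me.
  rewrite EFinD; apply: lteD.
    apply: le_lt_trans (Hp (Some k)); rewrite le_eqVlt; apply/orP; left; apply/eqP.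
    by apply: eq_integral => x _; rewrite /cjet /=; case: (Du k x).
  apply: le_lt_trans (Hq (Some k)); rewrite le_eqVlt; apply/orP; left; apply/eqP.
  by apply: eq_integral => x _; rewrite /cjet /=; case: (Du k x).
rewrite /H1norm sqrte_lt//; last first.
  by rewrite adde_ge0 ?sqL2norm_ge0// sume_ge0// => k _; exact: sqL2norm_ge0.
have -> : (e ^+ 2)%:E = ((d + d)%:E + \sum_(k < N) (d + d)%:E)%E.
  rewrite sumEFin -EFinD sumr_const card_ord -mulr_natl; congr EFin.
  have n0 : N.+1%:R != 0 :> R by rewrite pnatr_eq0.
  have -> : N%:R = N.+1%:R - 1 :> R by rewrite -natr1 addrK.
  by rewrite /d; move: (N.+1%:R) n0 => z z0; field.
have hs : (\sum_(k < N) sqL2norm Omega (fun x => (Du k x - cpartial k (fun x => Complex (p x) (q x)) x)%R)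
    <= \sum_(k < N) (d + d)%:E)%E by apply: lee_sum => k _; exact: ltW.
apply: lte_leD => //.
rewrite ge0_fin_numE; last by apply: sume_ge0 => k _; exact: sqL2norm_ge0.
by apply: le_lt_trans hs _; rewrite sumEFin ltry.
Qed.

End cpx.

(** * The Hermitian product, and radial rearrangements of complex fields *)

Section herm_theory.
Context {R : realType} {m : nat}.
Local Notation C := R[i].
Local Notation Re := (@complex.Re R).
Local Notation Im := (@complex.Im R).
Implicit Types (u v w : 'cV[C]_m) (r : R).

Lemma ReD (x y : C) : Re (x + y) = Re x + Re y.
Proof. by case: x y => [? ?] [? ?]. Qed.

Lemma Re_sum (T : Type) (r : seq T) (F : T -> C) : Re (\sum_(c <- r) F c) = \sum_(c <- r) Re (F c).
Proof. by elim/big_ind2: _ => // *; rewrite ReD; congr (_ + _). Qed.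

Lemma Re_realM r (z : C) : Re (r%:C%C * z) = r * Re z.
Proof. by case: z => [? ?]; rewrite /= mul0r subr0. Qed.

Lemma Re_mul_conj (x y : C) : Re (x * y^*) = Re x * Re y + Im x * Im y.
Proof. by case: x y => [a b] [c d] /=; rewrite mulrN opprK. Qed.

Lemma Re_conj (x : C) : Re (x^*) = Re x.
Proof. by case: x. Qed.

Lemma conj_real r : (r%:C%C : C)^* = r%:C%C.
Proof. by rewrite /Num.conj /= oppr0. Qed.

Lemma hermDl u v w : herm (u + v) w = herm u w + herm v w.
Proof. by rewrite /herm -big_split; apply: eq_bigr => i _; rewrite mxE mulrDl. Qed.

Lemma hermDr u v w : herm w (u + v) = herm w u + herm w v.
Proof. by rewrite /herm -big_split; apply: eq_bigr => i _; rewrite mxE rmorphD mulrDr. Qed.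

Lemma hermZl (a : C) u w : herm (a *: u) w = a * herm u w.
Proof. by rewrite /herm mulr_sumr; apply: eq_bigr => i _; rewrite mxE mulrA. Qed.

Lemma hermZr r u w : herm w (r%:C%C *: u) = r%:C%C * herm w u.
Proof.
rewrite /herm mulr_sumr; apply: eq_bigr => i _.
by rewrite mxE rmorphM /= conj_real mulrCA.
Qed.

Lemma hermC u w : herm w u = (herm u w)^*.
Proof. by rewrite /herm rmorph_sum; apply: eq_bigr => i _; rewrite rmorphM /= conjCK mulrC. Qed.

Lemma herm_adj (A : 'M[C]_m) u w : herm (adjmx A *m u) w = herm u (A *m w).
Proof.
rewrite /herm.
transitivity (\sum_i \sum_j (A j i)^* * u j 0 * (w i 0)^*).
  apply: eq_bigr => i _; rewrite mxE mulr_suml; apply: eq_bigr => j _.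
  by rewrite !mxE.
rewrite exchange_big; apply: eq_bigr => j _; rewrite mxE rmorph_sum mulr_sumr.
by apply: eq_bigr => i _; rewrite rmorphM /= mulrCA mulrA [_ * u j 0]mulrC.
Qed.

Lemma enorm_sq v : enorm v ^+ 2 = \sum_i (Re (v i 0) ^+ 2 + Im (v i 0) ^+ 2).
Proof.
have E : Re (herm v v) = \sum_i (Re (v i 0) ^+ 2 + Im (v i 0) ^+ 2).
  by rewrite Re_sum; apply: eq_bigr => i _; rewrite Re_mul_conj !expr2.
rewrite /enorm sqr_sqrtr E//; apply: sumr_ge0 => i _.
by rewrite addr_ge0 ?sqr_ge0.
Qed.

Lemma Re_herm v : Re (herm v v) = enorm v ^+ 2.
Proof.
by rewrite enorm_sq Re_sum; apply: eq_bigr => i _; rewrite Re_mul_conj !expr2.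
Qed.

Lemma enorm_ge0 v : 0 <= enorm v. Proof. exact: sqrtr_ge0. Qed.

Lemma enorm0 : enorm (0 : 'cV[C]_m) = 0.
Proof.
apply/eqP; rewrite -sqrf_eq0 enorm_sq big1// => i _.
by rewrite mxE /= expr0n addr0.
Qed.

Lemma enorm_eq0 v : (enorm v == 0) = (v == 0).
Proof.
apply/idP/idP => [|/eqP ->]; last by rewrite enorm0.
rewrite -sqrf_eq0 enorm_sq psumr_eq0 => [/allP H|i _]; last by rewrite addr_ge0 ?sqr_ge0.
apply/eqP/colP => i; rewrite mxE; apply/eqP; rewrite eq_complex.
have := H i (mem_index_enum _); rewrite paddr_eq0 ?sqr_ge0// => /andP[].
by rewrite !sqrf_eq0 => -> ->.
Qed.

Lemma enorm_gt0 v : (0 < enorm v) = (v != 0).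
Proof. by rewrite lt_neqAle enorm_ge0 andbT eq_sym enorm_eq0. Qed.

Lemma enormZ r v : enorm (r%:C%C *: v) = `|r| * enorm v.
Proof.
apply/eqP; rewrite -(@eqrXn2 _ 2) ?mulr_ge0 ?enorm_ge0//; apply/eqP.
rewrite exprMn real_normK ?num_real// !enorm_sq mulr_sumr.
by apply: eq_bigr => i _; rewrite mxE; case: (v i 0) => a b /=; ring.
Qed.

End herm_theory.

Section vjet.
Context {R : realType} {N m : nat}.
Variable Omega : set 'rV[R]_N.
Hypothesis oO : open Omega.
Let mO : measurable Omega := open_measurable_rV oO.
Local Notation mu := (lebesgue_rV N : {sigma_finite_measure set 'rV[R]_N -> \bar R}).
Local Notation C := R[i].
Local Notation Re := (@complex.Re R).
Local Notation Im := (@complex.Im R).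
Implicit Types (u v : 'rV[R]_N -> 'cV[C]_m) (Du Dv : 'I_N -> 'rV[R]_N -> 'cV[C]_m).

(** C^m is read as R^(2m), the boolean selecting the real or imaginary part; [sqnorm] then becomes
    |u|^2 and the real chain rule applies. *)
Definition vjet u Du (j : 'I_m * bool) : option 'I_N -> 'rV[R]_N -> R :=
  cjet (fun x => u x j.1 0) (fun k x => Du k x j.1 0) j.2.

Lemma H01_vecP u Du : H01_vec Omega u Du <-> forall j, H0 Omega (vjet u Du j).
Proof.
split=> [Hu [i b]|Hu i]; first exact: H01_H0.
by apply: H0_H01 => // b; exact: (Hu (i, b)).
Qed.

Lemma sum_pairb (F : 'I_m * bool -> R) : \sum_j F j = \sum_i (F (i, true) + F (i, false)).
Proof.
rewrite -(eq_bigr _ (fun i _ => (big_bool _ (fun b => F (i, b))))).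
by rewrite pair_big/=; apply: eq_bigr => -[].
Qed.

Lemma sqnorm_vjet u Du x : sqnorm (vjet u Du) x = enorm (u x) ^+ 2.
Proof. by rewrite enorm_sq /sqnorm sum_pairb. Qed.

Lemma dot_vjet u Du x k : \sum_j vjet u Du j None x * vjet u Du j (Some k) x =
  Re (herm (u x) (Du k x)).
Proof. by rewrite sum_pairb Re_sum; apply: eq_bigr => i _; rewrite Re_mul_conj. Qed.

Lemma H01_vecD u Du v Dv : H01_vec Omega u Du -> H01_vec Omega v Dv ->
  H01_vec Omega (fun x => u x + v x) (fun k x => Du k x + Dv k x).
Proof.
move=> /H01_vecP Hu /H01_vecP Hv; apply/H01_vecP => j.
have := H0D oO (Hu j) (Hv j); congr (H0 _ _); apply/funext => a; apply/funext => x.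
by rewrite /vjet /cjet; case: a => [k|]; rewrite mxE partD.
Qed.

Lemma cV_part_inj (v w : 'cV[C]_m) : (forall i b, part b (v i 0) = part b (w i 0)) -> v = w.
Proof.
move=> vw; apply/colP => i; apply/eqP; rewrite eq_complex.
by have /= -> := vw i true; have /= -> := vw i false; rewrite !eqxx.
Qed.

Lemma H01_vec_unique u v Du Dv : H01_vec Omega u Du -> H01_vec Omega v Dv ->
  (forall x, Omega x -> u x = v x) ->
  {ae mu, forall x, Omega x -> forall k, Du k x = Dv k x}.
Proof.
move=> /H01_vecP Hu /H01_vecP Hv uv.
have : {ae mu, forall x, forall c : 'I_N * ('I_m * bool), Omega x ->
    vjet u Du c.2 (Some c.1) x = vjet v Dv c.2 (Some c.1) x}.
  apply: filter_forall => c; apply: H0_unique => // x Ox.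
  by rewrite /vjet /cjet uv.
by apply: filterS => x Hx Ox k; apply: cV_part_inj => i b; exact: (Hx (k, (i, b))).
Qed.

Lemma H01_vec_zero u Du : H01_vec Omega u Du ->
  {ae mu, forall x, Omega x -> u x = 0 -> forall k, Du k x = 0}.
Proof.
move=> /H01_vecP Hu.
have : {ae mu, forall x, forall c : 'I_N * ('I_m * bool), Omega x ->
    sqnorm (vjet u Du) x = 0 -> vjet u Du c.2 (Some c.1) x = 0}.
  by apply: filter_forall => c; exact: H0_zero_set.
apply: filterS => x Hx Ox u0 k; apply: cV_part_inj => i b.
have Q0 : sqnorm (vjet u Du) x = 0 by rewrite sqnorm_vjet u0 enorm0 expr0n.
by rewrite mxE; have := Hx (k, (i, b)) Ox Q0; rewrite /vjet /cjet /= => ->; case: b.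
Qed.

Definition radial_vec (f : R -> R) u x : 'cV[C]_m := (f (enorm (u x)) / enorm (u x))%:C%C *: u x.

(** With t = |u| and Re<u, D_k u> = t D_k t, the gradient is multiplied by f / t orthogonally to u
    and by f' along u. Division by zero being zero, both this and [radial_vec] vanish where u
    does. *)
Definition radial_grad (f df : R -> R) u Du (k : 'I_N) x : 'cV[C]_m :=
  (f (enorm (u x)) / enorm (u x))%:C%C *: Du k x +
  ((df (enorm (u x)) - f (enorm (u x)) / enorm (u x)) / enorm (u x) ^+ 2 *
    Re (herm (u x) (Du k x)))%:C%C *: u x.

(** In the variable t = |u|^2 the profile is g(t) = f(sqrt t) / sqrt t, and t g'(t) = (f'(sqrt t) -
    g(t)) / 2. So bounds on f(s) / s and f'(s) are exactly what [H0_radial] asks for, with the same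
    L. *)
Lemma H01_vec_radial u Du (f df : R -> R) (L : R) : H01_vec Omega u Du ->
  (forall t : R, 0 < t -> is_derive t 1 f (df t)) ->
  (forall t : R, 0 < t -> {for t, continuous df}) ->
  (forall t : R, 0 < t -> `|f t| <= L * t) -> (forall t : R, 0 < t -> `|df t| <= L) ->
  H01_vec Omega (radial_vec f u) (radial_grad f df u Du).
Proof.
move=> /H01_vecP Hu fdf cdf fL dfL; apply/H01_vecP => j.
pose g (t : R) := f (Num.sqrt t) / Num.sqrt t.
pose dg (t : R) := (df (Num.sqrt t) - f (Num.sqrt t) / Num.sqrt t) / (2 * t).
have h2 (a b : R) : 2 * (a / (2 * b)) = a / b.
  by rewrite invfM mulrCA (mulrA 2) divff ?mul1r// pnatr_eq0.
have -> : vjet (radial_vec f u) (radial_grad f df u Du) j = radial g dg (vjet u Du) j.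
  apply/funext => a; apply/funext => x.
  rewrite /radial sqnorm_vjet /g /dg sqrtr_sqr ger0_norm ?enorm_ge0//.
  case: a => [k|]; rewrite /vjet /cjet /radial_grad /radial_vec.
    by rewrite dot_vjet !mxE partD !part_realM h2.
  by rewrite /= mxE part_realM addr0.
have cf t : 0 < t -> {for t, continuous f}.
  move=> t0; apply: differentiable_continuous; apply/derivable1_diffP.
  by have [] := fdf t t0.
have csq (t : R) : {for t, continuous (@Num.sqrt R)} by exact: sqrt_continuous.
have cVt (F : R -> R) (t : R) : {for t, continuous F} -> F t != 0 -> {for t, continuous (fun s => (F s)^-1)}.
  by move=> cF Ft; apply: cvgV.
apply: (@H0_radial _ _ _ _ oO _ _ _ L) => //.
- by rewrite /g sqrtr0 invr0 mulr0.
- move=> t t0; have st : 0 < Num.sqrt t by rewrite sqrtr_gt0.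
  have sn0 : Num.sqrt t != 0 by rewrite gt_eqF.
  have D1 := is_derive1_sqrt t0; have [dD1 vD1] := D1.
  have D2 := @is_derive1_comp _ f Num.sqrt t _ _ (fdf _ st) D1.
  have D3 : is_derive t 1 (fun t : R => (Num.sqrt t)^-1) (- (Num.sqrt t) ^- 2 *: (2 * Num.sqrt t)^-1).
    apply: DeriveDef; first exact: derivableV.
    by rewrite deriveV// vD1.
  apply: is_derive_eq (is_deriveM D2 D3) _.
  rewrite /dg /GRing.scale/=; have := sqr_sqrtr (ltW t0).
  move: (Num.sqrt t) sn0 => s sn0 <-.
  by field.
- move=> t t0; have st : 0 < Num.sqrt t by rewrite sqrtr_gt0.
  have cs1 : {for t, continuous (fun t : R => f (Num.sqrt t))}.
    by apply: continuous_comp; [exact: csq|exact: cf].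
  have cs2 : {for t, continuous (fun t : R => df (Num.sqrt t))}.
    by apply: continuous_comp; [exact: csq|exact: cdf].
  apply: cvgM; last first.
    apply: cvgV; first by rewrite mulf_neq0// gt_eqF.
    by apply: cvgM => //; exact: cvg_cst.
  apply: cvgB => //; apply: cvgM => //; apply: cVt; first exact: csq.
  by rewrite gt_eqF.
- move=> t t0; have st : 0 < Num.sqrt t by rewrite sqrtr_gt0.
  rewrite normrM normfV (gtr0_norm st) ler_pdivrMr//; exact: fL.
- move=> t t0; have st : 0 < Num.sqrt t by rewrite sqrtr_gt0.
  have gL : `|g t| <= L.
    by rewrite normrM normfV (gtr0_norm st) ler_pdivrMr//; exact: fL.
  have -> : t * dg t = (df (Num.sqrt t) - g t) / 2.
    by rewrite /dg /g; field; rewrite !gt_eqF.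
  rewrite normrM normfV (ger0_norm (_ : 0 <= 2))// ler_pdivrMr//.
  apply: le_trans (ler_normB _ _) _; have := dfL _ st; lra.
Qed.

End vjet.

(** * The real bilinear form of the operator and the two integrands *)

Section form.
Context {R : realType} {N m : nat}.
Local Notation C := R[i].
Local Notation Re := (@complex.Re R).
Local Notation Im := (@complex.Im R).
Implicit Types (A : 'I_N -> 'I_N -> 'M[C]_m) (X Y Z p : 'I_N -> 'cV[C]_m) (v : 'cV[C]_m).

Definition form A X Y : R := Re (\sum_h \sum_k herm (A h k *m X k) (Y h)).

Lemma ReN (z : C) : Re (- z) = - Re z.
Proof. by case: z. Qed.

Lemma formE A X Y : form A X Y = \sum_h \sum_k Re (herm (A h k *m X k) (Y h)).
Proof. by rewrite /form Re_sum; apply: eq_bigr => h _; rewrite Re_sum. Qed.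

Lemma formDl A X Y Z : form A (fun k => X k + Y k) Z = form A X Z + form A Y Z.
Proof.
rewrite !formE -big_split; apply: eq_bigr => h _; rewrite -big_split.
by apply: eq_bigr => k _; rewrite mulmxDr hermDl ReD.
Qed.

Lemma formDr A X Y Z : form A Z (fun k => X k + Y k) = form A Z X + form A Z Y.
Proof.
rewrite !formE -big_split; apply: eq_bigr => h _; rewrite -big_split.
by apply: eq_bigr => k _; rewrite hermDr ReD.
Qed.

Lemma formZl A r X Y : form A (fun k => r%:C%C *: X k) Y = r * form A X Y.
Proof.
rewrite !formE mulr_sumr; apply: eq_bigr => h _; rewrite mulr_sumr.
by apply: eq_bigr => k _; rewrite -scalemxAr hermZl Re_realM.
Qed.

Lemma formZr A r X Y : form A X (fun k => r%:C%C *: Y k) = r * form A X Y.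
Proof.
rewrite !formE mulr_sumr; apply: eq_bigr => h _; rewrite mulr_sumr.
by apply: eq_bigr => k _; rewrite hermZr Re_realM.
Qed.

(* The component of the gradient [p] along [v], up to the factor [|v|^2]. *)
Definition radial_part v p (k : 'I_N) : 'cV[C]_m := (Re (herm v (p k)))%:C%C *: v.

(** Gradients of radial rearrangements of one field are all combinations of p and its radial part,
    so two integrands agree as soon as four coefficients do. *)
Lemma form_radial A v p (a b c d : R) :
  form A (fun k => a%:C%C *: p k + (b * Re (herm v (p k)))%:C%C *: v)
         (fun k => c%:C%C *: p k + (d * Re (herm v (p k)))%:C%C *: v) =
  a * c * form A p p + b * c * form A (radial_part v p) p +
  a * d * form A p (radial_part v p) + b * d * form A (radial_part v p) (radial_part v p).
Proof.
have E (x : R) : (fun k => (x * Re (herm v (p k)))%:C%C *: v) = (fun k => x%:C%C *: radial_part v p k).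
  by apply/funext => k; rewrite scalerA rmorphM.
rewrite formDl !formDr !E !(formZl, formZr); ring.
Qed.

(** The right-hand side is the form at (p + l' r, p - l' r), where r is the radial part and l' = l /
    |v|^2. If v = 0 then r = 0 and both sides reduce to the form at (p, p). *)
Lemma form_integrand A v p (l : R) :
  Re (\sum_h \sum_k
        (herm (A h k *m p k) (p h) +
         (if v == 0 then 0 else
            (l * enorm v ^- 2 * Re (herm v (p k)))%:C%C
              * herm ((A h k - adjmx (A k h)) *m v) (p h)
            - (l ^+ 2 * enorm v ^- 4 * Re (herm v (p k)) * Re (herm v (p h)))%:C%C
              * herm (A h k *m v) v))) =
  form A p p + l / enorm v ^+ 2 * (form A (radial_part v p) p - form A p (radial_part v p)) -
  (l / enorm v ^+ 2) ^+ 2 * form A (radial_part v p) (radial_part v p).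
Proof.
have [v0|v0] := eqVneq v 0.
  have r0 : radial_part v p = (fun k => 0%:C%C *: p k).
    by apply/funext => k; rewrite /radial_part v0 scaler0 scale0r.
  rewrite r0 !(formZl, formZr) !mul0r subrr !mulr0 subr0 addr0 /form.
  by congr Re; apply: eq_bigr => h _; apply: eq_bigr => k _; rewrite addr0.
(* The adjoint moves the matrix to the other side of the product, and interchanging h and k puts the
   factor Re<v, p_k> where the integrand has it. *)
have swap : form A p (radial_part v p) =
    \sum_h \sum_k Re (herm v (p k)) * Re (herm (adjmx (A k h) *m v) (p h)).
  rewrite formE exchange_big; apply: eq_bigr => k _; apply: eq_bigr => h _.
  by rewrite hermZr Re_realM herm_adj (hermC (A h k *m p k) v) Re_conj.
rewrite swap !formE Re_sum -sumrB mulr_sumr -big_split mulr_sumr -sumrB.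
apply: eq_bigr => h _ /=.
rewrite Re_sum -sumrB mulr_sumr -big_split mulr_sumr -sumrB.
apply: eq_bigr => k _ /=.
rewrite /radial_part -!scalemxAr !hermZl hermZr.
rewrite mulmxBl [herm (_ *m v - _) _]hermDl -[- (adjmx _ *m v)]scaleN1r hermZl mulN1r.
rewrite !ReD ReN !Re_realM ReD ReN expr_div_n -exprM; ring.
Qed.

Local Notation normc := Normc.normc.

Lemma normc_ge0 (z : C) : 0 <= normc z.
Proof. by case: z => a b; exact: sqrtr_ge0. Qed.

Lemma normcR (r : R) (z : C) : normc (r%:C%C * z) = `|r| * normc z.
Proof.
apply/eqP; rewrite -(@eqrXn2 _ 2) ?mulr_ge0 ?normc_ge0//; apply/eqP.
rewrite exprMn real_normK ?num_real// !normc_sq.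
by case: z => a b /=; ring.
Qed.

Lemma normc_conj (z : C) : normc (z^*) = normc z.
Proof. by case: z => a b /=; rewrite sqrrN. Qed.

Lemma Re_le_normc (z : C) : `|Re z| <= normc z.
Proof.
rewrite -(@ler_pXn2r _ 2) ?nnegrE ?normc_ge0// normc_sq real_normK ?num_real//.
by rewrite lerDl sqr_ge0.
Qed.

Lemma normc_sum (T : Type) (r : seq T) (F : T -> C) :
  normc (\sum_(c <- r) F c) <= \sum_(c <- r) normc (F c).
Proof.
elim/big_ind2: _ => [|z a w b za wb|//]; first by rewrite Normc.normc0.
by apply: le_trans (le_normcD _ _) _; exact: lerD.
Qed.

Lemma normc_le_enorm v i : normc (v i 0) <= enorm v.
Proof.
rewrite -(@ler_pXn2r _ 2) ?nnegrE ?normc_ge0 ?enorm_ge0// normc_sq enorm_sq.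
by rewrite (bigD1 i)//= lerDl; apply: sumr_ge0 => j _; rewrite addr_ge0 ?sqr_ge0.
Qed.

Definition sum_normc X : R := \sum_k \sum_i normc (X k i 0).

Lemma sum_normc_ge0 X : 0 <= sum_normc X.
Proof. by apply: sumr_ge0 => k _; apply: sumr_ge0 => i _; exact: normc_ge0. Qed.

Lemma form_le A X Y (M : R) : (forall h k i j, normc (A h k i j) <= M) ->
  `|form A X Y| <= M * sum_normc X * sum_normc Y.
Proof.
move=> AM; have -> : M * sum_normc X * sum_normc Y = \sum_h \sum_k \sum_i \sum_j
    (M * normc (X k j 0) * normc (Y h i 0)).
  rewrite mulrC /sum_normc mulr_suml; apply: eq_bigr => h _.
  rewrite !mulr_sumr; under [RHS]eq_bigr => k _.
    under eq_bigr => i _ do rewrite -mulr_suml -mulr_sumr.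
    rewrite -mulr_sumr; over.
  by apply: eq_bigr => k _; rewrite mulrC.
rewrite formE; apply: le_trans (ler_norm_sum _ _ _) _; apply: ler_sum => h _.
apply: le_trans (ler_norm_sum _ _ _) _; apply: ler_sum => k _.
apply: le_trans (Re_le_normc _) _; apply: le_trans (normc_sum _ _) _.
apply: ler_sum => i _; rewrite Normc.normcM normc_conj mxE -mulr_suml.
rewrite ler_wpM2r ?normc_ge0//; apply: le_trans (normc_sum _ _) _.
by apply: ler_sum => j _; rewrite Normc.normcM ler_wpM2r ?normc_ge0.
Qed.

(** One factor |v| comes from Cauchy-Schwarz applied to Re<v, p_k>, the other from the vector v
    itself, whose m entries are each at most |v|. *)
Lemma sum_normc_radial_part v p : sum_normc (radial_part v p) <= m%:R * enorm v ^+ 2 * sum_normc p.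
Proof.
rewrite /sum_normc mulr_sumr; apply: ler_sum => k _.
have -> : \sum_i normc (radial_part v p k i 0) = `|Re (herm v (p k))| * \sum_i normc (v i 0).
  by rewrite mulr_sumr; apply: eq_bigr => i _; rewrite mxE normcR.
have h1 : \sum_i normc (v i 0) <= m%:R * enorm v.
  rewrite mulr_natl -[m in _ *+ m]card_ord -sumr_const; apply: ler_sum => i _.
  exact: normc_le_enorm.
have h2 : `|Re (herm v (p k))| <= enorm v * \sum_i normc (p k i 0).
  apply: le_trans (Re_le_normc _) _; apply: le_trans (normc_sum _ _) _.
  rewrite mulr_sumr; apply: ler_sum => i _; rewrite Normc.normcM normc_conj.
  by rewrite ler_wpM2r ?normc_ge0// normc_le_enorm.
have -> : m%:R * enorm v ^+ 2 * \sum_i normc (p k i 0) =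
  (enorm v * \sum_i normc (p k i 0)) * (m%:R * enorm v) by ring.
by apply: ler_pM => //; apply: sumr_ge0 => i _; exact: normc_ge0.
Qed.

End form.

Section measurable_form.
Context {R : realType} {N m : nat}.
Variable Omega : set 'rV[R]_N.
Hypothesis oO : open Omega.
Let mO : measurable Omega := open_measurable_rV oO.
Local Notation C := R[i].
Local Notation Re := (@complex.Re R).
Local Notation Im := (@complex.Im R).
Implicit Types f g : 'rV[R]_N -> C.

Lemma cmeasurableM f g : cmeasurable Omega f -> cmeasurable Omega g ->
  cmeasurable Omega (fun x => f x * g x).
Proof.
move=> [f1 f2] [g1 g2]; split.
  rewrite (_ : (fun _ => _) = (fun x => Re (f x) * Re (g x) - Im (f x) * Im (g x))).
    by apply: measurable_funB; exact: measurable_funM.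
  by apply/funext => x; case: (f x) (g x) => [? ?] [? ?].
rewrite (_ : (fun _ => _) = (fun x => Re (f x) * Im (g x) + Im (f x) * Re (g x))).
  by apply: measurable_funD; exact: measurable_funM.
by apply/funext => x; case: (f x) (g x) => [? ?] [? ?].
Qed.

Lemma cmeasurable_conj f : cmeasurable Omega f -> cmeasurable Omega (fun x => (f x)^*).
Proof.
move=> [f1 f2]; split.
  by rewrite (_ : (fun _ => _) = (fun x => Re (f x)))//; apply/funext => x; case: (f x).
rewrite (_ : (fun _ => _) = (fun x => - Im (f x))); first exact: measurable_funN.
by apply/funext => x; case: (f x).
Qed.

Lemma cmeasurable_sum (T : Type) (r : seq T) (F : T -> 'rV[R]_N -> C) :
  (forall c, cmeasurable Omega (F c)) -> cmeasurable Omega (fun x => \sum_(c <- r) F c x).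
Proof.
move=> mF; elim: r => [|c r [IH1 IH2]].
  by split; under eq_fun do rewrite big_nil; exact: measurable_cst.
have [m1 m2] := mF c; split.
  rewrite (_ : (fun _ => _) = (fun x => Re (F c x) + Re (\sum_(c <- r) F c x))).
    exact: measurable_funD.
  by apply/funext => x; rewrite big_cons; case: (F c x) (\sum_(_ <- _) _) => [? ?] [? ?].
rewrite (_ : (fun _ => _) = (fun x => Im (F c x) + Im (\sum_(c <- r) F c x))).
  exact: measurable_funD.
by apply/funext => x; rewrite big_cons; case: (F c x) (\sum_(_ <- _) _) => [? ?] [? ?].
Qed.

Lemma measurable_herm (X Y : 'rV[R]_N -> 'cV[C]_m) :
  (forall i, cmeasurable Omega (fun x => X x i 0)) ->
  (forall i, cmeasurable Omega (fun x => Y x i 0)) ->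
  cmeasurable Omega (fun x => herm (X x) (Y x)).
Proof.
by move=> mX mY; apply: cmeasurable_sum => i; apply: cmeasurableM => //; exact: cmeasurable_conj.
Qed.

Lemma measurable_form (A : 'I_N -> 'I_N -> 'rV[R]_N -> 'M[C]_m)
    (X Y : 'I_N -> 'rV[R]_N -> 'cV[C]_m) :
  (forall h k i j, cmeasurable Omega (fun x => A h k x i j)) ->
  (forall k i, cmeasurable Omega (fun x => X k x i 0)) ->
  (forall k i, cmeasurable Omega (fun x => Y k x i 0)) ->
  measurable_fun Omega (fun x => form (fun h k => A h k x) (X ^~ x) (Y ^~ x)).
Proof.
move=> mA mX mY.
suff [] : cmeasurable Omega (fun x => \sum_h \sum_k herm (A h k x *m X k x) (Y h x)) by [].
apply: cmeasurable_sum => h; apply: cmeasurable_sum => k; apply: measurable_herm => // i.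
rewrite (_ : (fun x => _) = (fun x => \sum_j A h k x i j * X k x j 0)); last first.
  by apply/funext => x; rewrite mxE.
by apply: cmeasurable_sum => j; exact: cmeasurableM.
Qed.

Lemma cmeasurable_real (f : 'rV[R]_N -> R) : measurable_fun Omega f ->
  cmeasurable Omega (fun x => (f x)%:C%C).
Proof. by move=> mf; split => //; exact: measurable_cst. Qed.

Lemma measurable_enorm (v : 'rV[R]_N -> 'cV[C]_m) :
  (forall i, cmeasurable Omega (fun x => v x i 0)) ->
  measurable_fun Omega (fun x => enorm (v x)).
Proof.
move=> mv; apply: (@measurableT_comp _ _ _ _ _ _ (@Num.sqrt R)).
  by apply: continuous_measurable_fun; exact: sqrt_continuous.
by have [] := measurable_herm mv mv.
Qed.

Lemma L2_normc f : L2 Omega f -> L2r Omega (fun x => Normc.normc (f x)).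
Proof.
move=> [[m1 m2] f2]; split=> //.
rewrite (_ : (fun _ => _) = (fun x => Num.sqrt (Re (f x) ^+ 2 + Im (f x) ^+ 2))).
  apply: (@measurableT_comp _ _ _ _ _ _ (@Num.sqrt R)).
    by apply: continuous_measurable_fun; exact: sqrt_continuous.
  by apply: measurable_funD; exact: measurable_funX.
by apply/funext => x; case: (f x).
Qed.

End measurable_form.

(** * The scalar functions s phi(s) and s sqrt(phi(s)) *)

Section one_dim.
Context {R : realType}.
Implicit Types (f df h dh : R -> R).

Lemma MVT_pos f df a b : (forall s : R, 0 < s -> is_derive s 1 f (df s)) -> 0 < a -> a <= b ->
  exists2 c, a <= c <= b & f b - f a = df c * (b - a).
Proof.
move=> fdf a0 ab; have [||c] := @MVT_segment R f df a b ab.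
- by move=> s; rewrite in_itv/= => /andP[sa _]; apply: fdf; exact: lt_trans sa.
- apply: continuous_in_subspaceT => s; rewrite inE /= in_itv/= => /andP[sa _].
  apply: differentiable_continuous; apply/derivable1_diffP.
  by have [] := fdf s (lt_le_trans a0 sa).
by rewrite in_itv/= => cab ->; exists c.
Qed.

Lemma is_derive_continuous f df (s : R) : is_derive s 1 f (df s) -> {for s, continuous f}.
Proof.
by move=> [dfs _]; apply: differentiable_continuous; exact/derivable1_diffP.
Qed.

Lemma is_derive_lt f df a b : (forall s : R, 0 < s -> is_derive s 1 f (df s)) ->
  (forall s, 0 < s -> 0 < df s) -> 0 < a -> a < b -> f a < f b.
Proof.
move=> fdf df0 a0 ab; have [c /andP[ac _] E] := MVT_pos fdf a0 (ltW ab).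
by rewrite -subr_gt0 E mulr_gt0 ?subr_gt0// df0// (lt_le_trans a0).
Qed.

(** Surjectivity is asked for only as the existence of values below and above each y, which is easy
    to check for sums; the intermediate value theorem supplies the rest. The inverse is arbitrary
    outside (0, +oo). *)
Lemma inverse_C1 h dh :
  (forall s, 0 < s -> 0 < h s) ->
  (forall s : R, 0 < s -> is_derive s 1 h (dh s)) ->
  (forall s, 0 < s -> 0 < dh s) ->
  (forall y, 0 < y -> exists2 s, 0 < s & h s <= y) ->
  (forall y, 0 < y -> exists2 s, 0 < s & y <= h s) ->
  exists k : R -> R, [/\ forall t, 0 < t -> 0 < k t, forall t, 0 < t -> h (k t) = t,
    forall s, 0 < s -> k (h s) = s &
    forall t : R, 0 < t -> is_derive t 1 k (dh (k t))^-1].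
Proof.
move=> h0 hdh dh0 hlow hup.
have /choice[k Hk] : forall t, exists s, 0 < t -> 0 < s /\ h s = t.
  move=> t; have [t0|t0] := ltP 0 t; last by exists 0.
  have [a a0 ha] := hlow t t0; have [b b0 hb] := hup t t0.
  have ab : a <= b.
    rewrite leNgt; apply/negP => ba; have := is_derive_lt hdh dh0 b0 ba.
    by rewrite ltNge (le_trans ha hb).
  have [||c] := @IVT R h a b t ab.
  - apply: continuous_in_subspaceT => s; rewrite inE /= in_itv/= => /andP[sa _].
    by apply: (@is_derive_continuous _ dh); apply: hdh; exact: lt_le_trans sa.
  - by rewrite ge_min ha/= le_max hb orbT.
  rewrite in_itv/= => /andP[ac _] hc; exists c => _; split=> //.
  exact: lt_le_trans ac.
have k0 t : 0 < t -> 0 < k t by move=> /Hk[].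
have hk t : 0 < t -> h (k t) = t by move=> /Hk[].
have kh s : 0 < s -> k (h s) = s.
  move=> s0; have ks := k0 _ (h0 _ s0); have hks := hk _ (h0 _ s0).
  apply/eqP; rewrite eq_le !leNgt; apply/andP; split; apply/negP => l.
    by have := is_derive_lt hdh dh0 s0 l; rewrite hks ltxx.
  by have := is_derive_lt hdh dh0 ks l; rewrite hks ltxx.
exists k; split=> // t t0.
have npos : \forall s \near k t, 0 < s by apply: lt_nbhsr; exact: k0.
rewrite -[X in is_derive X](hk t t0).
apply: is_derive_inverse.
- by apply: filterS npos => s; exact: kh.
- by apply: filterS npos => s s0; exact: is_derive_continuous (hdh s s0).
- by apply: hdh; exact: k0.
- by rewrite gt_eqF// dh0// k0.
Qed.

End one_dim.

Section phi_facts.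
Context {R : realType}.
Variable phi : R -> R.
Hypothesis Hphi : phi_conditions phi.

Definition sphi (s : R) : R := s * phi s.
Definition dsphi (s : R) : R := phi s + s * derive1 phi s.
Definition ssqrtphi (s : R) : R := s * Num.sqrt (phi s).
Definition dssqrtphi (s : R) : R := (2 * phi s + s * derive1 phi s) / (2 * Num.sqrt (phi s)).

Lemma phi_gt0 s : 0 < s -> 0 < phi s. Proof. by have [+ _ _ _ _] := Hphi; exact. Qed.

Lemma is_derive_phi (s : R) : 0 < s -> is_derive s 1 phi (derive1 phi s).
Proof.
have [_ + _ _ _] := Hphi => /[apply] -[dphi _].
by apply: DeriveDef => //; rewrite derive1E.
Qed.

Lemma continuous_dphi s : 0 < s -> {for s, continuous (derive1 phi)}.
Proof. by have [_ + _ _ _] := Hphi => /[apply] -[]. Qed.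

Lemma continuous_phi s : 0 < s -> {for s, continuous phi}.
Proof. by move=> s0; exact: is_derive_continuous (is_derive_phi s0). Qed.

Lemma is_derive_sphi (s : R) : 0 < s -> is_derive s 1 sphi (dsphi s).
Proof.
move=> s0; have := is_deriveM (is_derive_id s (1 : R)) (is_derive_phi s0).
by move=> /is_derive_eq; apply; rewrite /GRing.scale/= /dsphi; ring.
Qed.

Lemma dsphi_gt0 s : 0 < s -> 0 < dsphi s.
Proof.
move=> s0; have [_ _ + _ _] := Hphi => /(_ s s0).
by rewrite derive1E; have [_ ->] := is_derive_sphi s0.
Qed.

Lemma sphi_gt0 s : 0 < s -> 0 < sphi s.
Proof. by move=> s0; rewrite mulr_gt0// phi_gt0. Qed.

Lemma ssqrtphi_gt0 s : 0 < s -> 0 < ssqrtphi s.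
Proof. by move=> s0; rewrite mulr_gt0// sqrtr_gt0 phi_gt0. Qed.

Lemma is_derive_ssqrtphi (s : R) : 0 < s -> is_derive s 1 ssqrtphi (dssqrtphi s).
Proof.
move=> s0; have f0 := phi_gt0 s0; have sf0 : 0 < Num.sqrt (phi s) by rewrite sqrtr_gt0.
have D1 := @is_derive1_comp _ Num.sqrt phi s _ _ (is_derive1_sqrt f0) (is_derive_phi s0).
have := is_deriveM (is_derive_id s (1 : R)) D1.
move=> /is_derive_eq; apply; rewrite /GRing.scale/= /dssqrtphi.
rewrite -{3}(sqr_sqrtr (ltW f0)); move: (Num.sqrt _) sf0 => c c0.
by field; rewrite gt_eqF.
Qed.

Lemma dssqrtphi_gt0 s : 0 < s -> 0 < dssqrtphi s.
Proof.
move=> s0; have := dsphi_gt0 s0; rewrite /dsphi => d0; have f0 := phi_gt0 s0.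
by rewrite divr_gt0 ?mulr_gt0 ?sqrtr_gt0//; lra.
Qed.

Lemma ssqrtphi_sq s : 0 < s -> ssqrtphi s ^+ 2 = s * sphi s.
Proof.
by move=> s0; rewrite exprMn sqr_sqrtr ?(ltW (phi_gt0 s0))// /sphi; ring.
Qed.

Lemma continuous_dsphi s : 0 < s -> {for s, continuous dsphi}.
Proof.
move=> s0; apply: cvgD; first exact: continuous_phi.
by apply: cvgM => //; exact: continuous_dphi.
Qed.

Lemma continuous_dssqrtphi s : 0 < s -> {for s, continuous dssqrtphi}.
Proof.
move=> s0; have c1 := continuous_phi s0.
apply: cvgM.
  apply: cvgD; first by apply: cvgM => //; exact: cvg_cst.
  by apply: cvgM => //; exact: continuous_dphi.
apply: cvgV; first by rewrite mulf_neq0// gt_eqF// sqrtr_gt0 phi_gt0.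
apply: cvgM; first exact: cvg_cst.
by apply: (@continuous_comp _ _ _ phi Num.sqrt) => //; exact: sqrt_continuous.
Qed.

Lemma sphi_le a b : 0 < a -> a <= b -> sphi a <= sphi b.
Proof.
move=> a0; rewrite le_eqVlt => /predU1P[->//|ab].
exact/ltW/(is_derive_lt is_derive_sphi dsphi_gt0 a0 ab).
Qed.

Lemma sphi_surj y : 0 < y -> exists2 s, 0 < s & sphi s = y.
Proof.
move=> y0; have [_ _ _ + _] := Hphi => /seteqP[_ /(_ y)].
move=> /(_ _)[|s]; first by rewrite /= in_itv/= y0.
by rewrite /= in_itv/= andbT => s0 <-; exists s.
Qed.

Lemma exists_sphi_le y : 0 < y -> exists s, [/\ 0 < s, s <= y & sphi s <= y].
Proof.
move=> y0; have [s s0 sy] := sphi_surj y0; exists (Num.min s y).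
split; first by rewrite lt_min s0.
  by rewrite ge_min lexx orbT.
rewrite -[leRHS]sy; apply: sphi_le; first by rewrite lt_min s0.
by rewrite ge_min lexx.
Qed.

Lemma exists_le_sphi y : 0 < y -> exists s, [/\ 0 < s, y <= s & y <= sphi s].
Proof.
move=> y0; have [s s0 sy] := sphi_surj y0; exists (Num.max s y).
split; first by rewrite lt_max s0.
  by rewrite le_max lexx orbT.
by rewrite -[leLHS]sy; apply: sphi_le => //; rewrite le_max lexx.
Qed.

(** One inverse for three purposes: (a, b) = (1, 0) gives zeta, (0, 1) recovers |u| from |u| +
    P(|u|), and (1, e) gives the regularized inverse. *)
Lemma comb_inverse (a b : R) : 0 <= a -> 0 <= b -> 0 < a + b -> exists k : R -> R,
  [/\ forall t, 0 < t -> 0 < k t,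
    forall t, 0 < t -> a * ssqrtphi (k t) + b * (k t + sphi (k t)) = t,
    forall s, 0 < s -> k (a * ssqrtphi s + b * (s + sphi s)) = s &
    forall t : R, 0 < t ->
      is_derive t 1 k (a * dssqrtphi (k t) + b * (1 + dsphi (k t)))^-1].
Proof.
move=> a0 b0 ab0.
pose h (s : R) := a * ssqrtphi s + b * (s + sphi s).
pose dh (s : R) := a * dssqrtphi s + b * (1 + dsphi s).
have comb_gt0 x y : 0 < x -> 0 < y -> 0 < a * x + b * y.
  move=> x0 y0; case: (ltgtP a 0) a0 => // [a1|a1] _.
    by rewrite ltr_pwDl ?mulr_gt0// mulr_ge0// ltW.
  by rewrite a1 mul0r add0r mulr_gt0//; move: ab0; rewrite a1 add0r.
(* If s and P(s) are both at most (at least) y / (a + 2 b), then so is q(s), being their geometric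
   mean, and the combination is at most (at least) y. *)
have K0 : 0 < a + 2 * b by lra.
apply: (@inverse_C1 _ h dh).
- move=> s s0; apply: comb_gt0; first exact: ssqrtphi_gt0.
  by rewrite addr_gt0// sphi_gt0.
- move=> s s0.
  have D1 := is_deriveZ a (is_derive_ssqrtphi s0).
  have D2 := is_deriveZ b (is_deriveD (is_derive_id s (1 : R)) (is_derive_sphi s0)).
  exact: is_deriveD D1 D2.
- move=> s s0; apply: comb_gt0; first exact: dssqrtphi_gt0.
  by rewrite addr_gt0// dsphi_gt0.
- move=> y y0; have [s [s0 sy Py]] := exists_sphi_le (divr_gt0 y0 K0).
  exists s => //; have q0 := ssqrtphi_gt0 s0.
  have yK0 : 0 <= y / (a + 2 * b) by rewrite ltW// divr_gt0.
  have qy : ssqrtphi s <= y / (a + 2 * b).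
    rewrite -(@ler_pXn2r _ 2) ?nnegrE ?(ltW q0)// ssqrtphi_sq// expr2.
    by apply: ler_pM => //; apply: ltW => //; exact: sphi_gt0.
  have -> : y = a * (y / (a + 2 * b)) + b * (y / (a + 2 * b) + y / (a + 2 * b)).
    by field; rewrite gt_eqF.
  by rewrite lerD// ler_wpM2l// lerD.
- move=> y y0; have [s [s0 sy Py]] := exists_le_sphi (divr_gt0 y0 K0).
  exists s => //; have q0 := ssqrtphi_gt0 s0.
  have yK0 : 0 <= y / (a + 2 * b) by rewrite ltW// divr_gt0.
  have qy : y / (a + 2 * b) <= ssqrtphi s.
    by rewrite -(@ler_pXn2r _ 2) ?nnegrE ?(ltW q0)// ssqrtphi_sq// expr2 ler_pM.
  have -> : y = a * (y / (a + 2 * b)) + b * (y / (a + 2 * b) + y / (a + 2 * b)).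
    by field; rewrite gt_eqF.
  by rewrite lerD// ler_wpM2l// lerD.
Qed.

End phi_facts.

(** * The function Lambda and the growth of phi *)

Section lambda.
Context {R : realType}.
Variable phi : R -> R.
Hypothesis Hphi : phi_conditions phi.
Local Notation P := (sphi phi).
Local Notation dP := (dsphi phi).
Local Notation q := (ssqrtphi phi).
Local Notation dq := (dssqrtphi phi).

(** [zeta] picks a solution of q(s) = t by choice; injectivity of q identifies it with the smooth
    inverse k. The formula is then the logarithmic derivative of k(t) / t. *)
Lemma Lambda_inverse : exists k : R -> R,
  [/\ forall t, 0 < t -> 0 < k t, forall t, 0 < t -> q (k t) = t,
      forall s, 0 < s -> k (q s) = s, forall t, 0 < t -> {for t, continuous k} &
      forall t, 0 < t -> Lambda phi t = t / (k t * dq (k t)) - 1].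
Proof.
have [|k [k0 qk kq kd]] := comb_inverse Hphi ler01 (lexx 0); first by rewrite addr0.
have {}qk t : 0 < t -> q (k t) = t by move=> t0; rewrite -[RHS](qk t t0) mul0r addr0 mul1r.
have {}kq s : 0 < s -> k (q s) = s by move=> s0; rewrite -[RHS](kq s s0) mul0r addr0 mul1r.
have {}kd (t : R) : 0 < t -> is_derive t 1 k (dq (k t))^-1.
  by move=> t0; have := kd t t0; rewrite mul0r addr0 mul1r.
have zk t : 0 < t -> zeta phi t = k t.
  move=> t0; rewrite /zeta.
  have ex : exists s, [set s | 0 < s /\ s * Num.sqrt (phi s) = t] s.
    by exists (k t); split; [exact: k0|exact: qk].
  have [] := xgetPex 0 ex.
  by move: (xget _ _) => z z0 zt; rewrite -(kq z z0) /ssqrtphi zt.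
exists k; split=> // t t0.
  exact: (@is_derive_continuous _ k (fun t => (dq (k t))^-1) t (kd t t0)).
have kt0 := k0 t t0; have dq0 := dssqrtphi_gt0 Hphi kt0.
have tn0 : t != 0 by rewrite gt_eqF.
have Dinv : is_derive t 1 (fun s : R => s^-1) (- t ^- 2 *: 1).
  apply: DeriveDef; first by apply: (@derivableV _ _ id).
  by rewrite (@deriveV _ _ id)// derive_id.
have D := is_deriveM (kd t t0) Dinv.
have near0 : \forall s \near t, k s * s^-1 = Theta phi s.
  have : \forall s \near t, 0 < s by exact: lt_nbhsr.
  by apply: filterS => s s0; rewrite /Theta zk.
have [_ vD] := near_eq_is_derive near0 D.
rewrite /Lambda derive1E vD /Theta zk// /GRing.scale/=.
by field; rewrite tn0 !gt_eqF.
Qed.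

Lemma Lambda_ssqrtphi s : 0 < s -> 1 + Lambda phi (q s) = q s / (s * dq s).
Proof.
move=> s0; have [k [_ _ kq _ L]] := Lambda_inverse.
by rewrite L ?ssqrtphi_gt0// kq// addrC subrK.
Qed.

Lemma dssqrtphiE s : 0 < s -> dq s = (phi s + dP s) / (2 * Num.sqrt (phi s)).
Proof. by move=> s0; rewrite /dssqrtphi /dsphi; congr (_ / _); ring. Qed.

Lemma one_plus_Lambda s : 0 < s -> (1 + Lambda phi (q s)) * dq s = Num.sqrt (phi s).
Proof.
move=> s0; have dq0 := dssqrtphi_gt0 Hphi s0.
by rewrite Lambda_ssqrtphi// /ssqrtphi; field; rewrite !gt_eqF.
Qed.

(** Added to [one_plus_Lambda] this is 2 q' = sqrt(phi) + P' / sqrt(phi). Up to factors sqrt(phi),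
    the numbers (1 + Lambda) q' and (1 - Lambda) q' are the derivatives 1 and P' of the profiles of
    u and phi(|u|) u. *)
Lemma one_minus_Lambda s : 0 < s ->
  (1 - Lambda phi (q s)) * dq s = dP s / Num.sqrt (phi s).
Proof.
move=> s0; have := one_plus_Lambda s0; have f0 := phi_gt0 Hphi s0.
have sf0 : 0 < Num.sqrt (phi s) by rewrite sqrtr_gt0.
rewrite mulrDl mulrBl mul1r => E.
have -> : dq s - Lambda phi (q s) * dq s = 2 * dq s - Num.sqrt (phi s) by rewrite -E; ring.
rewrite dssqrtphiE//; move: (Num.sqrt (phi s)) sf0 (sqr_sqrtr (ltW f0)) => c c0 <-.
by field; rewrite gt_eqF.
Qed.

Lemma continuous_Lambda t : 0 < t -> {for t, continuous (Lambda phi)}.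
Proof.
move=> t0; have [k [k0 _ _ kc L]] := Lambda_inverse.
have nE : \forall s \near t, s / (k s * dq (k s)) - 1 = Lambda phi s.
  have : \forall s \near t, 0 < s by exact: lt_nbhsr.
  by apply: filterS => s s0; rewrite L.
rewrite /prop_for /continuous_at (L t t0).
apply: cvg_trans (near_eq_cvg nE) _.
have kt0 := k0 t t0; have kct := kc t t0.
apply: cvgB; last exact: cvg_cst.
apply: cvgM => //; apply: cvgV.
  by rewrite mulf_neq0// gt_eqF// dssqrtphi_gt0.
apply: cvgM => //.
by apply: (@continuous_comp _ _ _ k dq) => //; exact: continuous_dssqrtphi.
Qed.

(** Integrating (iv) from 0, where P tends to 0 and r + 1 > 0, shows that (r + 1) P lies between C1
    s^(r+1) and C2 s^(r+1). Hence phi, P' and s^r are comparable near 0. *)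
Lemma growth_near_0 : exists s0 : R, 0 < s0 /\ exists K c : R, [/\ 0 < K, 0 < c &
  forall s, 0 < s < s0 -> c * phi s <= dP s <= K * phi s].
Proof.
have [_ _ _ _ [s0 [s00 [C1 [C2 [r [C10 C20 r1 HC _]]]] _]]] := Hphi.
exists s0; split=> //; exists (C2 * (r + 1) / C1), (C1 * (r + 1) / C2).
have r10 : 0 < r + 1 by lra.
split; [by rewrite divr_gt0// mulr_gt0|by rewrite divr_gt0// mulr_gt0|].
have HC' s : 0 < s < s0 -> C1 * s `^ r <= dP s <= C2 * s `^ r.
  move=> /[dup] /andP[sp _] /HC.
  by rewrite derive1E; have [_ ->] := is_derive_sphi Hphi sp.
have dW (C : R) (s : R) : 0 < s -> is_derive s 1 (fun x => C * x `^ (r + 1)) (C * (r + 1) * s `^ r).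
  move=> sp; have := is_deriveZ C (is_derive1_powR (r + 1) sp).
  by rewrite addrK => /is_derive_eq; apply; rewrite /GRing.scale/= mulrA.
have dP' (s : R) : 0 < s -> is_derive s 1 (fun x => (r + 1) * P x) ((r + 1) * dP s).
  by move=> sp; exact: is_deriveZ (is_derive_sphi Hphi sp).
(* The values of the functions at 0 are irrelevant conventions, so a one-sided lower limit at 0
   replaces the initial value F(0) = 0. *)
have ge0 (F dF : R -> R) : (forall s : R, 0 < s -> is_derive s 1 F (dF s)) ->
    (forall s, 0 < s < s0 -> 0 <= dF s) ->
    (forall e, 0 < e -> exists2 a0, 0 < a0 & forall a, 0 < a <= a0 -> - e <= F a) ->
    forall s, 0 < s < s0 -> 0 <= F s.
  move=> FdF dF0 Fe s /andP[sp ss]; apply/ler_addgt0Pr => e e0.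
  have [a0 a00 Ha] := Fe e e0; pose a := Num.min a0 s.
  have ap : 0 < a by rewrite lt_min a00.
  have aas : a <= s by rewrite ge_min lexx orbT.
  have Fa : - e <= F a by apply: Ha; rewrite ap ge_min lexx.
  have [c /andP[ac cs] E] := MVT_pos FdF ap aas.
  have : 0 <= F s - F a.
    rewrite E mulr_ge0 ?subr_ge0// dF0// (lt_le_trans ap ac)/=.
    exact: le_lt_trans cs ss.
  lra.
have up s : 0 < s < s0 -> (r + 1) * P s <= C2 * s `^ (r + 1).
  move=> ss; rewrite -subr_ge0.
  apply: (ge0 (fun s => C2 * s `^ (r + 1) - (r + 1) * P s)
    (fun s => C2 * (r + 1) * s `^ r - (r + 1) * dP s)) ss => {s}.
  - by move=> s sp; exact: is_deriveB (dW C2 s sp) (dP' s sp).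
  - move=> s ss; have /andP[_ h2] := HC' s ss.
    by rewrite subr_ge0 -mulrA mulrCA ler_pM2l.
  - move=> e e0; have [a0 [a00 _ aP]] := exists_sphi_le Hphi (divr_gt0 e0 r10).
    exists a0 => // a /andP[ap aa0].
    have h1 : P a <= e / (r + 1) by exact: le_trans (sphi_le Hphi ap aa0) aP.
    have h2 : (r + 1) * P a <= e by rewrite mulrC -ler_pdivlMr.
    have h3 : 0 <= C2 * a `^ (r + 1) by rewrite mulr_ge0 ?powR_ge0// ltW.
    lra.
have lo s : 0 < s < s0 -> C1 * s `^ (r + 1) <= (r + 1) * P s.
  move=> ss; rewrite -subr_ge0.
  apply: (ge0 (fun s => (r + 1) * P s - C1 * s `^ (r + 1))
    (fun s => (r + 1) * dP s - C1 * (r + 1) * s `^ r)) ss => {s}.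
  - by move=> s sp; exact: is_deriveB (dP' s sp) (dW C1 s sp).
  - move=> s ss; have /andP[h1 _] := HC' s ss.
    by rewrite subr_ge0 -mulrA mulrCA ler_pM2l.
  - move=> e e0; have eC : 0 < e / C1 by rewrite divr_gt0.
    exists ((e / C1) `^ (r + 1)^-1); first exact: powR_gt0.
    move=> a /andP[ap aa0].
    have h1 : a `^ (r + 1) <= e / C1.
      have := @ge0_ler_powR _ (r + 1) (ltW r10) a ((e / C1) `^ (r + 1)^-1).
      rewrite !nnegrE (ltW ap) powR_ge0 -powRrM mulVf ?gt_eqF// powRr1 ?(ltW eC)//.
      exact.
    have h2 : C1 * a `^ (r + 1) <= e by rewrite mulrC -ler_pdivlMr.
    have h3 : 0 <= (r + 1) * P a by rewrite mulr_ge0 ?ltW// sphi_gt0.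
    lra.
move=> s ss; have /andP[sp _] := ss; have /andP[h1 h2] := HC' s ss.
have := up s ss; have := lo s ss.
have -> : s `^ (r + 1) = s `^ r * s.
  by rewrite powRD ?powRr1 ?ltW// (gt_eqF sp) implybT.
rewrite /sphi => l1 l2.
have l1' : C1 * s `^ r <= (r + 1) * phi s.
  by rewrite -(ler_pM2r sp) -mulrA -[leRHS]mulrA [phi s * s]mulrC.
have l2' : (r + 1) * phi s <= C2 * s `^ r.
  by rewrite -(ler_pM2r sp) -[leLHS]mulrA -[leRHS]mulrA [phi s * s]mulrC.
have e1 : s `^ r <= (r + 1) * phi s / C1 by rewrite ler_pdivlMr// mulrC.
have e2 : (r + 1) * phi s / C2 <= s `^ r by rewrite ler_pdivrMr// [leRHS]mulrC.
apply/andP; split.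
  apply: le_trans h1; have -> : C1 * (r + 1) / C2 * phi s = C1 * ((r + 1) * phi s / C2) by ring.
  by rewrite ler_pM2l.
apply: le_trans h2 _; have -> : C2 * (r + 1) / C1 * phi s = C2 * ((r + 1) * phi s / C1) by ring.
by rewrite ler_pM2l.
Qed.

(** By (phi + P')^2 = 4 phi q'^2, the bound follows near 0 from the comparability of phi and P'; on
    a compact interval it follows from continuity, and at infinity from the constant sign of
    phi'. *)
Lemma dssqrtphi_le : exists2 L : R, 0 <= L & forall s, 0 < s -> dq s <= L * (1 + dP s).
Proof.
have [_ _ _ _ [s0' [_ _ [s1 s01 mono]]]] := Hphi.
have [s0 [s00 [K [c [K0 c0 near0]]]]] := growth_near_0.
have f0 s : 0 < s -> 0 < phi s by exact: phi_gt0.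
have sf0 s : 0 < s -> 0 < Num.sqrt (phi s) by move=> sp; rewrite sqrtr_gt0 f0.
have dP0 s : 0 < s -> 0 < dP s by exact: dsphi_gt0.
pose s2 := Num.max (Num.max s0 s1) 1.
have s20 : 0 < s2 by rewrite lt_max ltr01 orbT.
have [B HB] : exists B, forall s, s0 <= s <= s2 -> `|dq s| <= B.
  apply: segment_bounded => s /andP[ss _]; apply: continuous_dssqrtphi => //.
  exact: lt_le_trans ss.
(* Near 0, phi + P' is at most (1 + K) phi and at most (1 / c + 1) P'; using one bound for each
   factor of the square gives q'^2 <= M1 P'. *)
pose M1 := (1 + K) * (c^-1 + 1) / 4.
have M10 : 0 <= M1 by rewrite divr_ge0// mulr_ge0// addr_ge0// ?invr_ge0 ltW.
have dq_sq s : 0 < s -> dq s ^+ 2 = (phi s + dP s) ^+ 2 / (4 * phi s).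
  move=> sp; rewrite dssqrtphiE// expr_div_n exprMn sqr_sqrtr ?(ltW (f0 _ sp))//.
  by congr (_ / (_ * _)); ring.
have inv0 : 0 <= (Num.sqrt (phi s2))^-1 by rewrite invr_ge0 ltW// sf0.
pose L := (1 + M1) + `|B| + (Num.sqrt (phi s2))^-1 + Num.sqrt (phi s2).
have sf20 := ltW (sf0 _ s20); have nB := normr_ge0 B.
have bnd s x : 0 < s -> 0 <= x -> x <= L -> dq s <= x * (1 + dP s) -> dq s <= L * (1 + dP s).
  move=> sp x0 xL /le_trans; apply; rewrite ler_wpM2r// addr_ge0// ltW// dP0//.
have L0 : 0 <= L by rewrite /L; lra.
exists L => // s sp; have fs := f0 s sp; have dPs := dP0 s sp.
have [ss0|ss0] := ltP s s0.
  apply: (bnd s (1 + M1)) => //; [lra|rewrite /L; lra|].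
  have /andP[h1 h2] : c * phi s <= dP s <= K * phi s by apply: near0; rewrite sp.
  have h3 : phi s <= c^-1 * dP s by rewrite ler_pdivlMl.
  have h4 : dq s ^+ 2 <= M1 * dP s.
    rewrite dq_sq// ler_pdivrMr ?mulr_gt0//.
    have -> : M1 * dP s * (4 * phi s) = ((1 + K) * phi s) * ((c^-1 + 1) * dP s).
      by rewrite /M1; field; rewrite gt_eqF.
    rewrite expr2; apply: ler_pM; [lra|lra| |].
      by rewrite mulrDl mul1r lerD2l.
    by rewrite mulrDl mul1r lerD2r.
  rewrite -(@ler_pXn2r _ 2) ?nnegrE ?(ltW (dssqrtphi_gt0 Hphi sp))//; last by rewrite mulr_ge0//; lra.
  apply: le_trans h4 _; rewrite exprMn; apply: ler_pM => //; first exact: ltW.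
    by rewrite sqrrD expr1n mulr2n; have := sqr_ge0 M1; lra.
  by rewrite sqrrD expr1n mulr2n; have := sqr_ge0 (dP s); lra.
have [ss2|ss2] := leP s s2.
  apply: (bnd s `|B|) => //; first by rewrite /L; lra.
  apply: le_trans (ler_norm _) _; apply: le_trans (HB s _) _; first by rewrite ss0.
  apply: le_trans (ler_norm _) _; rewrite -{1}[`|B|]mulr1 ler_wpM2l//; lra.
have s1s x : s2 <= x -> s1 <= x.
  by apply: le_trans; rewrite !le_max lexx orbT.
case: mono => mono.
  (* Now phi <= P', so q' <= P' / sqrt(phi), and phi is bounded below by phi(s2). *)
  have d1 : 0 <= s * derive1 phi s by rewrite mulr_ge0 ?(ltW sp)//; apply: mono; apply: s1s; exact: ltW.
  have fle : phi s2 <= phi s.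
    have [cc /andP[c1 c2] E] := MVT_pos (is_derive_phi Hphi) s20 (ltW ss2).
    rewrite -subr_ge0 E mulr_ge0 ?subr_ge0 ?(ltW ss2)//; exact/mono/s1s.
  apply: (bnd s (Num.sqrt (phi s2))^-1) => //; first by rewrite /L; lra.
  rewrite dssqrtphiE// ler_pdivrMr ?mulr_gt0// ?sf0//.
  have h1 : 1 <= (Num.sqrt (phi s2))^-1 * Num.sqrt (phi s).
    by rewrite mulrC ler_pdivlMr ?sf0// mul1r ler_sqrt// ltW.
  have h2 : phi s <= dP s by rewrite /dsphi lerDl.
  have -> : (Num.sqrt (phi s2))^-1 * (1 + dP s) * (2 * Num.sqrt (phi s)) =
    2 * (1 + dP s) * ((Num.sqrt (phi s2))^-1 * Num.sqrt (phi s)) by ring.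
  apply: (@le_trans _ _ (2 * (1 + dP s) * 1)); first by lra.
  by rewrite ler_wpM2l// mulr_ge0//; lra.
(* Now P' <= phi, so q' <= sqrt(phi), and phi is bounded above by phi(s2). *)
have d1 : s * derive1 phi s <= 0.
  by rewrite mulr_ge0_le0 ?(ltW sp)//; apply: mono; apply: s1s; exact: ltW.
have fle : phi s <= phi s2.
  have [cc /andP[c1 c2] E] := MVT_pos (is_derive_phi Hphi) s20 (ltW ss2).
  by rewrite -subr_le0 E mulr_le0_ge0 ?subr_ge0 ?(ltW ss2)//; exact/mono/s1s.
apply: (bnd s (Num.sqrt (phi s2))) => //; first by rewrite /L; lra.
apply: (@le_trans _ _ (Num.sqrt (phi s))).
  rewrite dssqrtphiE// ler_pdivrMr ?mulr_gt0// ?sf0// mulrCA -expr2 sqr_sqrtr ?(ltW fs)//.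
  by rewrite /dsphi; lra.
apply: (@le_trans _ _ (Num.sqrt (phi s2) * 1)); first by rewrite mulr1 ler_sqrt// ltW// f0.
by rewrite ler_wpM2l//; lra.
Qed.

End lambda.

(** * Comparison of the two integrands *)

Section coefs.
Context {R : realType}.
Variable phi : R -> R.
Hypothesis Hphi : phi_conditions phi.
Local Notation P := (sphi phi).
Local Notation dP := (dsphi phi).
Local Notation q := (ssqrtphi phi).
Local Notation dq := (dssqrtphi phi).

Lemma radial_comp (a b : R) (k f df : R -> R) : 0 <= a -> 0 <= b -> 0 < a + b ->
  (forall t, 0 < t -> 0 < k t) ->
  (forall t : R, 0 < t -> is_derive t 1 k (a * dq (k t) + b * (1 + dP (k t)))^-1) ->
  (forall s : R, 0 < s -> is_derive s 1 f (df s)) ->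
  (forall s : R, 0 < s -> {for s, continuous df}) ->
  (forall t : R, 0 < t -> is_derive t 1 (f \o k) (df (k t) / (a * dq (k t) + b * (1 + dP (k t))))) /\
  (forall t : R, 0 < t -> {for t, continuous (fun t => df (k t) / (a * dq (k t) + b * (1 + dP (k t))))}).
Proof.
move=> a0 b0 ab0 k0 dk fdf cdf; split=> t t0; have kt0 := k0 t t0.
  exact: (@is_derive1_comp _ f k t _ _ (fdf _ kt0) (dk t t0)).
have ck : {for t, continuous k}.
  exact: (@is_derive_continuous _ k (fun t => (a * dq (k t) + b * (1 + dP (k t)))^-1) t (dk t t0)).
have cc (g : R -> R) : {for k t, continuous g} -> {for t, continuous (g \o k)}.
  by move=> cg; apply: continuous_comp.
have pos : 0 < a * dq (k t) + b * (1 + dP (k t)).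
  have h1 : 0 < dq (k t) by exact: dssqrtphi_gt0.
  have h2 : 0 < 1 + dP (k t) by rewrite addr_gt0// dsphi_gt0.
  case: (ltgtP a 0) a0 => // [a1|a1] _.
    by apply: ltr_pwDl; [exact: mulr_gt0|apply: mulr_ge0 => //; exact: ltW].
  by rewrite a1 mul0r add0r mulr_gt0//; move: ab0; rewrite a1 add0r.
apply: cvgM; first exact: (cc _ (cdf _ kt0)).
apply: cvgV; first by rewrite gt_eqF.
apply: cvgD; apply: cvgM; try exact: cvg_cst.
  exact: (cc _ (continuous_dssqrtphi Hphi kt0)).
by apply: cvgD; [exact: cvg_cst|exact: (cc _ (continuous_dsphi Hphi kt0))].
Qed.

Section at_point.
Variables (s : R) (s0 : 0 < s).
Let c : R := Num.sqrt (phi s).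

Lemma sqrt_phi_gt0 : 0 < c. Proof. by rewrite sqrtr_gt0 phi_gt0. Qed.

Lemma sphiE : P s = s * c ^+ 2.
Proof. by rewrite /sphi sqr_sqrtr// ltW// phi_gt0. Qed.

Lemma ssqrtphiE : q s = s * c. Proof. by []. Qed.

Lemma dssqrtphi_mul : 2 * c * dq s = c ^+ 2 + dP s.
Proof.
have c0 := sqrt_phi_gt0; have : c ^+ 2 = phi s by rewrite sqr_sqrtr// ltW// phi_gt0.
rewrite dssqrtphiE// -/c; move: c c0 => d d0 <-.
by field; rewrite gt_eqF.
Qed.

(* With [v] a radial rearrangement of [V], and [X] the derivative at
   [t = |V|] of the inverse of [t], these are the four coefficients of the
   bilinear form evaluated at the gradients of [u] and [phi(|u|)u] on the one
   hand, and those of the integrand of the theorem on the other. *)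
Lemma coef_identity (t X : R) : 0 < t ->
  let al := s / t in let be := (X - s / t) / t ^+ 2 in
  let ga := P s / t in let de := (dP s * X - P s / t) / t ^+ 2 in
  let r := q s / t in
  let bp := (dq s * X - q s / t + Lambda phi (q s) * (dq s * X)) / t ^+ 2 in
  let bm := (dq s * X - q s / t - Lambda phi (q s) * (dq s * X)) / t ^+ 2 in
  [/\ al * ga = r * r, be * ga = bp * r, al * de = r * bm & be * de = bp * bm].
Proof.
move=> t0 al be ga de r; move: (Lambda phi (q s)) (one_plus_Lambda Hphi s0) (one_minus_Lambda Hphi s0).
move=> l E1 E2 bp bm; have c0 := sqrt_phi_gt0.
have h1 : dq s + l * dq s = c by move: E1; rewrite mulrDl mul1r.
have h2 : dq s - l * dq s = dP s / c by move: E2; rewrite mulrBl mul1r.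
(* The Lambda relations turn the coefficients into [bp = c * be], [bm = de / c] and
   [r = c * al = ga / c]; in every product the factors c cancel. *)
have bpE : bp = (c * X - s * c / t) / t ^+ 2.
  have -> : c * X = (dq s + l * dq s) * X by rewrite h1.
  by rewrite /bp -ssqrtphiE; congr (_ / _); ring.
have bmE : bm = (dP s / c * X - s * c / t) / t ^+ 2.
  rewrite -h2 -ssqrtphiE /bm; congr (_ / _); ring.
rewrite bpE bmE /al /be /ga /de /r ssqrtphiE sphiE.
by split; field; rewrite !gt_eqF.
Qed.

(** As t >= q and 1 / X >= q', everything reduces to b = 0. There s P = q^2 and 2 q q' = P + s P'
    bound the products s P / t^2, X P / t, s P' X / t by 1, 2, 2, and P' <= q'^2 bounds P' X^2 by 1.
    The constants 3 and 6 are 1 + 2 and 1 + 2 + 2 + 1. *)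
Lemma coef_bounds (b : R) : 0 <= b ->
  let t := q s + b * (s + P s) in let X := (dq s + b * (1 + dP s))^-1 in
  [/\ `|s / t * (P s / t)| <= 1, `|(X - s / t) * (P s / t)| <= 3,
      `|s / t * (dP s * X - P s / t)| <= 3 & `|(X - s / t) * (dP s * X - P s / t)| <= 6].
Proof.
move=> b0 t X.
have c0 := sqrt_phi_gt0; have P0 := sphi_gt0 Hphi s0; have dP0 := dsphi_gt0 Hphi s0.
have q0 := ssqrtphi_gt0 Hphi s0; have dq0 := dssqrtphi_gt0 Hphi s0.
have tq : q s <= t by rewrite lerDl mulr_ge0// addr_ge0// ltW.
have t0 : 0 < t by exact: lt_le_trans tq.
have dHq : dq s <= X^-1 by rewrite /X invrK lerDl mulr_ge0// addr_ge0// ltW.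
have X0 : 0 < X by rewrite -invr_gt0; exact: lt_le_trans dq0 dHq.
have dqE := dssqrtphi_mul; have PE := sphiE.
have tX : dq s * q s <= X^-1 * t by apply: ler_pM => //; exact: ltW.
have h0 : 2 * (dq s * q s) = P s + s * dP s.
  by rewrite PE ssqrtphiE -mulrDr -dqE; ring.
have sdP0 : 0 < s * dP s by rewrite mulr_gt0.
have tX0 : 0 < X^-1 * t by rewrite mulr_gt0// invr_gt0.
have XzE (x : R) : X * (x / t) = x / (X^-1 * t) by field; rewrite !gt_eqF.
have b1 : 0 <= s / t * (P s / t) <= 1.
  rewrite mulr_ge0 ?divr_ge0 ?(ltW s0) ?(ltW t0) ?(ltW P0)//=.
  rewrite mulf_div -ssqrtphi_sq// -expr2 ler_pdivrMr ?exprn_gt0// mul1r.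
  by rewrite ler_pXn2r ?nnegrE ?(ltW q0) ?(ltW t0).
have b2 : 0 <= X * (P s / t) <= 2.
  rewrite mulr_ge0 ?divr_ge0 ?(ltW X0) ?(ltW t0) ?(ltW P0)//=.
  by rewrite XzE ler_pdivrMr//; lra.
have b3 : 0 <= s / t * (dP s * X) <= 2.
  apply/andP; split.
    by apply: mulr_ge0; [apply: divr_ge0; exact: ltW|apply: mulr_ge0; exact: ltW].
  have -> : s / t * (dP s * X) = X * ((s * dP s) / t) by ring.
  by rewrite XzE ler_pdivrMr//; lra.
have b4 : 0 <= X * (dP s * X) <= 1.
  apply/andP; split; first by apply: mulr_ge0; [exact: ltW|apply: mulr_ge0; exact: ltW].
  have -> : X * (dP s * X) = dP s / X^-1 ^+ 2 by field; rewrite gt_eqF.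
  rewrite ler_pdivrMr ?mul1r; last by apply: exprn_gt0; rewrite invr_gt0.
  (* The inequality P' <= q'^2 is the arithmetic-geometric mean inequality: 4 c^2 (q'^2 - P') = (c^2
     - P')^2. *)
  apply: (@le_trans _ _ (dq s ^+ 2)); last first.
    by rewrite ler_pXn2r ?nnegrE//; [exact: ltW|rewrite invr_ge0 ltW].
  rewrite -(@ler_pM2l _ (4 * c ^+ 2)) ?mulr_gt0 ?exprn_gt0//.
  have -> : 4 * c ^+ 2 * dq s ^+ 2 = (c ^+ 2 + dP s) ^+ 2 by rewrite -dqE; ring.
  rewrite -subr_ge0; have -> : (c ^+ 2 + dP s) ^+ 2 - 4 * c ^+ 2 * dP s = (c ^+ 2 - dP s) ^+ 2 by ring.
  exact: sqr_ge0.
move: b1 b2 b3 b4; rewrite !mulrBl !mulrBr.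
move: (s / t * (P s / t)) (X * (P s / t)) (s / t * (dP s * X)) (X * (dP s * X)) => x1 x2 x3 x4.
move=> /andP[? ?] /andP[? ?] /andP[? ?] /andP[? ?].
by split; rewrite ler_norml; apply/andP; split; lra.
Qed.

End at_point.
End coefs.

Section backward.
Context {R : realType} {N m : nat}.
Variable phi : R -> R.
Hypothesis Hphi : phi_conditions phi.
Variable Omega : set 'rV[R]_N.
Hypothesis oO : open Omega.
Let mO : measurable Omega := open_measurable_rV oO.
Local Notation mu := (lebesgue_rV N : {sigma_finite_measure set 'rV[R]_N -> \bar R}).
Local Notation C := R[i].
Local Notation Re := (@complex.Re R).
Local Notation P := (sphi phi).
Local Notation dP := (dsphi phi).
Local Notation q := (ssqrtphi phi).
Local Notation dq := (dssqrtphi phi).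
Implicit Types (u v : 'rV[R]_N -> 'cV[C]_m) (Du Dv : 'I_N -> 'rV[R]_N -> 'cV[C]_m).

Lemma form0l (A : 'I_N -> 'I_N -> 'M[C]_m) X Y : (forall k, X k = 0) -> form A X Y = 0.
Proof.
move=> X0; have -> : X = (fun k => 0%:C%C *: X k) by apply/funext => k; rewrite X0 scaler0.
by rewrite formZl mul0r.
Qed.

Lemma form_radial_grad (A : 'I_N -> 'I_N -> 'M[C]_m) u Du (f1 df1 f2 df2 : R -> R) x :
  let t := enorm (u x) in
  let a := f1 t / t in let b := (df1 t - f1 t / t) / t ^+ 2 in
  let c := f2 t / t in let d := (df2 t - f2 t / t) / t ^+ 2 in
  form A (radial_grad f1 df1 u Du ^~ x) (radial_grad f2 df2 u Du ^~ x) =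
  a * c * form A (Du ^~ x) (Du ^~ x) + b * c * form A (radial_part (u x) (Du ^~ x)) (Du ^~ x) +
  a * d * form A (Du ^~ x) (radial_part (u x) (Du ^~ x)) +
  b * d * form A (radial_part (u x) (Du ^~ x)) (radial_part (u x) (Du ^~ x)).
Proof. exact: form_radial. Qed.

Lemma radial_grad0 f df u Du k x : u x = 0 -> radial_grad f df u Du k x = 0.
Proof. by move=> u0; rewrite /radial_grad u0 enorm0 invr0 mulr0 scale0r scaler0 add0r. Qed.

Lemma radial_vec0 f u x : u x = 0 -> radial_vec f u x = 0.
Proof. by move=> u0; rewrite /radial_vec u0 scaler0. Qed.

Lemma enorm_radial_vec f u x : u x != 0 -> 0 < f (enorm (u x)) ->
  enorm (radial_vec f u x) = f (enorm (u x)).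
Proof.
move=> u0 f0; have t0 : 0 < enorm (u x) by rewrite enorm_gt0.
by rewrite enormZ gtr0_norm ?divr_gt0// divfK// gt_eqF.
Qed.

Lemma herm_radial f df u Du k x : u x != 0 -> let t := enorm (u x) in
  Re (herm (radial_vec f u x) (radial_grad f df u Du k x)) =
  f t / t * df t * Re (herm (u x) (Du k x)).
Proof.
move=> u0 t; have t0 : 0 < t by rewrite enorm_gt0.
rewrite /radial_vec /radial_grad hermZl hermDr !hermZr Re_realM ReD !Re_realM Re_herm -/t.
by field; rewrite gt_eqF.
Qed.

(** The left side is factored as the form at p + lam (radial part) and p - lam (radial part). The
    radial correction of a rearrangement is parallel to u, so the two arguments differ only in their
    coefficients [bp] and [bm] along the radial part. *)
Lemma integrand_radial (A : 'I_N -> 'I_N -> 'M[C]_m) f df u Du x (l : R) :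
  u x != 0 -> 0 < f (enorm (u x)) ->
  let t := enorm (u x) in
  let v := radial_vec f u x in let p := radial_grad f df u Du ^~ x in
  let bp := (df t - f t / t + l * df t) / t ^+ 2 in
  let bm := (df t - f t / t - l * df t) / t ^+ 2 in
  let r := f t / t in
  form A p p + l / enorm v ^+ 2 * (form A (radial_part v p) p - form A p (radial_part v p)) -
    (l / enorm v ^+ 2) ^+ 2 * form A (radial_part v p) (radial_part v p) =
  r * r * form A (Du ^~ x) (Du ^~ x) + bp * r * form A (radial_part (u x) (Du ^~ x)) (Du ^~ x) +
  r * bm * form A (Du ^~ x) (radial_part (u x) (Du ^~ x)) +
  bp * bm * form A (radial_part (u x) (Du ^~ x)) (radial_part (u x) (Du ^~ x)).
Proof.
move=> u0 f0 t v p bp bm r; have t0 : 0 < t by rewrite enorm_gt0.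
rewrite -/t in f0.
have ev : enorm v = f t by exact: enorm_radial_vec.
set lam := l / enorm v ^+ 2.
have -> : form A p p + lam * (form A (radial_part v p) p - form A p (radial_part v p)) -
    lam ^+ 2 * form A (radial_part v p) (radial_part v p) =
  1 * 1 * form A p p + lam * 1 * form A (radial_part v p) p + 1 * (- lam) * form A p (radial_part v p) +
  lam * (- lam) * form A (radial_part v p) (radial_part v p) by ring.
rewrite -form_radial -form_radial; congr (form A _ _); apply/funext => k.
- rewrite /p herm_radial// -/t scale1r /radial_grad -/t -/r -addrA; congr (_ + _).
  rewrite /v /radial_vec -/t -/r scalerA -scalerDl -!rmorphM -rmorphD; congr (_%:C%C *: _).
  by rewrite /lam ev /bp /r; field; rewrite !gt_eqF.
- rewrite /p herm_radial// -/t scale1r /radial_grad -/t -/r -addrA; congr (_ + _).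
  rewrite /v /radial_vec -/t -/r scalerA -scalerDl -!rmorphM -rmorphD; congr (_%:C%C *: _).
  by rewrite /lam ev /bm /r; field; rewrite !gt_eqF.
Qed.

End backward.

(** * The two implications *)

Section backward2.
Context {R : realType} {N m : nat}.
Variable phi : R -> R.
Hypothesis Hphi : phi_conditions phi.
Variable Omega : set 'rV[R]_N.
Hypothesis oO : open Omega.
Let mO : measurable Omega := open_measurable_rV oO.
Local Notation mu := (lebesgue_rV N : {sigma_finite_measure set 'rV[R]_N -> \bar R}).
Local Notation C := R[i].
Local Notation Re := (@complex.Re R).
Local Notation P := (sphi phi).
Local Notation dP := (dsphi phi).
Local Notation q := (ssqrtphi phi).
Local Notation dq := (dssqrtphi phi).
Variable A : 'I_N -> 'I_N -> 'rV[R]_N -> 'M[C]_m.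
Hypothesis mA : forall h k i j, cmeasurable Omega (fun x => A h k x i j).

Definition condition_integrand (v : 'rV[R]_N -> 'cV[C]_m) (Dv : 'I_N -> 'rV[R]_N -> 'cV[C]_m) x : C :=
  \sum_h \sum_k
        (herm (A h k x *m Dv k x) (Dv h x) +
         (if v x == 0 then 0 else
            (Lambda phi (enorm (v x)) * enorm (v x) ^- 2
               * Re (herm (v x) (Dv k x)))%:C%C
              * herm ((A h k x - adjmx (A k h x)) *m v x) (Dv h x)
            - (Lambda phi (enorm (v x)) ^+ 2 * enorm (v x) ^- 4
                 * Re (herm (v x) (Dv k x))
                 * Re (herm (v x) (Dv h x)))%:C%C
              * herm (A h k x *m v x) (v x))).

Lemma H01_vec_cmeasurable u Du : H01_vec Omega u Du ->
  (forall i, cmeasurable Omega (fun x => u x i 0 : C)) /\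
  (forall k (i : 'I_m), cmeasurable Omega (fun x => Du k x i 0 : C)).
Proof.
move=> Hu; split=> [i|k i]; have [[Lu LDu _] _] := Hu i; first by case: Lu.
by case: (LDu k).
Qed.

Lemma condition_dissipative :
  (forall v Dv, H01_vec Omega v Dv -> 0 <= Re (cintegral Omega (condition_integrand v Dv))) ->
  functional_dissipative phi Omega A.
Proof.
move=> cond u Du Dw Hu Hw.
pose w x := phi_scale phi (u x).
pose V x := u x + w x; pose DV k x := Du k x + Dw k x.
have HV : H01_vec Omega V DV by exact: H01_vecD.
have [|k [k0 kt kh dk]] := comb_inverse Hphi (lexx 0) ler01; first by rewrite add0r.
have {}kt t : 0 < t -> k t + P (k t) = t by move=> t0; rewrite -[RHS](kt t t0) mul0r add0r mul1r.
have {}kh s : 0 < s -> k (s + P s) = s by move=> s0; rewrite -[RHS](kh s s0) mul0r add0r mul1r.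
pose X t := (1 + dP (k t))^-1.
have dHE t : (0 * dq (k t) + 1 * (1 + dP (k t))) = 1 + dP (k t) by ring.
have RC (f df : R -> R) : (forall s : R, 0 < s -> is_derive s 1 f (df s)) ->
    (forall s : R, 0 < s -> {for s, continuous df}) ->
    (forall t : R, 0 < t -> is_derive t 1 (f \o k) (df (k t) * X t)) /\
    (forall t : R, 0 < t -> {for t, continuous (fun t => df (k t) * X t)}).
  move=> d1 d2; have := radial_comp Hphi (lexx 0) ler01 _ k0 dk d1 d2.
  move=> /(_ _)[|h1 h2]; first by rewrite add0r.
  have E : (fun t => df (k t) * X t) = (fun t => df (k t) / (0 * dq (k t) + 1 * (1 + dP (k t)))).
    by apply/funext => t; rewrite dHE.
  by split=> t t0; [have := h1 t t0; rewrite dHE|rewrite E; exact: h2].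
have HR (f df : R -> R) L : (forall s : R, 0 < s -> is_derive s 1 f (df s)) ->
    (forall s : R, 0 < s -> {for s, continuous df}) ->
    (forall s, 0 < s -> `|f s| <= L * (s + P s)) ->
    (forall s, 0 < s -> `|df s| <= L * (1 + dP s)) ->
    H01_vec Omega (radial_vec (f \o k) V) (radial_grad (f \o k) (fun t => df (k t) * X t) V DV).
  move=> d1 d2 fL dfL; have [h1 h2] := RC f df d1 d2.
  apply: (H01_vec_radial oO (L := L)) => // t t0; have kt0 := k0 t t0.
    by rewrite -[t in leRHS](kt t t0); exact: fL.
  have dp : 0 < 1 + dP (k t) by rewrite addr_gt0// dsphi_gt0.
  by rewrite normrM normfV (gtr0_norm dp) ler_pdivrMr//; exact: dfL.
have P0 s : 0 < s -> 0 < P s by exact: sphi_gt0.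
have dP0 s : 0 < s -> 0 < dP s by exact: dsphi_gt0.
have Hu' : H01_vec Omega (radial_vec (id \o k) V) (radial_grad (id \o k) (fun t => 1 * X t) V DV).
  apply: (HR id (fun=> 1) 1).
  - by move=> s s0; exact: cvg_cst.
  - by move=> s s0; rewrite mul1r gtr0_norm// lerDl ltW// P0.
  - by move=> s s0; rewrite mul1r normr1 lerDl ltW// dP0.
have Hw' : H01_vec Omega (radial_vec (P \o k) V) (radial_grad (P \o k) (fun t => dP (k t) * X t) V DV).
  apply: (HR P dP 1).
  - by move=> s s0; exact: is_derive_sphi.
  - by move=> s s0; exact: continuous_dsphi.
  - by move=> s s0; rewrite mul1r gtr0_norm ?P0// lerDr ltW.
  - by move=> s s0; rewrite mul1r gtr0_norm ?dP0// lerDr.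
have [L L0 HL] := dssqrtphi_le Hphi.
have Hv' : H01_vec Omega (radial_vec (q \o k) V) (radial_grad (q \o k) (fun t => dq (k t) * X t) V DV).
  (* One constant must bound both quotients: q <= s + P because q^2 = s P <= (s + P)^2, while q' <=
     L (1 + P'). *)
  apply: (HR q dq (1 + L)).
  - by move=> s s0; exact: is_derive_ssqrtphi.
  - by move=> s s0; exact: continuous_dssqrtphi.
  - move=> s s0; have q0 := ssqrtphi_gt0 Hphi s0; have Ps := P0 s s0.
    rewrite gtr0_norm//; apply: (@le_trans _ _ (s + P s)); last first.
      by rewrite mulrDl mul1r lerDl mulr_ge0//; lra.
    rewrite -(@ler_pXn2r _ 2) ?nnegrE//; [|exact: ltW|lra].
    rewrite ssqrtphi_sq// sqrrD mulr2n.
    have := sqr_ge0 s; have := sqr_ge0 (P s); have : 0 <= s * P s by rewrite mulr_ge0 ?ltW.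
    lra.
  - move=> s s0; rewrite gtr0_norm ?dssqrtphi_gt0//; apply: le_trans (HL s s0) _.
    by rewrite ler_wpM2r//; have := dP0 s s0; lra.
have VE x : u x != 0 -> [/\ V x = (1 + phi (enorm (u x)))%:C%C *: u x, V x != 0,
    enorm (V x) = enorm (u x) + P (enorm (u x)), k (enorm (V x)) = enorm (u x) & 0 < enorm (u x)].
  move=> ux0; have s0 : 0 < enorm (u x) by rewrite enorm_gt0.
  have f0 := phi_gt0 Hphi s0; have f1 : 0 < 1 + phi (enorm (u x)) by rewrite addr_gt0.
  have E : V x = (1 + phi (enorm (u x)))%:C%C *: u x.
    by rewrite /V /w /phi_scale (negbTE ux0) rmorphD scalerDl scale1r.
  have E2 : enorm (V x) = enorm (u x) + P (enorm (u x)).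
    by rewrite E enormZ gtr0_norm// /sphi; ring.
  split=> //; last by rewrite E2 kh.
  by rewrite -enorm_gt0 E2 addr_gt0// P0.
have V0 x : u x = 0 -> V x = 0.
  by move=> u0; rewrite /V /w /phi_scale u0 eqxx addr0.
have uE x : radial_vec (id \o k) V x = u x.
  have [u0|u0] := eqVneq (u x) 0; first by rewrite radial_vec0 ?V0// u0.
  have [E V1 E2 E3 s0] := VE x u0; have Ps := P0 _ s0; have f0 := phi_gt0 Hphi s0.
  rewrite /radial_vec /= E3 E2 E scalerA -rmorphM -[RHS]scale1r; congr (_ *: _).
  rewrite -[RHS](rmorph1 (real_complex R)); congr (_%:C%C).
  have : 0 < enorm (u x) + P (enorm (u x)) by rewrite addr_gt0.
  by rewrite /sphi; move: (enorm (u x)) s0 f0 => s s0 f0 h; field; rewrite gt_eqF.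
have wE x : radial_vec (P \o k) V x = w x.
  have [u0|u0] := eqVneq (u x) 0.
    by rewrite radial_vec0 ?V0// /w /phi_scale u0 eqxx.
  have [E V1 E2 E3 s0] := VE x u0; have Ps := P0 _ s0; have f0 := phi_gt0 Hphi s0.
  rewrite /radial_vec /= E3 E2 E scalerA -rmorphM /w /phi_scale (negbTE u0); congr (_%:C%C *: _).
  have : 0 < enorm (u x) + P (enorm (u x)) by rewrite addr_gt0.
  by rewrite /sphi; move: (enorm (u x)) s0 f0 => s s0 f0 h; field; rewrite gt_eqF.
have aeu := H01_vec_unique oO Hu Hu' (fun x _ => esym (uE x)).
have aew := H01_vec_unique oO Hw Hw' (fun x _ => esym (wE x)).
have := cond _ _ Hv'; congr (0 <= _).
transitivity (\int[mu]_(x in Omega) form (fun h k => A h k x)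
   (radial_grad (id \o k) (fun t => 1 * X t) V DV ^~ x)
   (radial_grad (P \o k) (fun t => dP (k t) * X t) V DV ^~ x)).
  apply: eq_Rintegral => x _.
  rewrite [LHS]form_integrand.
  (* The chain-rule gradients are zero here by the convention on division, so both integrands vanish
     without an almost everywhere argument. *)
  have [Vx0|Vx0] := eqVneq (V x) 0.
    have g0 f df j : radial_grad f df V DV j x = 0 by exact: radial_grad0.
    have r0 f df j : radial_part (radial_vec f V x) (radial_grad f df V DV ^~ x) j = 0.
      by rewrite /radial_part radial_vec0// scaler0.
    by rewrite !(form0l, mulr0, subrr, addr0, subr0) // => j; rewrite ?g0 ?r0.
  have t0 : 0 < enorm (V x) by rewrite enorm_gt0.
  have s0 := k0 _ t0.
  rewrite integrand_radial//; last by rewrite /= ssqrtphi_gt0.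
  rewrite form_radial_grad /= enorm_radial_vec//=; last exact: ssqrtphi_gt0.
  have [e1 e2 e3 e4] := coef_identity Hphi s0 (X (enorm (V x))) t0.
  by rewrite mul1r e1 e2 e3 e4.
congr fine; apply: ae_eq_integral => //.
- apply/measurable_EFinP; apply: measurable_form => //.
    by have [_] := H01_vec_cmeasurable Hu'.
  by have [_] := H01_vec_cmeasurable Hw'.
- apply/measurable_EFinP; apply: measurable_form => //.
    by have [_] := H01_vec_cmeasurable Hu.
  by have [_] := H01_vec_cmeasurable Hw.
apply: filterS2 aeu aew => x ux wx Ox; congr EFin.
rewrite /form; congr Re; apply: eq_bigr => h _; apply: eq_bigr => j _.
by rewrite ux// wx.
Qed.

End backward2.

Section coef_limits.
Context {R : realType}.
Variable phi : R -> R.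
Hypothesis Hphi : phi_conditions phi.
Local Notation P := (sphi phi).
Local Notation dP := (dsphi phi).
Local Notation q := (ssqrtphi phi).
Local Notation dq := (dssqrtphi phi).

(** The limits 1, l, -l, -l^2 are the four coefficients of the integrand of the condition in the
    form of [form_integrand]. *)
Lemma coef_limits (eps : nat -> R) (k : nat -> R) (t : R) : 0 < t ->
  (forall n, 0 < eps n) -> eps n @[n --> \oo] --> 0 ->
  (forall n, 0 < k n) -> (forall n, q (k n) + eps n * (k n + P (k n)) = t) ->
  let X n := (dq (k n) + eps n * (1 + dP (k n)))^-1 in
  let be n := (X n - k n / t) / t ^+ 2 in
  let de n := (dP (k n) * X n - P (k n) / t) / t ^+ 2 in
  let l := Lambda phi t / t ^+ 2 in
  [/\ k n / t * (P (k n) / t) @[n --> \oo] --> (1 : R),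
      be n * (P (k n) / t) @[n --> \oo] --> l,
      k n / t * de n @[n --> \oo] --> - l & be n * de n @[n --> \oo] --> - (l ^+ 2)].
Proof.
move=> t0 e0 ecv k0 kt X be de l.
have [z [z0 qz zq zc _]] := Lambda_inverse Hphi.
pose s := z t; have s0 : 0 < s by exact: z0.
have qs : q s = t by exact: qz.
have P0 x : 0 < x -> 0 < P x by exact: sphi_gt0.
have dP0 x : 0 < x -> 0 < dP x by exact: dsphi_gt0.
have qk n : q (k n) = t - eps n * (k n + P (k n)) by rewrite -(kt n) addrK.
(* This a priori bound keeps k + P(k) bounded, so that q(k n) = t - eps (k + P(k)) tends to t;
   continuity of the inverse of q then gives k n -> s. *)
have ks n : k n <= s.
  rewrite leNgt; apply/negP => sk.
  have := is_derive_lt (is_derive_ssqrtphi Hphi) (dssqrtphi_gt0 Hphi) s0 sk.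
  rewrite qs qk; have : 0 <= eps n * (k n + P (k n)).
    by rewrite mulr_ge0 ?(ltW (e0 n))// addr_ge0 ?ltW// ?P0.
  lra.
have qcv : q (k n) @[n --> \oo] --> t.
  apply: (@squeeze_cvgr _ _ _ _ (fun n => t - eps n * (s + P s)) (fun=> t)); last 2 first.
  - rewrite -[X in _ --> X]subr0 -(mul0r (s + P s)); apply: cvgB; first exact: cvg_cst.
    by apply: cvgM => //; exact: cvg_cst.
  - exact: cvg_cst.
  apply: nearW => n; rewrite qk; apply/andP; split.
    rewrite lerD2l lerN2 ler_wpM2l ?(ltW (e0 n))// lerD//.
    exact: sphi_le.
  by rewrite gerBl mulr_ge0 ?(ltW (e0 n))// addr_ge0 ?ltW// ?P0.
have kcv : k n @[n --> \oo] --> s.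
  rewrite (_ : (fun n => k n) = (fun n => z (q (k n)))); last by apply/funext => n; rewrite zq.
  by apply: continuous_cvg => //; exact: zc.
have Pcv : P (k n) @[n --> \oo] --> P s.
  by apply: continuous_cvg => //; exact: is_derive_continuous (is_derive_sphi Hphi s0).
have dPcv : dP (k n) @[n --> \oo] --> dP s.
  by apply: continuous_cvg => //; exact: continuous_dsphi.
have dqcv : dq (k n) @[n --> \oo] --> dq s.
  by apply: continuous_cvg => //; exact: continuous_dssqrtphi.
have dqs0 : 0 < dq s by exact: dssqrtphi_gt0.
have Xcv : X n @[n --> \oo] --> (dq s)^-1.
  apply: cvgV; first by rewrite gt_eqF.
  rewrite -[X in _ --> X]addr0 -(mul0r (1 + dP s)); apply: cvgD => //.
  by apply: cvgM => //; apply: cvgD => //; exact: cvg_cst.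
have cc (u : nat -> R) (a : R) : u n @[n --> \oo] --> a -> u n / t @[n --> \oo] --> a / t.
  by move=> h; apply: cvgM => //; exact: cvg_cst.
have becv : be n @[n --> \oo] --> ((dq s)^-1 - s / t) / t ^+ 2.
  by apply: cvgM; [apply: cvgB => //; exact: cc|exact: cvg_cst].
have decv : de n @[n --> \oo] --> (dP s * (dq s)^-1 - P s / t) / t ^+ 2.
  by apply: cvgM; [apply: cvgB; [exact: cvgM|exact: cc]|exact: cvg_cst].
have kcv' := cc _ _ kcv; have Pcv' := cc _ _ Pcv.
have c0 := sqrt_phi_gt0 Hphi s0; have PE := sphiE Hphi s0.
have h1 := one_plus_Lambda Hphi s0; have h2 := one_minus_Lambda Hphi s0.
rewrite qs in h1 h2; move: PE h1 h2 c0 qs; rewrite /ssqrtphi.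
move: (Num.sqrt (phi s)) => c PE h1 h2 c0 tE.
(* With c = sqrt(phi(s)) and t = s c, the limits are s / t = 1 / c, P / t = c, 1 / q' = (1 + Lambda)
   / c and P' / q' = c (1 - Lambda). *)
have L1 : Lambda phi t = c / dq s - 1 by rewrite -h1; field; rewrite gt_eqF.
have dPE : dP s = c * ((1 - Lambda phi t) * dq s) by rewrite h2; field; rewrite gt_eqF.
have beE : ((dq s)^-1 - s / t) / t ^+ 2 = Lambda phi t / c / t ^+ 2.
  by rewrite L1 -tE; field; rewrite !gt_eqF.
have deE : (dP s * (dq s)^-1 - P s / t) / t ^+ 2 = - c * Lambda phi t / t ^+ 2.
  by rewrite dPE PE -tE; field; rewrite !gt_eqF.
rewrite beE in becv; rewrite deE in decv.
split.
- have -> : 1 = s / t * (P s / t) by rewrite PE -tE; field; rewrite !gt_eqF.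
  exact: cvgM.
- have -> : l = Lambda phi t / c / t ^+ 2 * (P s / t).
    by rewrite /l PE -[in X in _ = _ * X]tE; field; rewrite !gt_eqF.
  exact: cvgM.
- have -> : - l = s / t * (- c * Lambda phi t / t ^+ 2).
    by rewrite /l -[in X in _ = _ / X * _]tE; field; rewrite !gt_eqF.
  exact: cvgM.
- have -> : - (l ^+ 2) = Lambda phi t / c / t ^+ 2 * (- c * Lambda phi t / t ^+ 2).
    by rewrite /l; field; rewrite !gt_eqF.
  exact: cvgM.
Qed.

End coef_limits.

Section forward.
Context {R : realType} {N m : nat}.
Variable phi : R -> R.
Hypothesis Hphi : phi_conditions phi.
Variable Omega : set 'rV[R]_N.
Hypothesis oO : open Omega.
Let mO : measurable Omega := open_measurable_rV oO.
Local Notation mu := (lebesgue_rV N : {sigma_finite_measure set 'rV[R]_N -> \bar R}).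
Local Notation C := R[i].
Local Notation Re := (@complex.Re R).
Local Notation P := (sphi phi).
Local Notation dP := (dsphi phi).
Local Notation q := (ssqrtphi phi).
Local Notation dq := (dssqrtphi phi).
Variable A : 'I_N -> 'I_N -> 'rV[R]_N -> 'M[C]_m.
Hypothesis LA : forall h k i j, Linfty Omega (fun x => A h k x i j).

Lemma Linfty_bound : exists2 M : R, 0 <= M & {ae mu, forall x, Omega x ->
  forall h k i j, Normc.normc (A h k x i j) <= M}.
Proof.
have /choice[M HM] : forall c : ('I_N * 'I_N) * ('I_m * 'I_m), exists M : R,
    {ae mu, forall x, Omega x -> Normc.normc (A c.1.1 c.1.2 x c.2.1 c.2.2) <= M}.
  by move=> c; have [_] := LA c.1.1 c.1.2 c.2.1 c.2.2.
exists (\sum_c `|M c|); first exact: sumr_ge0.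
have : {ae mu, forall x, forall c : ('I_N * 'I_N) * ('I_m * 'I_m),
    Omega x -> Normc.normc (A c.1.1 c.1.2 x c.2.1 c.2.2) <= M c}.
  by apply: filter_forall.
apply: filterS => x Hx Ox h k i j.
apply: le_trans (Hx ((h, k), (i, j)) Ox) _; apply: le_trans (ler_norm _) _.
by rewrite (bigD1 ((h, k), (i, j)))//= lerDl; apply: sumr_ge0.
Qed.

(** Each radial part contributes a factor m t^2, whose t^2 cancels the denominator of its
    coefficient. With the bounds 1, 3, 3, 6 of [coef_bounds] the total is 1 + 3 m + 3 m + 6 m^2,
    independent of b. *)
Lemma form_radial_grad_bound v Dv (x : 'rV[R]_N) (s b M : R) (f1 df1 f2 df2 : R -> R) :
  let t := enorm (v x : 'cV[C]_m) in
  v x != 0 -> 0 < s -> 0 <= b -> q s + b * (s + P s) = t ->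
  let X := (dq s + b * (1 + dP s))^-1 in
  f1 t = s -> df1 t = X -> f2 t = P s -> df2 t = dP s * X ->
  0 <= M -> (forall h k i j, Normc.normc (A h k x i j) <= M) ->
  `|form (fun h k => A h k x) (radial_grad f1 df1 v Dv ^~ x) (radial_grad f2 df2 v Dv ^~ x)|
   <= M * (1 + 6 * m%:R + 6 * m%:R ^+ 2) * sum_normc (Dv ^~ x) ^+ 2.
Proof.
move=> t v0 s0 b0 tE X f1E df1E f2E df2E M0 AM.
have t0 : 0 < t by rewrite enorm_gt0.
rewrite form_radial_grad -/t f1E df1E f2E df2E.
have := coef_bounds Hphi s0 b0; rewrite tE -/X => -[b1 b2 b3 b4].
set p := Dv ^~ x; have n0 := sum_normc_ge0 p; have nr := sum_normc_radial_part (v x) p; rewrite -/t in nr.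
have nr0 := sum_normc_ge0 (radial_part (v x) p).
have F1 := form_le p p AM; have F2 := form_le (radial_part (v x) p) p AM.
have F3 := form_le p (radial_part (v x) p) AM; have F4 := form_le (radial_part (v x) p) (radial_part (v x) p) AM.
have T0 : 0 < t ^+ 2 by rewrite exprn_gt0.
have r0 : 0 <= m%:R :> R by [].
have {}F1 : `|form (fun h k => A h k x) p p| <= M * sum_normc p ^+ 2 by rewrite expr2 mulrA.
have {}F2 : `|form (fun h k => A h k x) (radial_part (v x) p) p| <= t ^+ 2 * (M * m%:R * sum_normc p ^+ 2).
  apply: le_trans F2 _; rewrite [leRHS](_ : _ = M * (m%:R * t ^+ 2 * sum_normc p) * sum_normc p); last by ring.
  by rewrite ler_wpM2r// ler_wpM2l.
have {}F3 : `|form (fun h k => A h k x) p (radial_part (v x) p)| <= t ^+ 2 * (M * m%:R * sum_normc p ^+ 2).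
  apply: le_trans F3 _; rewrite [leRHS](_ : _ = M * sum_normc p * (m%:R * t ^+ 2 * sum_normc p)); last by ring.
  by rewrite ler_wpM2l// mulr_ge0.
have {}F4 : `|form (fun h k => A h k x) (radial_part (v x) p) (radial_part (v x) p)| <=
    t ^+ 2 * t ^+ 2 * (M * m%:R ^+ 2 * sum_normc p ^+ 2).
  apply: le_trans F4 _.
  rewrite [leRHS](_ : _ = M * (m%:R * t ^+ 2 * sum_normc p) * (m%:R * t ^+ 2 * sum_normc p)); last by ring.
  apply: ler_pM => //; first by rewrite mulr_ge0.
  by rewrite ler_wpM2l.
have key (y D K c F : R) : `|y| <= K -> 0 < D -> `|F| <= D * c -> `|y / D * F| <= K * c.
  move=> yK D0 FD; rewrite !normrM normfV (gtr0_norm D0).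
  rewrite -mulrA ler_pM// ?mulr_ge0 ?invr_ge0 ?(ltW D0)//.
  by rewrite mulrC ler_pdivrMr// [leRHS]mulrC.
set G1 := form _ p p in F1 *; set G2 := form _ _ p in F2 *.
set G3 := form _ p _ in F3 *; set G4 := form _ _ _ in F4 *.
have e2 : (X - s / t) / t ^+ 2 * (P s / t) = (X - s / t) * (P s / t) / t ^+ 2 by ring.
have e3 : s / t * ((dP s * X - P s / t) / t ^+ 2) = s / t * (dP s * X - P s / t) / t ^+ 2 by ring.
have e4 : (X - s / t) / t ^+ 2 * ((dP s * X - P s / t) / t ^+ 2) =
  (X - s / t) * (dP s * X - P s / t) / (t ^+ 2 * t ^+ 2) by exact: mulf_div.
rewrite e2 e3 e4.
have k1 : `|s / t * (P s / t) * G1| <= 1 * (M * sum_normc p ^+ 2).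
  by rewrite normrM; apply: ler_pM.
have k2 := key _ _ _ _ _ b2 T0 F2; have k3 := key _ _ _ _ _ b3 T0 F3.
have k4 := key _ _ _ _ _ b4 (mulr_gt0 T0 T0) F4.
apply: le_trans (ler_normD _ _) _.
apply: le_trans (lerD (le_trans (ler_normD _ _) (lerD (ler_normD _ _) (lexx _))) (lexx _)) _.
apply: le_trans (lerD (lerD (lerD k1 k2) k3) k4) _.
rewrite le_eqVlt; apply/orP; left; apply/eqP; ring.
Qed.

End forward.

Section forward2.
Context {R : realType} {N m : nat}.
Variable phi : R -> R.
Hypothesis Hphi : phi_conditions phi.
Variable Omega : set 'rV[R]_N.
Hypothesis oO : open Omega.
Let mO : measurable Omega := open_measurable_rV oO.
Local Notation mu := (lebesgue_rV N : {sigma_finite_measure set 'rV[R]_N -> \bar R}).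
Local Notation C := R[i].
Local Notation Re := (@complex.Re R).
Local Notation P := (sphi phi).
Local Notation dP := (dsphi phi).
Local Notation q := (ssqrtphi phi).
Local Notation dq := (dssqrtphi phi).
Variable A : 'I_N -> 'I_N -> 'rV[R]_N -> 'M[C]_m.
Hypothesis LA : forall h k i j, Linfty Omega (fun x => A h k x i j).

Lemma dissipative_condition v Dv : functional_dissipative phi Omega A ->
  H01_vec Omega v Dv -> 0 <= Re (cintegral Omega (condition_integrand phi A v Dv)).
Proof.
move=> diss Hv.
have mA h k i j : cmeasurable Omega (fun x => A h k x i j) by have [] := LA h k i j.
have [mv mDv] := H01_vec_cmeasurable Hv.
pose eps n : R := n.+1%:R^-1.
have e0 n : 0 < eps n by rewrite invr_gt0.
have ecv : eps n @[n --> \oo] --> 0 by exact: cvg_harmonic.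
have /choice[k Hk] : forall n, exists k : R -> R, [/\ forall t, 0 < t -> 0 < k t,
    forall t, 0 < t -> q (k t) + eps n * (k t + P (k t)) = t &
    forall t : R, 0 < t -> is_derive t 1 k (1 * dq (k t) + eps n * (1 + dP (k t)))^-1].
  move=> n; have [|k [k0 kt _ dk]] := comb_inverse Hphi ler01 (ltW (e0 n)).
    by rewrite ltr_pwDl// ltW.
  by exists k; split=> // t t0; have := kt t t0; rewrite mul1r.
pose X n t := (1 * dq (k n t) + eps n * (1 + dP (k n t)))^-1.
have P0 s : 0 < s -> 0 < P s by exact: sphi_gt0.
have dP0 s : 0 < s -> 0 < dP s by exact: dsphi_gt0.
have HR n (f df : R -> R) : (forall s : R, 0 < s -> is_derive s 1 f (df s)) ->
    (forall s : R, 0 < s -> {for s, continuous df}) ->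
    (forall s, 0 < s -> `|f s| <= s + P s) ->
    (forall s, 0 < s -> `|df s| <= 1 + dP s) ->
    H01_vec Omega (radial_vec (f \o k n) v) (radial_grad (f \o k n) (fun t => df (k n t) * X n t) v Dv).
  move=> d1 d2 fL dfL; have [k0 kt dk] := Hk n.
  have ab0 : 0 < 1 + eps n by rewrite ltr_pwDl// ltW.
  have [h1 h2] := radial_comp Hphi ler01 (ltW (e0 n)) ab0 k0 dk d1 d2.
  (* Only the perturbation eps (s + P) is used in this Lipschitz bound; it degenerates as n grows,
     but it serves just to place each field in H^1_0. *)
  apply: (H01_vec_radial oO (L := (eps n)^-1)) => // t t0; have kt0 := k0 t t0.
    rewrite -[t in leRHS](kt t t0) ler_pdivlMl//.
    apply: (@le_trans _ _ (eps n * (k n t + P (k n t)))).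
      by rewrite ler_wpM2l ?(ltW (e0 n))//; exact: fL.
    by rewrite lerDr ltW// ssqrtphi_gt0.
  have q0 := dssqrtphi_gt0 Hphi kt0; have dPk := dP0 _ kt0.
  have dH0 : 0 < 1 * dq (k n t) + eps n * (1 + dP (k n t)).
    by rewrite mul1r addr_gt0// mulr_gt0// addr_gt0.
  rewrite normrM /X normfV (gtr0_norm dH0) ler_pdivrMr// mulrC ler_pdivlMr//.
  apply: (@le_trans _ _ (eps n * (1 + dP (k n t)))).
    by rewrite mulrC ler_wpM2l ?(ltW (e0 n))//; exact: dfL.
  by rewrite mul1r lerDr ltW.
have Hu n : H01_vec Omega (radial_vec (id \o k n) v) (radial_grad (id \o k n) (fun t => 1 * X n t) v Dv).
  apply: (HR n id (fun=> 1)) => [s s0|s s0|s s0].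
  - exact: cvg_cst.
  - by rewrite gtr0_norm// lerDl ltW// P0.
  - by rewrite normr1 lerDl ltW// dP0.
have Hw n : H01_vec Omega (radial_vec (P \o k n) v) (radial_grad (P \o k n) (fun t => dP (k n t) * X n t) v Dv).
  apply: (HR n P dP).
  - by move=> s s0; exact: is_derive_sphi.
  - by move=> s s0; exact: continuous_dsphi.
  - by move=> s s0; rewrite gtr0_norm ?P0// lerDr ltW.
  - by move=> s s0; rewrite gtr0_norm ?dP0// lerDr.
have wE n : radial_vec (P \o k n) v = (fun x => phi_scale phi (radial_vec (id \o k n) v x)).
  apply/funext => x; have [v0|v0] := eqVneq (v x) 0.
    by rewrite !radial_vec0// /phi_scale eqxx.
  have [k0 _ _] := Hk n; have t0 : 0 < enorm (v x) by rewrite enorm_gt0.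
  have en := enorm_radial_vec (f := id \o k n) v0 (k0 _ t0).
  rewrite /phi_scale ifF; last by rewrite -enorm_eq0 en gt_eqF// /= k0.
  rewrite en /radial_vec /= scalerA -rmorphM; congr (_%:C%C *: _).
  by rewrite /sphi; ring.
pose fn n x := form (fun h k => A h k x)
   (radial_grad (id \o k n) (fun t => 1 * X n t) v Dv ^~ x)
   (radial_grad (P \o k n) (fun t => dP (k n t) * X n t) v Dv ^~ x).
have fn0 n : 0 <= \int[mu]_(x in Omega) fn n x.
  have Hw' := Hw n; rewrite wE in Hw'.
  exact: (diss _ _ _ (Hu n) Hw').
pose lam t := Lambda phi t / t ^+ 2.
pose F x := form (fun h k => A h k x) (Dv ^~ x) (Dv ^~ x) +
  lam (enorm (v x)) * (form (fun h k => A h k x) (radial_part (v x) (Dv ^~ x)) (Dv ^~ x) -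
    form (fun h k => A h k x) (Dv ^~ x) (radial_part (v x) (Dv ^~ x))) -
  lam (enorm (v x)) ^+ 2 * form (fun h k => A h k x) (radial_part (v x) (Dv ^~ x)) (radial_part (v x) (Dv ^~ x)).
rewrite (_ : Re _ = \int[mu]_(x in Omega) F x); last first.
  by apply: eq_Rintegral => x _; rewrite [LHS]form_integrand.
have [M M0 AM] := Linfty_bound LA.
have ae0 := H01_vec_zero oO Hv.
pose K := M * (1 + 6 * m%:R + 6 * m%:R ^+ 2).
have K0 : 0 <= K by exact: mulr_ge0.
have [iF _ cvI] : [/\ mu.-integrable Omega (EFin \o F),
    [sequence \int[mu]_(x in Omega) `|(fn n x)%:E - (F x)%:E|]_n @ \oo --> 0 &
    [sequence \int[mu]_(x in Omega) (fn n x)%:E]_n @ \oo --> \int[mu]_(x in Omega) (F x)%:E]%E.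
  apply: (@dominated_convergence _ _ _ mu _ mO (fun n x => (fn n x)%:E) (EFin \o F)
    (EFin \o (fun x => K * sum_normc (Dv ^~ x) ^+ 2))).
  - move=> n; apply/measurable_EFinP; apply: measurable_form => //.
      by have [_] := H01_vec_cmeasurable (Hu n).
    by have [_] := H01_vec_cmeasurable (Hw n).
  - have men := measurable_enorm mv.
    have mlam : measurable_fun Omega (fun x => lam (enorm (v x))).
      apply: (measurable_comp_pos (h := lam) (q := fun x => enorm (v x))) => // [t t0|x _]; last exact: enorm_ge0.
      apply: cvgM; first exact: continuous_Lambda.
      apply: cvgV; first by rewrite expf_neq0// gt_eqF.
      by rewrite expr2; under eq_fun do rewrite expr2; exact: cvgM.
    have mrad j i : cmeasurable Omega (fun x => radial_part (v x) (Dv ^~ x) j i 0).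
      rewrite (_ : (fun x => _) = (fun x => (Re (herm (v x) (Dv j x)))%:C%C * v x i 0)); last first.
        by apply/funext => x; rewrite mxE.
      apply: cmeasurableM => //; apply: cmeasurable_real.
      by have [] := measurable_herm mv (mDv j).
    apply/measurable_EFinP; apply: measurable_funB.
      apply: measurable_funD; first exact: measurable_form.
      by apply: measurable_funM => //; apply: measurable_funB; exact: measurable_form.
    apply: measurable_funM; first exact: measurable_funX.
    exact: measurable_form.
  - apply: filterS ae0 => x v0 Ox; apply: cvg_EFin; first exact: nearW.
    rewrite /comp /=; have [vx0|vx0] := eqVneq (v x) 0.
      (* Unlike [fn], [F] keeps the term in Dv alone where v = 0; it vanishes there only because Dv
         = 0 almost everywhere on that set. *)
      rewrite (_ : F x = 0); last first.
        have D0 := v0 Ox vx0.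
        by rewrite /F !(form0l, mulr0, subrr, addr0, subr0) // => j; rewrite /radial_part ?D0// vx0 scaler0.
      rewrite (_ : (fun n => _) = (fun=> 0)); first exact: cvg_cst.
      by apply/funext => n; rewrite /fn form0l// => j; rewrite radial_grad0.
    have t0 : 0 < enorm (v x) by rewrite enorm_gt0.
    have [|n|l1 l2 l3 l4] := coef_limits Hphi t0 e0 ecv (k := fun n => k n (enorm (v x))).
    + by move=> n; have [k0 _ _] := Hk n; exact: k0.
    + by have [_ kt _] := Hk n; exact: kt.
    rewrite (_ : (fun n => _) = (fun n =>
      k n (enorm (v x)) / enorm (v x) * (P (k n (enorm (v x))) / enorm (v x)) *
        form (fun h k => A h k x) (Dv ^~ x) (Dv ^~ x) +
      (X n (enorm (v x)) - k n (enorm (v x)) / enorm (v x)) / enorm (v x) ^+ 2 * (P (k n (enorm (v x))) / enorm (v x)) *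
        form (fun h k => A h k x) (radial_part (v x) (Dv ^~ x)) (Dv ^~ x) +
      k n (enorm (v x)) / enorm (v x) * ((dP (k n (enorm (v x))) * X n (enorm (v x)) - P (k n (enorm (v x))) / enorm (v x)) / enorm (v x) ^+ 2) *
        form (fun h k => A h k x) (Dv ^~ x) (radial_part (v x) (Dv ^~ x)) +
      (X n (enorm (v x)) - k n (enorm (v x)) / enorm (v x)) / enorm (v x) ^+ 2 *
       ((dP (k n (enorm (v x))) * X n (enorm (v x)) - P (k n (enorm (v x))) / enorm (v x)) / enorm (v x) ^+ 2) *
        form (fun h k => A h k x) (radial_part (v x) (Dv ^~ x)) (radial_part (v x) (Dv ^~ x)))); last first.
      by apply/funext => n; rewrite /fn form_radial_grad /= mul1r.
    have -> : F x = 1 * form (fun h k => A h k x) (Dv ^~ x) (Dv ^~ x) +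
      lam (enorm (v x)) * form (fun h k => A h k x) (radial_part (v x) (Dv ^~ x)) (Dv ^~ x) +
      - lam (enorm (v x)) * form (fun h k => A h k x) (Dv ^~ x) (radial_part (v x) (Dv ^~ x)) +
      - (lam (enorm (v x)) ^+ 2) * form (fun h k => A h k x) (radial_part (v x) (Dv ^~ x)) (radial_part (v x) (Dv ^~ x)).
      by rewrite /F; ring.
    have XE n : X n (enorm (v x)) = (dq (k n (enorm (v x))) + eps n * (1 + dP (k n (enorm (v x)))))^-1.
      by rewrite /X mul1r.
    under eq_fun do rewrite XE.
    by apply: cvgD; [apply: cvgD; [apply: cvgD|]|]; apply: cvgM => //; exact: cvg_cst.
  - apply: integrable_EFinZ => //; apply: L2r_sq_integrable => //.
    apply: L2r_sum => // j; apply: L2r_sum => // i; apply: L2_normc.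
    by have [[_ + _] _] := Hv i; exact.
  - apply: filterS AM => x AM n Ox; rewrite /comp abse_EFin lee_fin.
    have [vx0|vx0] := eqVneq (v x) 0.
      rewrite /fn form0l; last by move=> j; rewrite radial_grad0.
      by rewrite normr0 mulr_ge0 ?sqr_ge0.
    have t0 : 0 < enorm (v x) by rewrite enorm_gt0.
    have [k0 kt _] := Hk n.
    apply: (form_radial_grad_bound Hphi Dv vx0 (k0 _ t0) (ltW (e0 n)) (kt _ t0)) => //.
    + by rewrite mul1r /X mul1r.
    + by rewrite /X mul1r.
    + exact: AM.
have /fineK EF : (\int[mu]_(x in Omega) (F x)%:E)%E \is a fin_num by exact: integrable_fin_num.
rewrite -EF in cvI.
by apply: (cvgr_to_ge (fine_cvg cvI)); apply: nearW => n; exact: fn0.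
Qed.

End forward2.

Theorem lemma6 (R : realType) (N m : nat) (Omega : set 'rV[R]_N)
    (A : 'I_N -> 'I_N -> 'rV[R]_N -> 'M[R[i]]_m) (phi : R -> R) :
  domain Omega ->
  (forall h k i j, Linfty Omega (fun x => A h k x i j)) ->
  phi_conditions phi ->
  functional_dissipative phi Omega A <->
  forall (v : 'rV[R]_N -> 'cV[R[i]]_m)
         (Dv : 'I_N -> 'rV[R]_N -> 'cV[R[i]]_m),
    H01_vec Omega v Dv ->
    0 <= complex.Re (cintegral Omega (fun x =>
      \sum_h \sum_k
        (herm (A h k x *m Dv k x) (Dv h x) +
         (if v x == 0 then 0 else
            (Lambda phi (enorm (v x)) * enorm (v x) ^- 2
               * complex.Re (herm (v x) (Dv k x)))%:C%C
              * herm ((A h k x - adjmx (A k h x)) *m v x) (Dv h x)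
            - (Lambda phi (enorm (v x)) ^+ 2 * enorm (v x) ^- 4
                 * complex.Re (herm (v x) (Dv k x))
                 * complex.Re (herm (v x) (Dv h x)))%:C%C
              * herm (A h k x *m v x) (v x))))).
Proof.
move=> [oO _ _] LA Hphi; split=> [diss v Dv Hv|cond].
  exact: (dissipative_condition Hphi oO LA diss Hv).
apply: (condition_dissipative Hphi oO) => // h k i j.
by have [] := LA h k i j.
Qed.
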